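(* Let $p\ge 0$ be a fixed integer and suppose $T/\sqrt{N}\to\infty$ as $N\to\infty$. Let $\epsilon_1,\dots,\epsilon_N$ be independent random vectors with $\epsilon_i\sim N_T(\mathbf 0,\sigma_i^2 I_T)$, $\sigma_i>0$, for each $i$. Let $$S_N=\sum_{1\le i<j\le N}T\hat\rho_{ij}^2,\qquad \mu_N=\frac{T}{(T-p)^2}\sum_{1\le i<j\le N}\mathrm{tr}(P_iP_j).$$ Then $(S_N-\mu_N)/N$ converges in distribution to $N(0,1)$ as $N\to\infty$.
   Context: A prime denotes transpose and $\|\cdot\|$ is the Euclidean norm. For each $N$, $T=T_N>p$ is an integer depending on $N$. For $i=1,\dots,N$, $x_i$ is a non-random real $T\times p$ matrix (it may depend on $N$) with $x_i'x_i$ invertible, and $P_i=I_T-x_i(x_i'x_i)^{-1}x_i'$; when $p=0$, $P_i=I_T$. For random vectors $\epsilon_i=(\epsilon_{i1},\dots,\epsilon_{iT})'\in\mathbb R^T$ (the errors in the linear regressions $y_i=x_i\beta_i+\epsilon_i$, whose OLS residual vectors are $P_i\epsilon_i$), the sample correlation coefficients of the residuals are $$\hat\rho_{ij}=\frac{\epsilon_i'P_iP_j\epsilon_j}{\|P_i\epsilon_i\|\,\|P_j\epsilon_j\|}.$$ $N_T(\mathbf 0,\sigma^2I_T)$ is the $T$-dimensional normal distribution with mean $\mathbf 0$ and covariance $\sigma^2I_T$. *)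

(* Defs.v *)
(* Built on MathComp-Analysis, over an arbitrary [R : realType]. *)
From HB Require Import structures.
From mathcomp Require Import all_boot all_order all_algebra.
From mathcomp Require Import all_classical all_reals all_analysis.

Set Implicit Arguments.
Unset Strict Implicit.
Unset Printing Implicit Defensive.

Import Order.TTheory GRing.Theory Num.Theory.
Import numFieldNormedType.Exports.

Local Open Scope classical_set_scope.
Local Open Scope ring_scope.

(* A random vector of R^n is a random variable with values in [n.-tuple R],
   which carries the product (= Borel) sigma-algebra in the library; matrix
   computations are done on the associated column vector. *)
Definition col_of_tuple (R : realType) (n : nat) (t : n.-tuple R) : 'cV[R]_n :=
  \col_k tnth t k.

(* The norm [`|v|] which the library puts on matrices is the sup norm. *)
Definition enorm (R : realType) (n : nat) (v : 'cV[R]_n) : R :=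
  Num.sqrt (\sum_k v k 0 ^+ 2).

(* Integral over R^n with respect to n-dimensional Lebesgue measure, as an
   iterated integral; only used for nonnegative Borel functions, for which the
   two coincide by Tonelli's theorem. *)
Fixpoint lebesgue_integral_tuple (R : realType) (n : nat) :
    (n.-tuple R -> \bar R) -> \bar R :=
  match n with
  | 0 => fun f => f [tuple]
  | m.+1 => fun f =>
      (\int[lebesgue_measure]_x
         lebesgue_integral_tuple (fun t : m.-tuple R => f (cons_tuple x t)))%E
  end.

(* Density of N_n(m, S), for S symmetric positive definite. *)
Definition multinormal_pdf (R : realType) (n : nat) (m : 'cV[R]_n)
    (S : 'M[R]_n) (v : 'cV[R]_n) : R :=
  expR (- (((v - m)^T *m invmx S *m (v - m)) 0 0 / 2)) /
  Num.sqrt ((2 * pi) ^+ n * \det S).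

(* The law of X is N_n(m, S), for S symmetric positive definite. *)
Definition multinormal_law (R : realType) (d : measure_display)
    (Om : measurableType d) (Pr : probability Om R) (n : nat)
    (X : {RV Pr >-> n.-tuple R}) (m : 'cV[R]_n) (S : 'M[R]_n) : Prop :=
  forall A : set (n.-tuple R), measurable A ->
    distribution Pr X A =
    lebesgue_integral_tuple
      (fun t => (multinormal_pdf m S (col_of_tuple t) * \1_A t)%:E).

Definition mutually_independent (R : realType) (d d' : measure_display)
    (Om : measurableType d) (E : measurableType d') (Pr : probability Om R)
    (I : finType) (X : I -> {RV Pr >-> E}) : Prop :=
  forall (J : {set I}) (A : I -> set E), (forall i, measurable (A i)) ->
    Pr (\bigcap_(i in [set` J]) (X i @^-1` A i)) =
    (\prod_(i in J) Pr (X i @^-1` A i))%E.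

(* The variables may live on different probability spaces; the limit is given
   by its law mu. *)
Definition cvg_in_distribution (R : realType) (d : nat -> measure_display)
    (Om : forall n, measurableType (d n)) (Pr : forall n, probability (Om n) R)
    (X : forall n, Om n -> R)
    (mu : probability (measurableTypeR R) R) : Prop :=
  (forall n, measurable_fun [set: Om n] (X n)) /\
  forall r : R, {for r, continuous (fun s : R => mu [set` `]-oo, s]])} ->
    Pr n (X n @^-1` `]-oo, r]) @[n --> \oo] --> mu [set` `]-oo, r]].

(* When p = 0 this is 1%:M, since the subtracted product then vanishes. *)
Definition resid_proj (R : realType) (T p : nat) (x : 'M[R]_(T, p)) : 'M[R]_T :=
  1%:M - x *m invmx (x^T *m x) *m x^T.

(* Correlation of the residuals Q1 e1 and Q2 e2; it is 0 when one of them
   vanishes, because of the convention a / 0 = 0. *)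
Definition resid_corr (R : realType) (T : nat) (Q1 Q2 : 'M[R]_T)
    (e1 e2 : 'cV[R]_T) : R :=
  (e1^T *m Q1 *m Q2 *m e2) 0 0 / (enorm (Q1 *m e1) * enorm (Q2 *m e2)).

Definition corr_stat (R : realType) (T p N : nat) (x : 'I_N -> 'M[R]_(T, p))
    (e : 'I_N -> 'cV[R]_T) : R :=
  \sum_(i < N) \sum_(j < N | (i < j)%N)
    T%:R * resid_corr (resid_proj (x i)) (resid_proj (x j)) (e i) (e j) ^+ 2.

Definition corr_center (R : realType) (T p N : nat)
    (x : 'I_N -> 'M[R]_(T, p)) : R :=
  T%:R / (T%:R - p%:R) ^+ 2 *
  \sum_(i < N) \sum_(j < N | (i < j)%N)
    \tr (resid_proj (x i) *m resid_proj (x j)).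

(* Main.v *)
(* Let m = T - p, let A_i be the orthogonal projection onto the line of the i-th
   residual vector, and B_i = A_i - P_i / m.  Then rho_ij^2 = tr (A_i A_j), the
   B_i are independent and centred with tr B_i = 0, and
     (S_N - mu_N) / N = sum_k D_k,
     D_k = (T / N) tr (B_k (sum_(i < k) B_i - K_k)),
   where K_k = (1 / m) sum_(j <> k) (1 - P_j) is deterministic and small because
   1 - P_j has rank p.  Thus the D_k are martingale differences.  Gaussian
   integration by parts gives the moments of tr (B_k X): the second one is
   2 (tr (P X P X) - tr (P X)^2 / m) / (m (m + 2)), the fourth one is at most a
   constant times its square.  As tr ((sum_(i < k) B_i)^2) concentrates around k
   with fluctuations of order N / m, the conditional variance of D_k is close
   in L^1 to (2 k + 1) / N^2, with total error O(sqrt N / m).  Replacing the D_k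
   one at a time by independent Gaussian variables of variance (2 k + 1) / N^2
   yields a bound O(sqrt N / m + 1 / sqrt N) for smooth test functions, and
   indicators of half-lines are sandwiched between cubic splines. *)
Require Import Defs.
From HB Require Import structures.
From mathcomp Require Import all_boot all_order all_algebra.
From mathcomp Require Import all_classical all_reals all_analysis.
From mathcomp Require Import measurable_realfun ring lra.

Set Implicit Arguments.
Unset Strict Implicit.
Unset Printing Implicit Defensive.

Import Order.TTheory GRing.Theory Num.Theory.
Import numFieldNormedType.Exports.

Local Open Scope classical_set_scope.
Local Open Scope ring_scope.

(** * Random variables with all moments *)

(** Two features are hidden by the overview. First, the moments of a residual direction are found
    without polar coordinates and without the independence of direction and length. For a quadratic
    form q living on the range of P and r = |P e|^2, integration by parts against e'Pe relates the
    mean of q^a / r^l to that of q^a / r^(l+1), so the moments of q / r reduce to Gaussian moments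
    of q. Second, no conditional expectation is formed: as the errors are independent, fixing all
    but one of them is Fubini's theorem, and a conditional identity is stated as an equality of
    means against a multiplier depending on the others. The replacement variances (2 k + 1) / N^2
    are deterministic and sum to exactly 1, so the Gaussian parts form a heat flow running from
    variance 1 down to 0, and the randomness of the true conditional variance enters only as an L^1
    error. The quantitative bound is proved for each fixed N with N <= m^2, with constants depending
    on p alone; T / sqrt N -> oo makes this condition hold eventually. *)

Definition mean d (Om : measurableType d) (R : realType)
  (P : probability Om R) (f : Om -> R) : R := \int[P]_w f w.

(** Unlike integrability, this is stable under products, so the integrability of every polynomial
    expression below follows from closure rules. *)
Definition tame d (Om : measurableType d) (R : realType)
  (P : probability Om R) (f : Om -> R) : Prop :=
  measurable_fun setT f /\
  forall n, P.-integrable setT (fun w => (`|f w| ^+ n)%:E).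

Section tame.
Context d (Om : measurableType d) (R : realType) (P : probability Om R).
Implicit Types f g : Om -> R.

Lemma tame_integrable f : tame P f -> P.-integrable setT (EFin \o f).
Proof.
move=> [mf /(_ 1)]; apply: le_integrable => //.
  exact/measurable_EFinP.
by move=> x _ /=; rewrite expr1 !lee_fin normr_id.
Qed.

Lemma eq_tame g f : tame P g -> f =1 g -> tame P f.
Proof. by move=> tg /funext ->. Qed.

Lemma tame_measurable f : tame P f -> measurable_fun setT f.
Proof. by case. Qed.

Lemma tame_le g f : tame P g -> measurable_fun setT f ->
  (forall w, `|f w| <= `|g w|) -> tame P f.
Proof.
move=> [mg ig] mf fg; split=> // n; apply: le_integrable (ig n) => //.
  apply/measurable_EFinP; apply: measurable_funX.
  exact: measurableT_comp.
by move=> w _ /=; rewrite lee_fin !normrX !normr_id; exact: lerXn2r.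
Qed.

Lemma tame_cst c : tame P (cst c).
Proof.
split=> // n.
exact: (@finite_measure_integrable_cst _ _ _ P _ (`|c| ^+ n) measurableT).
Qed.

Lemma tame_bounded f C : measurable_fun setT f -> (forall w, `|f w| <= C) ->
  tame P f.
Proof.
move=> mf fC; apply: (tame_le (tame_cst C) mf) => w /=.
exact: le_trans (fC w) (ler_norm _).
Qed.

Lemma tame_norm f : tame P f -> tame P (fun w => `|f w|).
Proof.
move=> tf; apply: (tame_le tf); first by apply: measurableT_comp => //; exact: tame_measurable.
by move=> w; rewrite normr_id.
Qed.

Lemma tameD f g : tame P f -> tame P g -> tame P (fun w => f w + g w).
Proof.
move=> [mf tf] [mg tg]; split; first exact: measurable_funD.
move=> n; have h : P.-integrable setT
    (fun w => (2 ^+ n)%:E * ((`|f w| ^+ n)%:E + (`|g w| ^+ n)%:E))%E.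
  by apply: integrableZl => //; apply: integrableD.
apply: le_integrable h => //.
  by apply/measurable_EFinP/measurable_funX/measurableT_comp => //; exact: measurable_funD.
move=> w _ /=; rewrite lee_fin normrX normr_id.
rewrite [leRHS]ger0_norm ?mulr_ge0 ?addr_ge0 ?exprn_ge0//.
wlog fg : f g mf mg tf tg / `|f w| <= `|g w|.
  move=> H; have [fg|/ltW fg] := leP `|f w| `|g w|.
    exact: (H f g mf mg tf tg fg).
  by rewrite (addrC (f w)) (addrC (`|f w| ^+ n)); exact: (H g f mg mf tg tf fg).
apply: (@le_trans _ _ ((2 * `|g w|) ^+ n)).
  apply: lerXn2r; rewrite ?nnegrE ?mulr_ge0//.
  by apply: le_trans (ler_normD _ _) _; lra.
by rewrite exprMn ler_pM2l ?exprn_gt0// lerDr exprn_ge0.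
Qed.

Lemma tameM f g : tame P f -> tame P g -> tame P (fun w => f w * g w).
Proof.
move=> [mf tf] [mg tg]; split; first exact: measurable_funM.
move=> n; have h : P.-integrable setT
    (fun w => ((`|f w| ^+ (n * 2))%:E + (`|g w| ^+ (n * 2))%:E))%E.
  by apply: integrableD.
apply: le_integrable h => //.
  by apply/measurable_EFinP/measurable_funX/measurableT_comp => //; exact: measurable_funM.
move=> w _ /=; rewrite lee_fin normrX normr_id normrM exprMn.
rewrite [leRHS]ger0_norm ?addr_ge0 ?exprn_ge0// !exprM.
have : 0 <= `|f w| ^+ n by exact: exprn_ge0.
have : 0 <= `|g w| ^+ n by exact: exprn_ge0.
by set a := `|f w| ^+ n; set b := `|g w| ^+ n => *; nra.
Qed.

Lemma tameZ c f : tame P f -> tame P (fun w => c * f w).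
Proof. by apply: tameM; exact: tame_cst. Qed.

Lemma tameN f : tame P f -> tame P (fun w => - f w).
Proof.
move=> tf; apply: (tame_le tf).
  exact/measurable_funN/tame_measurable.
by move=> w; rewrite normrN.
Qed.

Lemma tameB f g : tame P f -> tame P g -> tame P (fun w => f w - g w).
Proof. by move=> tf /tameN; exact: tameD. Qed.

Lemma tameX n f : tame P f -> tame P (fun w => f w ^+ n).
Proof.
move=> tf; elim: n => [|n ih]; first exact: (tame_cst 1).
by apply: (eq_tame (tameM tf ih)) => w; rewrite exprS.
Qed.

Lemma tame_sum I (r : seq I) (Q : pred I) (F : I -> Om -> R) :
  (forall i, Q i -> tame P (F i)) -> tame P (fun w => \sum_(i <- r | Q i) F i w).
Proof.
move=> tF; elim: r => [|i r ih].
  by apply: (eq_tame (tame_cst 0)) => w; rewrite big_nil.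
have [Qi|Qi] := boolP (Q i).
  by apply: (eq_tame (tameD (tF _ Qi) ih)) => w; rewrite big_cons Qi.
by apply: (eq_tame ih) => w; rewrite big_cons (negbTE Qi).
Qed.

Lemma eq_mean f g : f =1 g -> mean P f = mean P g.
Proof. by move=> fg; apply: eq_Rintegral => w _; exact: fg. Qed.

Lemma mean_cst c : mean P (fun=> c) = c.
Proof.
rewrite /mean Rintegral_cst// [X in fine X](_ : _ = 1%E) ?mulr1//.
exact: probability_setT.
Qed.

Lemma meanD f g : tame P f -> tame P g ->
  mean P (fun w => f w + g w) = mean P f + mean P g.
Proof. by move=> tf tg; apply: RintegralD => //; exact: tame_integrable. Qed.

Lemma meanB f g : tame P f -> tame P g ->
  mean P (fun w => f w - g w) = mean P f - mean P g.
Proof. by move=> tf tg; apply: RintegralB => //; exact: tame_integrable. Qed.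

Lemma meanZ c f : tame P f -> mean P (fun w => c * f w) = c * mean P f.
Proof. by move=> tf; apply: RintegralZl => //; exact: tame_integrable. Qed.

Lemma mean_sum I (r : seq I) (Q : pred I) (F : I -> Om -> R) :
  (forall i, Q i -> tame P (F i)) ->
  mean P (fun w => \sum_(i <- r | Q i) F i w) = \sum_(i <- r | Q i) mean P (F i).
Proof.
move=> tF; elim: r => [|i r ih].
  by rewrite big_nil -[RHS](mean_cst 0); apply: eq_mean => w; rewrite big_nil.
rewrite big_cons -ih; have [Qi|Qi] := boolP (Q i).
  rewrite -meanD; [|exact: tF|exact: tame_sum].
  by apply: eq_mean => w; rewrite big_cons Qi.
by apply: eq_mean => w; rewrite big_cons (negbTE Qi).
Qed.

Lemma le_mean f g : tame P f -> tame P g -> (forall w, f w <= g w) ->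
  mean P f <= mean P g.
Proof. by move=> tf tg fg; apply: le_Rintegral => //; exact: tame_integrable. Qed.

Lemma mean_ge0 f : (forall w, 0 <= f w) -> 0 <= mean P f.
Proof. by move=> f0; apply: Rintegral_ge0 => w _. Qed.

Lemma norm_mean f : tame P f -> `|mean P f| <= mean P (fun w => `|f w|).
Proof. by move=> tf; apply: le_normr_Rintegral => //; exact: tame_integrable. Qed.

Lemma mean_dominated_cvg (f_ : nat -> Om -> R) f g :
  (forall n, measurable_fun setT (f_ n)) -> tame P g ->
  (forall n w, `|f_ n w| <= g w) ->
  (forall w, f_ n w @[n --> \oo] --> f w) ->
  mean P (f_ n) @[n --> \oo] --> mean P f.
Proof.
move=> mf_ tg fg cf.
have mf : measurable_fun setT f by apply: (measurable_fun_cvg mf_).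
have cE w : (EFin \o f_ ^~ w) @ \oo --> (f w)%:E.
  by apply: cvg_EFin (cf w); exact: nearW.
have [] := @dominated_convergence _ _ _ P setT measurableT
  (fun n => EFin \o f_ n) (EFin \o f) (EFin \o g).
- by move=> n; exact/measurable_EFinP.
- exact/measurable_EFinP.
- by apply: aeW => w _; exact: cE.
- exact: tame_integrable.
- by apply: aeW => w n _; rewrite lee_fin.
move=> fi _ cvi.
by apply: fine_cvg; rewrite fineK//; exact: integrable_fin_num.
Qed.

End tame.

(* The sigma-algebra of all the X i with i != k stands in for a filtration: X k
   is independent of it. *)
Definition other_cylinders d d' (Om : measurableType d) (E : measurableType d')
    (I : eqType) (X : I -> Om -> E) (k : I) : set (set Om) :=
  [set B | exists2 A : I -> set E, forall i, measurable (A i) &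
     B = \bigcap_(i in [set i | i != k]) (X i @^-1` A i)].

Notation others X k := (g_sigma_algebraType (other_cylinders X k)).

Section independence.
Context d d' (Om : measurableType d) (E : measurableType d') (R : realType)
  (I : finType) (X : I -> {mfun Om >-> E}) (k : I).

Lemma measurable_cylinder B : other_cylinders X k B -> measurable B.
Proof.
move=> [A mA ->]; apply: fin_bigcap_measurable => [|i _].
  exact: finite_finset.
by rewrite -[X in measurable X]setTI; exact: measurable_funP.
Qed.

Lemma measurable_others (B : set Om) :
  measurable (B : set (others X k)) -> measurable B.
Proof.
move=> mB; suff : <<s other_cylinders X k >> `<=` measurable by exact.
apply: smallest_sub; last exact: measurable_cylinder.
exact: sigma_algebra_measurable.
Qed.

Lemma others_measurable_fun i : i != k ->
  measurable_fun setT (X i : others X k -> E).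
Proof.
move=> ik _ A mA; rewrite setTI; apply: sub_sigma_algebra.
exists (fun j => if j == i then A else setT) => [j|]; first by case: ifP.
apply/seteqP; split=> [w wA j jk /=|w /(_ i ik)/=]; last by rewrite eqxx.
by case: eqP => // ->.
Qed.

Lemma other_cylindersI : setI_closed (other_cylinders X k).
Proof.
move=> _ _ [A mA ->] [B mB ->]; exists (fun i => A i `&` B i).
  by move=> i; exact: measurableI.
apply/seteqP; split=> [w [wA wB] i ik|w wAB]; first by split; [exact: wA|exact: wB].
by split=> i ik; have [] := wAB i ik.
Qed.

Variable P : probability Om R.
Hypothesis indX : forall A : I -> set E, (forall i, measurable (A i)) ->
  P (\bigcap_(i in setT) X i @^-1` A i) = (\prod_i P (X i @^-1` A i))%E.

(** A pi-lambda argument: for fixed [A] both sides are finite measures in [B], and they agree on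
    cylinders, which are stable under intersection. *)
Lemma independent_others A (B : set Om) :
  measurable A -> measurable (B : set (others X k)) ->
  P (X k @^-1` A `&` B) = (P (X k @^-1` A) * P B)%E.
Proof.
move=> mA mB.
have mXA : measurable (X k @^-1` A).
  by rewrite -[X in measurable X]setTI; exact: measurable_funP.
(* Turns P (X k in A) into a scalar, so that the right-hand side becomes the measure
   [mscale r P]. *)
pose r : {nonneg R} := NngNum (fine_ge0 (measure_ge0 P (X k @^-1` A))).
have rE : (r%:num%:E = P (X k @^-1` A))%E by rewrite /= fineK// fin_num_measure.
have PE C : measurable C -> mrestr P mXA C = mscale r P C ->
    P (X k @^-1` A `&` C) = (P (X k @^-1` A) * P C)%E.
  by move=> _; rewrite /mrestr /mscale rE setIC.
apply: PE; first exact: measurable_others mB.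
apply: (g_sigma_algebra_measure_unique (other_cylinders X k)
  measurable_cylinder (fun=> setT)) => //.
- move=> _; exists (fun=> setT) => //; apply/seteqP.
  by split.
- by rewrite bigcup_const.
- exact: other_cylindersI.
- move=> _ [C mC ->].
  suff : P (\bigcap_(i in [set i | i != k]) (X i @^-1` C i) `&` X k @^-1` A) =
         (P (X k @^-1` A) * P (\bigcap_(i in [set i | i != k]) (X i @^-1` C i)))%E.
    by rewrite -rE.
  pose D i := if i == k then A else C i.
  have mD i : measurable (D i) by rewrite /D; case: ifP.
  pose D' i := if i == k then setT else C i.
  have mD' i : measurable (D' i) by rewrite /D'; case: ifP.
  have -> : \bigcap_(i in [set i | i != k]) (X i @^-1` C i) `&` X k @^-1` A =
            \bigcap_(i in setT) X i @^-1` D i.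
    apply/seteqP; split=> [w [wC wA] i _|w wD].
      by rewrite /D /=; case: eqP => [->//|/eqP]; exact: wC.
    split=> [i /negbTE ik|]; last by have := wD k Logic.I; rewrite /D /= eqxx.
    by have := wD i Logic.I; rewrite /D /= ik.
  have -> : \bigcap_(i in [set i | i != k]) (X i @^-1` C i) =
            \bigcap_(i in setT) X i @^-1` D' i.
    apply/seteqP; split=> [w wC i _|w wD].
      by rewrite /D' /=; case: eqP => [//|/eqP]; exact: wC.
    by move=> i /negbTE ik; have := wD i Logic.I; rewrite /D' /= ik.
  rewrite !indX// (bigD1 k)//= [in RHS](bigD1 k)//=.
  rewrite /D /D' !eqxx preimage_setT probability_setT mul1e; congr (_ * _)%E.
  by apply: eq_bigr => i /negbTE ->.
- move=> n; rewrite /mrestr; apply: le_lt_trans (ltry 1).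
  by apply: probability_le1; exact: measurableI.
Qed.

Definition pair_others (w : Om) : others X k * E := (w, X k w).

Let measurable_pair_others : measurable_fun setT pair_others.
Proof.
apply: measurable_fun_pair; last exact: measurable_funP.
by move=> _ B mB; rewrite setTI; exact: measurable_others.
Qed.

HB.instance Definition _ :=
  isMeasurableFun.Build _ _ _ _ pair_others measurable_pair_others.

(** The identity into the coarser sigma-algebra; its law is the restriction of [P] to that
    sigma-algebra. *)
Definition id_others (w : Om) : others X k := w.

Let measurable_id_others : measurable_fun setT id_others.
Proof. by move=> _ B mB; rewrite setTI; exact: measurable_others. Qed.

HB.instance Definition _ :=
  isMeasurableFun.Build _ _ _ _ id_others measurable_id_others.

(** Conditioning on all [X i] with i != k, in the form of Fubini's theorem: by independence the law
    of [pair_others] is the product of the law of [id_others] and the law of [X k]. *)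
Lemma mean_swap (F : E -> Om -> R) :
  measurable_fun setT (fun z : others X k * E => F z.2 z.1) ->
  tame P (fun w => F (X k w) w) ->
  (forall w, tame (distribution P (X k)) (F ^~ w)) ->
  mean P (fun w => F (X k w) w) =
  mean P (fun w => mean (distribution P (X k)) (F ^~ w)).
Proof.
move=> mF tF tFw.
pose G (z : others X k * E) := (F z.2 z.1)%:E.
have mG : measurable_fun setT G by exact/measurable_EFinP.
have PG : P.-integrable setT (G \o pair_others) by exact: tame_integrable tF.
pose m1 := distribution P id_others.
pose m2 := distribution P (X k).
have mE B : measurable B -> (m1 \x m2)%E B = distribution P pair_others B.
  apply: product_measure_unique => C D mC mD.
  by rewrite /= /distribution /pushforward /= muleC -independent_others// setIC.
have IG : (m1 \x m2)%E.-integrable setT G.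
  have : (distribution P pair_others).-integrable setT G.
    exact: integrable_pushforward.
  move=> /integrableP[_ h]; apply/integrableP; split => //.
  by rewrite (eq_measure_integral (distribution P pair_others))// => B mB _; exact: mE.
have e1 : (\int[P]_w (G \o pair_others) w = \int[m1 \x m2]_z G z)%E.
  rewrite -(integral_distribution (X := pair_others))//.
  by apply: eq_measure_integral => B mB _; exact/esym/mE.
rewrite /mean /Rintegral [X in fine X](_ : _ = \int[P]_w (G \o pair_others) w)%E//.
rewrite e1 -integral12_prod_meas1//.
pose H (w : others X k) := (mean m2 (F ^~ w))%:E.
have HE w : H w = (\int[m2]_x G (w, x))%E.
  by rewrite /H fineK//; apply: integrable_fin_num => //; exact: tame_integrable (tFw w).
have HG : fubini_F m2 G = H by apply/funext => w; rewrite HE.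
have mH : measurable_fun setT H by rewrite -HG; exact: measurable_fubini_F IG.
have iH : m1.-integrable setT H by rewrite -HG; exact: integrable_fubini_F IG.
rewrite -/(fubini_F m2 G) HG /m1 (integral_distribution (X := id_others))//.
have /integrableP[_ iH2] := iH.
apply/integrableP; split; first exact/measurableT_comp.
by move: iH2; rewrite ge0_integral_distribution//; exact: measurableT_comp.
Qed.

End independence.

(** * Gaussian integration by parts *)

Section polynomial_growth.
Context (R : realType).
Implicit Types f g : R -> R.

Definition poly_growth f :=
  exists2 K : R, 0 <= K & exists n, forall x, `|f x| <= K * (1 + x ^+ 2) ^+ n.

Lemma one_sqr_ge1 (x : R) : 1 <= 1 + x ^+ 2.
Proof. by rewrite lerDl sqr_ge0. Qed.

Lemma poly_growth_cst c : poly_growth (cst c).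
Proof.
by exists `|c|; [exact: normr_ge0|exists 0 => x; rewrite expr0 mulr1].
Qed.

Lemma poly_growth_id : poly_growth id.
Proof. by exists 1 => //; exists 1 => x; rewrite mul1r expr1 ler_norml; apply/andP; split; nra. Qed.

Lemma poly_growth_le g f : poly_growth g -> (forall x, `|f x| <= `|g x|) ->
  poly_growth f.
Proof.
move=> [K K0 [n gK]] fg; exists K => //; exists n => x.
exact: le_trans (fg x) (gK x).
Qed.

Lemma poly_growthD f g : poly_growth f -> poly_growth g ->
  poly_growth (fun x => f x + g x).
Proof.
move=> [K K0 [n fK]] [L L0 [m gL]].
exists (K + L); [exact: addr_ge0|exists (n + m)%N => x].
apply: le_trans (ler_normD _ _) _; rewrite mulrDl.
have h : 1 <= 1 + x ^+ 2 by exact: one_sqr_ge1.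
apply: lerD; [apply: le_trans (fK x) _|apply: le_trans (gL x) _];
  apply: ler_wpM2l => //; apply: ler_weXn2l => //.
- exact: leq_addr.
- exact: leq_addl.
Qed.

Lemma poly_growthM f g : poly_growth f -> poly_growth g ->
  poly_growth (fun x => f x * g x).
Proof.
move=> [K K0 [n fK]] [L L0 [m gL]].
exists (K * L); [exact: mulr_ge0|exists (n + m)%N => x].
by rewrite normrM exprD mulrACA; apply: ler_pM.
Qed.

Lemma poly_growthX n f : poly_growth f -> poly_growth (fun x => f x ^+ n).
Proof.
move=> gf; elim: n => [|n ih]; first exact: (poly_growth_cst 1).
apply: poly_growth_le (poly_growthM gf ih) _ => x.
by rewrite exprS.
Qed.

(** The n-th power of y / n <= 1 + y / n <= exp (y / n). *)
Lemma exprn_le_expR n (y : R) : 0 <= y -> y ^+ n <= n%:R ^+ n * expR y.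
Proof.
case: n => [|n] y0; first by rewrite expr0 mul1r -expR0 ler_expR.
have n0 : 0 < n.+1%:R :> R by rewrite ltr0n.
have -> : expR y = expR (y / n.+1%:R) ^+ n.+1.
  by rewrite -expRM_natl mulrC divfK// gt_eqF.
rewrite -exprMn; apply: lerXn2r => //.
  by rewrite nnegrE mulr_ge0// expR_ge0.
rewrite -ler_pdivrMl// mulrC; apply: le_trans (expR_ge1Dx _).
by rewrite lerDr.
Qed.

End polynomial_growth.

Lemma normal_pdf0E (R : realType) (s x : R) : s != 0 ->
  normal_pdf 0 s x = normal_peak s * expR (- (x ^+ 2 / (2 * s ^+ 2))).
Proof.
by move=> s0; rewrite normal_pdfE// /normal_fun subr0 mulr_natl mulNr.
Qed.

Lemma normal_pdf_cvg0 (R : realType) (s : R) : 0 < s ->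
  normal_pdf 0 s k%:R @[k --> \oo] --> 0.
Proof.
move=> s0; have s1 : s != 0 by rewrite gt_eqF.
(* The inequality exp (- t) <= 1 / t at t = k^2 / (2 s^2) bounds the density by C / k^2, and 1 / k^2
   <= 2 / (k + 1). *)
pose C := normal_peak s * (2 * s ^+ 2).
apply: (@squeeze_cvgr _ _ _ _ (cst 0) (fun k => (2 * C) * harmonic k)).
- exists 1%N => // k /= k1; rewrite normal_pdf_ge0/=.
  have k0 : 0 < k%:R :> R by rewrite ltr0n.
  have k1' : 1 <= k%:R :> R by rewrite ler1n.
  have ss : 0 < 2 * s ^+ 2 by rewrite mulr_gt0// exprn_gt0.
  have p0 := normal_peak_ge0 s.
  have -> : 2 * C * harmonic k = normal_peak s * ((2 * s ^+ 2) * (2 * harmonic k)).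
    by rewrite /C; ring.
  rewrite normal_pdf0E//.
  apply: ler_wpM2l => //; apply: (@le_trans _ _ ((k%:R ^+ 2 / (2 * s ^+ 2))^-1)).
    rewrite expRN lef_pV2 ?posrE ?expR_gt0 ?divr_gt0 ?exprn_gt0//.
    by apply: le_trans (expR_ge1Dx _); rewrite lerDr.
  rewrite invf_div; apply: ler_wpM2l; first exact: ltW.
  rewrite /harmonic/= ler_pdivlMr// mulrC ler_pdivrMr ?exprn_gt0//.
  by rewrite -natr1; nra.
- exact: cvg_cst.
- rewrite -[X in _ --> X](mulr0 (2 * C)); apply: cvgMr; exact: cvg_harmonic.
Qed.

Section normal.
Context (R : realType) (s : R).
Hypothesis s0 : 0 < s.
Local Notation mu := (@lebesgue_measure R).
Local Notation gauss := (normal_prob 0 s).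
Implicit Types f g : R -> R.

(** Doubling the standard deviation leaves room for a polynomial factor. This gives both the
    integrability of [f] under the normal law and the vanishing of boundary terms in integration by
    parts. *)
Lemma poly_growth_pdf f : poly_growth f ->
  exists2 K, 0 <= K &
    forall x, `|f x| * normal_pdf 0 s x <= K * normal_pdf 0 (2 * s) x.
Proof.
move=> [K K0 [n fK]].
(* This is 1 / (2 s^2) - 1 / (8 s^2), the gap between the exponents of the two densities;
   [exprn_le_expR] at c (1 + x^2) lets it absorb the polynomial. *)
pose c := 3 / (8 * s ^+ 2).
have c0 : 0 < c by rewrite divr_gt0// mulr_gt0// exprn_gt0.
have s1 : s != 0 by rewrite gt_eqF.
have s2 : 2 * s != 0 by rewrite mulf_neq0.
have p0 : 0 < normal_peak (2 * s) by exact: normal_peak_gt0.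
exists (K * (n%:R ^+ n / c ^+ n * expR c) * normal_peak s / normal_peak (2 * s)).
  apply: divr_ge0; last exact: ltW.
  apply: mulr_ge0; last exact: normal_peak_ge0.
  by rewrite mulr_ge0// mulr_ge0 ?expR_ge0// divr_ge0 ?exprn_ge0// ltW.
move=> x; rewrite !normal_pdf0E//.
set p2 := normal_peak (2 * s) in p0 *.
rewrite [leRHS]mulrA divfK ?gt_eqF//.
apply: (@le_trans _ _ (K * (1 + x ^+ 2) ^+ n *
    (normal_peak s * expR (- (x ^+ 2 / (2 * s ^+ 2)))))).
  by apply: ler_wpM2r (fK x); rewrite mulr_ge0 ?normal_peak_ge0 ?expR_ge0.
suff h : (1 + x ^+ 2) ^+ n * expR (- (x ^+ 2 / (2 * s ^+ 2))) <=
    n%:R ^+ n / c ^+ n * expR c * expR (- (x ^+ 2 / (2 * (2 * s) ^+ 2))).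
  rewrite mulrACA -[leRHS]mulrA mulrACA -mulrA -[leRHS]mulrA.
  by apply: ler_wpM2l => //; rewrite mulrCA [leRHS]mulrCA ler_wpM2l ?normal_peak_ge0.
rewrite -[leRHS]mulrA -expRD.
have h : (c * (1 + x ^+ 2)) ^+ n <= n%:R ^+ n * expR (c * (1 + x ^+ 2)).
  by apply: exprn_le_expR; rewrite mulr_ge0 ?addr_ge0 ?sqr_ge0// ltW.
have {}h : (1 + x ^+ 2) ^+ n <= n%:R ^+ n / c ^+ n * expR (c * (1 + x ^+ 2)).
  by rewrite mulrAC ler_pdivlMr ?exprn_gt0// -exprMn mulrC.
apply: le_trans (ler_wpM2r (expR_ge0 _) h) _.
rewrite -[leLHS]mulrA -expRD ler_wpM2l//.
  by rewrite divr_ge0 ?exprn_ge0// ltW.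
rewrite ler_expR le_eqVlt; apply/orP; left; apply/eqP.
by rewrite /c; field.
Qed.

Lemma ge0_integral_normal f : measurable_fun setT f -> (forall x, 0 <= f x) ->
  (\int[gauss]_x (f x)%:E = \int[mu]_x (f x * normal_pdf 0 s x)%:E)%E.
Proof.
move=> mf f0.
have dom : gauss `<< mu := normal_prob_dominates 0 s.
rewrite -(@Radon_Nikodym_SigmaFinite.change_of_variables _ _ R gauss mu dom)//; last exact/measurable_EFinP.
apply: ae_eq_integral => //.
- apply: emeasurable_funM; first exact/measurable_EFinP.
  apply: (measurable_int mu); exact: Radon_Nikodym_SigmaFinite.f_integrable.
- apply/measurable_EFinP/measurable_funM => //; exact: measurable_normal_pdf.
under [X in ae_eq _ _ _ X]eq_fun do rewrite EFinM.
apply: ae_eqe_mul2l; apply: integral_ae_eq => //.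
- exact: Radon_Nikodym_SigmaFinite.f_integrable.
- apply/measurable_EFinP; exact: measurable_normal_pdf.
- by move=> A _ mA; rewrite -Radon_Nikodym_SigmaFinite.f_integral.
Qed.

Lemma tame_poly_growth f : measurable_fun setT f -> poly_growth f ->
  tame gauss f.
Proof.
move=> mf gf; split => // n.
have gfn : poly_growth (fun x => `|f x| ^+ n).
  apply: poly_growthX; apply: poly_growth_le gf _ => x; by rewrite normr_id.
have [K K0 h] := poly_growth_pdf gfn.
have mfn : measurable_fun setT (fun x => `|f x| ^+ n).
  by apply: measurable_funX; exact: measurableT_comp.
apply/integrableP; split; first exact/measurable_EFinP.
under eq_integral do rewrite /= normrX normr_id.
rewrite ge0_integral_normal//.
apply: (@le_lt_trans _ _ (\int[mu]_x (K%:E * (normal_pdf 0 (2 * s) x)%:E))%E).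
  apply: ge0_le_integral => //.
  - by move=> x _; rewrite lee_fin mulr_ge0 ?normal_pdf_ge0 ?exprn_ge0.
  - by apply/measurable_EFinP/measurable_funM => //; exact: measurable_normal_pdf.
  - by apply/measurable_EFinP/measurable_funM => //; exact: measurable_normal_pdf.
  - by move=> x _; rewrite -EFinM lee_fin; apply: le_trans (h x); rewrite normrX normr_id.
rewrite ge0_integralZl//; last 2 first.
- by apply/measurable_EFinP; exact: measurable_normal_pdf.
- by move=> x _; rewrite lee_fin normal_pdf_ge0.
by rewrite integral_normal_pdf mule1 ltry.
Qed.

Lemma mean_normal f : tame gauss f ->
  mu.-integrable setT (fun x => (f x * normal_pdf 0 s x)%:E) /\
  mean gauss f = (\int[mu]_x (f x * normal_pdf 0 s x))%R.
Proof.
move=> tf; have mf := tame_measurable tf.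
have mfp : measurable_fun setT (fun x => f x * normal_pdf 0 s x).
  by apply: measurable_funM => //; exact: measurable_normal_pdf.
have fi : mu.-integrable setT (fun x => (f x * normal_pdf 0 s x)%:E).
  apply/integrableP; split; first exact/measurable_EFinP.
  have /integrableP[_] := tame_integrable tf.
  apply: le_lt_trans.
  under [leRHS]eq_integral do rewrite /=.
  rewrite ge0_integral_normal//; last exact: measurableT_comp.
  under eq_integral do rewrite /= normrM (ger0_norm (normal_pdf_ge0 _ _ _)).
  exact: le_refl.
split => //.
have h g : tame gauss g -> (forall x, 0 <= g x) ->
    mean gauss g = (\int[mu]_x (g x * normal_pdf 0 s x))%R.
  move=> tg g0; rewrite /mean /Rintegral ge0_integral_normal//.
  exact: tame_measurable tg.
(* A difference of two nonnegative tame functions, which reduces the signed case to the nonnegative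
   one. *)
have fE x : f x = `|f x| - (`|f x| - f x) by rewrite opprB addrC subrK.
have tn := tame_norm tf.
have td := tameB tn tf.
have i1 : mu.-integrable setT (EFin \o (fun x => `|f x| * normal_pdf 0 s x)).
  apply: le_integrable fi => //.
    by apply/measurable_EFinP/measurable_funM; [exact: measurableT_comp|exact: measurable_normal_pdf].
  by move=> x _; rewrite lee_fin !normrM normr_id.
rewrite (eq_mean gauss fE) meanB// h// h//; last first.
  by move=> x; rewrite subr_ge0 ler_norm.
rewrite -RintegralB//; first by apply: eq_Rintegral => x _; ring.
have -> : EFin \o (fun x => (`|f x| - f x) * normal_pdf 0 s x) =
   (fun x => (`|f x| * normal_pdf 0 s x)%:E - (f x * normal_pdf 0 s x)%:E)%E.
  by apply/funext => x /=; rewrite mulrBl EFinB.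
exact: integrableB.
Qed.

Lemma is_derive_normal_pdf (x : R) :
  is_derive x 1 (normal_pdf 0 s) (- (x / s ^+ 2) * normal_pdf 0 s x).
Proof.
have s1 : s != 0 by rewrite gt_eqF.
have -> : normal_pdf 0 s = (fun y => normal_peak s * expR (- (y ^+ 2 / (2 * s ^+ 2)))).
  by apply/funext => y; exact: normal_pdf0E.
apply: is_derive_eq; rewrite /GRing.scale/=.
by field.
Qed.

(** Stein's identity. The derivative of f times the density is (f' - x f / s^2) times the density;
    this is integrated over [-k, k], and as k grows the boundary terms vanish by
    [poly_growth_pdf]. *)
Lemma normal_ibp f f' : (forall x : R, is_derive x 1 f (f' x)) ->
  continuous f' -> poly_growth f -> poly_growth f' ->
  mean gauss (fun x => x * f x) = s ^+ 2 * mean gauss f'.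
Proof.
move=> df cf' gf gf'.
have s1 : s != 0 by rewrite gt_eqF.
have cf : continuous f.
  by move=> x; apply: differentiable_continuous; apply/derivable1_diffP; have [] := df x.
have mf := continuous_measurable_fun cf.
have mf' := continuous_measurable_fun cf'.
have tf' := tame_poly_growth mf' gf'.
have txf : tame gauss (fun x => x * f x).
  apply: tame_poly_growth; first exact: measurable_funM.
  exact: poly_growthM (@poly_growth_id R) gf.
pose g x := f' x - (s ^+ 2)^-1 * (x * f x).
have tg : tame gauss g by apply: tameB => //; exact: tameZ.
suff g0 : mean gauss g = 0.
  move: g0; rewrite /g meanB//; last exact: tameZ.
  rewrite meanZ// => /eqP; rewrite subr_eq0 => /eqP ->.
  by rewrite mulVKf// expf_neq0.
have mk k : measurable_fun setT (\1_(`[- k%:R, k%:R]) : R -> R).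
  exact: measurable_indic.
pose g_ (k : nat) x := g x * \1_(`[- k%:R, k%:R]) x.
have mg := tame_measurable tg.
have cvg1 : mean gauss (g_ k) @[k --> \oo] --> mean gauss g.
  apply: (@mean_dominated_cvg _ _ R gauss g_ g (fun x => `|g x|)).
  - by move=> k; exact: measurable_funM.
  - exact: tame_norm.
  - move=> k x; rewrite /g_ normrM ler_piMr// indicE.
    by case: (_ \in _); rewrite ?normr1 ?normr0.
  - move=> x; apply: cvg_near_cst.
    near=> k; rewrite /g_ indicE mem_set ?mulr1//= in_itv/= -ler_norml.
    near: k; exact: nbhs_infty_ger.
pose h x := f x * normal_pdf 0 s x.
have gE k : (0 < k)%N -> mean gauss (g_ k) = h k%:R - h (- k%:R).
  move=> k0.
  have tgk : tame gauss (g_ k).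
    apply: tame_le tg _ _; first exact: measurable_funM.
    move=> x; rewrite /g_ normrM ler_piMr// indicE.
    by case: (_ \in _); rewrite ?normr1 ?normr0.
  have [_ ->] := mean_normal tgk.
  have dh (x : R) : is_derive x 1 h (g x * normal_pdf 0 s x).
    have dx := df x; have dp := is_derive_normal_pdf x.
    rewrite /h; apply: is_derive_eq; rewrite /GRing.scale/= /g; ring.
  transitivity (fine (\int[mu]_(x in `[(- k%:R)%R, k%:R%R]) (g x * normal_pdf 0 s x)%:E)%E).
    rewrite /Rintegral [in RHS]integral_mkcond; congr fine; apply: eq_integral => x _.
    rewrite patchE /g_ indicE; case: ifP => _; last by rewrite mulr0 mul0r.
    by rewrite mulr1.
  rewrite (@continuous_FTC2 _ _ h)//.
  - by rewrite -subr_gt0 opprK addr_gt0// ltr0n.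
  - apply: continuous_subspaceT => x; apply: cvgM.
      apply: cvgB; first exact: cf'.
      apply: cvgM; first exact: cvg_cst.
      by apply: cvgM; [exact: cvg_id|exact: cf].
    exact: continuous_normal_pdf.
  - split => [x _||].
    + by have [] := dh x.
    + by apply: cvg_at_right_filter; apply: differentiable_continuous; apply/derivable1_diffP; have [] := dh (- k%:R).
    + by apply: cvg_at_left_filter; apply: differentiable_continuous; apply/derivable1_diffP; have [] := dh k%:R.
  - by move=> x _; rewrite derive1E; have [] := dh x.
have h0 : h k%:R - h (- k%:R) @[k --> \oo] --> 0.
  have [K K0 hK] := poly_growth_pdf gf.
  have s20 : 0 < 2 * s by rewrite mulr_gt0.
  have pN x : normal_pdf 0 (2 * s) (- x) = normal_pdf 0 (2 * s) x.
    by rewrite !normal_pdf0E ?gt_eqF// sqrrN.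
  apply/norm_cvg0P; apply: (@squeeze_cvgr _ _ _ _ (cst 0)
      (fun k => 2 * K * normal_pdf 0 (2 * s) k%:R)).
  - near=> k; rewrite normr_ge0/=; apply: le_trans (ler_normB _ _) _.
    rewrite (_ : 2 * K * _ = K * normal_pdf 0 (2 * s) k%:R + K * normal_pdf 0 (2 * s) (- k%:R)).
      by rewrite /h !normrM !(ger0_norm (normal_pdf_ge0 _ _ _)) lerD.
    by rewrite pN; ring.
  - exact: cvg_cst.
  - rewrite -[X in _ --> X](mulr0 (2 * K)); apply: cvgMr; exact: normal_pdf_cvg0.
apply: cvg_unique cvg1 _ => //.
apply: cvg_trans h0; apply: near_eq_cvg; near=> k; rewrite gE//.
by near: k; exact: nbhs_infty_gt.
Unshelve. all: by end_near.
Qed.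

End normal.

(** * Quadratic forms along coordinate lines and integration by parts for Gaussian vectors *)

Lemma measurable_inv_ge0 d (S : measurableType d) (R : realType) (f : S -> R) :
  measurable_fun setT f -> (forall x, 0 <= f x) ->
  measurable_fun setT (fun x => (f x)^-1).
Proof.
move=> mf f0; rewrite (_ : (fun x => _) = (@powR R ^~ (-1)) \o f).
  by apply: measurableT_comp mf; exact: measurable_powR.
by apply/funext => x /=; rewrite powR_inv1.
Qed.

Section line_functions.
Context (R : realType).
Implicit Types f g q r : R -> R.

Lemma is_derive_inv_expr g dg n (x : R) : g x != 0 -> is_derive x 1 g dg ->
  is_derive x 1 (fun y => (g y)^-1 ^+ n) (- (n%:R * (g x)^-1 ^+ n.+1 * dg)).
Proof.
move=> g0 gdg.
have h : is_derive x 1 (fun y => (g y)^-1) (- ((g x)^-1 ^+ 2) * dg).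
  by rewrite exprVn; exact: is_deriveV.
have -> : (fun y => (g y)^-1 ^+ n) = (fun y => (g y)^-1) ^+ n.
  by apply/funext => y; rewrite exprfctE.
apply: is_derive_eq; rewrite /GRing.scale/= .
case: n => [|n]; first by rewrite !mul0r oppr0.
by rewrite /=; set i := (g x)^-1; rewrite (exprS i n.+1) (exprS i n); ring.
Qed.

Lemma is_derive_line f g q (df dq dg : R) a l (x : R) : g x != 0 ->
  is_derive x 1 f df -> is_derive x 1 q dq -> is_derive x 1 g dg ->
  is_derive x 1 (fun y => f y * (q y ^+ a * (g y)^-1 ^+ l))
   (df * (q x ^+ a * (g x)^-1 ^+ l) + f x * (a%:R * q x ^+ a.-1 * dq * (g x)^-1 ^+ l
     - l%:R * q x ^+ a * (g x)^-1 ^+ l.+1 * dg)).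
Proof.
move=> g0 fd qd gd; have gl := is_derive_inv_expr l g0 gd.
have -> : (fun y => f y * (q y ^+ a * (g y)^-1 ^+ l)) =
    f * (q ^+ a * (fun y => (g y)^-1 ^+ l)).
  by apply/funext => y; rewrite !fctE.
apply: is_derive_eq; rewrite /GRing.scale/= !fctE.
set i := (g x)^-1; rewrite (exprS i); ring.
Qed.

Lemma is_derive_quad (a0 b c x : R) :
  is_derive x 1 (fun y => a0 + 2 * b * y + c * y ^+ 2) (2 * (b + c * x)).
Proof.
apply: is_derive_eq; rewrite /GRing.scale/=; ring.
Qed.

Lemma is_derive_aff (a0 b x : R) : is_derive x 1 (fun y => a0 + b * y) b.
Proof. by apply: is_derive_eq; rewrite /GRing.scale/=; ring. Qed.

End line_functions.

Definition qform (R : realType) n (N : 'M[R]_n) (u : 'cV[R]_n) : R :=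
  (u^T *m N *m u) 0 0.

Definition upd (R : realType) n (u : 'cV[R]_n) (k : 'I_n) (x : R) : 'cV[R]_n :=
  \col_l (if l == k then x else u l 0).

Section quadratic_forms.
Context (R : realType) (n : nat).
Implicit Types (N Q : 'M[R]_n) (u : 'cV[R]_n).

Lemma qformE N u : qform N u = \sum_j \sum_i u i 0 * N i j * u j 0.
Proof.
rewrite /qform mxE; apply: eq_bigr => j _; rewrite mxE big_distrl/=.
by apply: eq_bigr => i _; rewrite mxE.
Qed.

Lemma qform_sum N u : qform N u = \sum_k u k 0 * (N *m u) k 0.
Proof. by rewrite /qform -mulmxA mxE; apply: eq_bigr => k _; rewrite mxE. Qed.

Lemma qformM_sum N Q u : N^T = N ->
  qform (N *m Q) u = \sum_k (N *m u) k 0 * (Q *m u) k 0.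
Proof.
move=> NT; rewrite /qform mulmxA -{1}NT -trmx_mul -mulmxA mxE.
by apply: eq_bigr => k _; rewrite mxE.
Qed.

Lemma updE u k x : upd u k x = upd u k 0 + x *: delta_mx k 0.
Proof.
apply/matrixP => i j; rewrite !mxE !ord1 eqxx andbT.
by case: (i == k); rewrite ?mulr1 ?mulr0 ?add0r ?addr0.
Qed.

Lemma upd_id u k : upd u k (u k 0) = u.
Proof. by apply/matrixP => i j; rewrite !mxE !ord1; case: eqP => [->|]. Qed.

Lemma mulmx_upd N u k x :
  (N *m upd u k x) k 0 = (N *m upd u k 0) k 0 + N k k * x.
Proof.
rewrite updE mulmxDr -scalemxAr -colE mxE; congr (_ + _).
by rewrite !mxE mulrC.
Qed.

Lemma qform_upd N u k x : N^T = N -> qform N (upd u k x) =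
  qform N (upd u k 0) + 2 * (N *m upd u k 0) k 0 * x + N k k * x ^+ 2.
Proof.
move=> NT; rewrite /qform updE; set v := upd u k 0; set e := delta_mx k 0.
have D00 (A B : 'M[R]_1) : (A + B) 0 0 = A 0 0 + B 0 0 by rewrite mxE.
have Z00 c (A : 'M[R]_1) : (c *: A) 0 0 = c * A 0 0 by rewrite mxE.
have eNv : (e^T *m N *m v) 0 0 = (N *m v) k 0.
  by rewrite trmx_delta -rowE -row_mul mxE.
have vNe : (v^T *m N *m e) 0 0 = (N *m v) k 0.
  rewrite -eNv -[in LHS](trmxK (v^T *m N *m e)) mxE.
  by rewrite !trmx_mul trmxK NT mulmxA.
have eNe : (e^T *m N *m e) 0 0 = N k k by rewrite trmx_delta -rowE -colE !mxE.
have -> : (v + x *: e)^T = v^T + x *: e^T by rewrite linearD/= linearZ.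
rewrite !mulmxDl !mulmxDr.
rewrite -!scalemxAl -!scalemxAr !(D00, Z00) eNv vNe eNe.
by ring.
Qed.

End quadratic_forms.

Section equal_laws.
Context d (Om : measurableType d) (R : realType) (P Q : probability Om R).
Hypothesis PQ : forall A, measurable A -> P A = Q A.

Lemma eq_law_mean f : mean P f = mean Q f.
Proof. by congr fine; apply: eq_measure_integral => A mA _; exact: PQ. Qed.

Lemma eq_law_tame f : tame Q f -> tame P f.
Proof.
move=> [mf tf]; split => // n; have /integrableP[m h] := tf n.
apply/integrableP; split => //.
by rewrite (eq_measure_integral Q)// => A mA _; exact: PQ.
Qed.

End equal_laws.

Lemma tame_distribution d d' (Om : measurableType d) (E : measurableType d')
    (R : realType) (P : probability Om R) (X : {mfun Om >-> E}) (f : E -> R) :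
  tame (distribution P X) f -> tame P (f \o X).
Proof.
move=> [mf tf]; split; first exact: measurableT_comp.
move=> n; have /integrableP[m h] := tf n.
apply/integrableP; split.
  by apply: (measurableT_comp m); exact: measurable_funP.
move: h; rewrite ge0_integral_distribution//; exact: measurableT_comp.
Qed.

Lemma mean_distribution d d' (Om : measurableType d) (E : measurableType d')
    (R : realType) (P : probability Om R) (X : {mfun Om >-> E}) (f : E -> R) :
  tame (distribution P X) f -> mean (distribution P X) f = mean P (f \o X).
Proof.
move=> tf; rewrite /mean /Rintegral integral_distribution//.
  exact/measurable_EFinP/tame_measurable/tf.
exact/tame_integrable/tame_distribution.
Qed.

Section gaussian_vector.
Context d (Om : measurableType d) (R : realType) (P : probability Om R) (n : nat)
  (X : 'I_n -> {mfun Om >-> measurableTypeR R}) (s : R).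
Hypothesis s0 : 0 < s.
Hypothesis indX : forall A : 'I_n -> set (measurableTypeR R), (forall i, measurable (A i)) ->
  P (\bigcap_(i in setT) X i @^-1` A i) = (\prod_i P (X i @^-1` A i))%E.
Hypothesis lawX : forall k A, measurable A ->
  distribution P (X k) A = normal_prob 0 s A.

Let v (w : Om) : 'cV[R]_n := \col_k X k w.

Lemma tame_coord k : tame P (X k).
Proof.
have h : tame (distribution P (X k)) (fun x : R => x).
  apply: (@eq_law_tame _ _ R (distribution P (X k)) (normal_prob 0 s) (@lawX k)).
  by apply: tame_poly_growth => //; exact: poly_growth_id.
exact: tame_distribution h.
Qed.

(** Stein's identity in coordinate [k] with the other coordinates frozen: [mean_swap] is used once
    to freeze them and once to release them. Measurability is asked for arbitrary coordinate maps
    because it is needed on the product of [others X k] with the line, not on [Om]. *)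
Lemma coord_ibp k (Phi Phi' : 'cV[R]_n -> R) :
  (forall d' (S : measurableType d') (Y : 'I_n -> S -> R),
    (forall i, measurable_fun setT (Y i)) ->
    measurable_fun setT (fun w => Phi (\col_i Y i w)) /\
    measurable_fun setT (fun w => Phi' (\col_i Y i w))) ->
  (forall u (x : R), is_derive x 1 (fun y => Phi (upd u k y)) (Phi' (upd u k x))) ->
  (forall u, continuous (fun y => Phi' (upd u k y))) ->
  (forall u, poly_growth (fun y => Phi (upd u k y))) ->
  (forall u, poly_growth (fun y => Phi' (upd u k y))) ->
  tame P (fun w => Phi (v w)) -> tame P (fun w => Phi' (v w)) ->
  mean P (fun w => v w k 0 * Phi (v w)) = s ^+ 2 * mean P (fun w => Phi' (v w)).
Proof.
move=> mP dP cP gP gP' tP tP'.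
have vE w : v w = upd (v w) k (X k w).
  by rewrite -[LHS](upd_id _ k) {2}/v mxE.
pose Y i (z : others X k * measurableTypeR R) := if i == k then z.2 else X i z.1.
have mY i : measurable_fun setT (Y i).
  rewrite /Y; case: eqP => [_|/eqP ik]; first exact: measurable_snd.
  apply: (measurableT_comp (f := (X i : others X k -> R))); last exact: measurable_fst.
  exact: others_measurable_fun.
have YE z : \col_i Y i z = upd (v z.1) k z.2.
  by apply/matrixP => i j; rewrite !mxE /Y; case: eqP.
have [mP1 mP2] := mP _ _ _ mY.
have {}mP1 : measurable_fun setT (fun z : others X k * measurableTypeR R =>
    Phi (upd (v z.1) k z.2)).
  by rewrite (_ : (fun z => _) = (fun z => Phi (\col_i Y i z)))//; apply/funext => z; rewrite YE.
have {}mP2 : measurable_fun setT (fun z : others X k * measurableTypeR R =>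
    Phi' (upd (v z.1) k z.2)).
  by rewrite (_ : (fun z => _) = (fun z => Phi' (\col_i Y i z)))//; apply/funext => z; rewrite YE.
have tk := tame_coord k.
have gcont u : continuous (fun y => Phi (upd u k y)).
  by move=> x; apply: differentiable_continuous; apply/derivable1_diffP; have [] := dP u x.
have tx u : tame (normal_prob 0 s) (fun x => x * Phi (upd u k x)).
  apply: tame_poly_growth => //.
    by apply: measurable_funM => //; exact: continuous_measurable_fun.
  by apply: poly_growthM => //; exact: poly_growth_id.
have tx' u : tame (normal_prob 0 s) (fun x => Phi' (upd u k x)).
  by apply: tame_poly_growth => //; exact: continuous_measurable_fun.
transitivity (mean P (fun w => X k w * Phi (upd (v w) k (X k w)))).
  by apply: eq_mean => w; rewrite -vE mxE.
rewrite (@mean_swap _ _ Om (measurableTypeR R) R 'I_n X k P indX (fun x w => x * Phi (upd (v w) k x))); last 3 first.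
- by apply: measurable_funM mP1; exact: measurable_snd.
- by apply: (eq_tame (tameM tk tP)) => w; rewrite -vE.
- by move=> w; apply: eq_law_tame (tx _); exact: lawX.
transitivity (mean P (fun w => s ^+ 2 * mean (distribution P (X k)) (fun x => Phi' (upd (v w) k x)))).
  apply: eq_mean => w; rewrite !(eq_law_mean (@lawX k)).
  exact: normal_ibp.
transitivity (mean P (fun w => mean (distribution P (X k)) (fun x => s ^+ 2 * Phi' (upd (v w) k x)))).
  apply: eq_mean => w; rewrite meanZ//.
  by apply: eq_law_tame (tx' _); exact: lawX.
rewrite -(@mean_swap _ _ Om (measurableTypeR R) R 'I_n X k P indX (fun x w => s ^+ 2 * Phi' (upd (v w) k x))).
- rewrite -meanZ//; by apply: eq_mean => w; rewrite -vE.
- exact: measurable_funM mP2.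
- by apply: (eq_tame (tameZ (s ^+ 2) tP')) => w; rewrite -vE.
- move=> w; apply: tameZ.
  by apply: eq_law_tame (tx' _); exact: lawX.
Qed.

End gaussian_vector.

Lemma measurable_sumr d (S : measurableType d) (R : realType) (I : Type)
    (r : seq I) (F : I -> S -> R) :
  (forall i, measurable_fun setT (F i)) ->
  measurable_fun setT (fun w => \sum_(i <- r) F i w).
Proof.
move=> mF; elim: r => [|i r ih].
  by rewrite (_ : (fun w => _) = cst 0)//; apply/funext => w; rewrite big_nil.
rewrite (_ : (fun w => _) = (fun w => F i w + \sum_(j <- r) F j w)).
  exact: measurable_funD.
by apply/funext => w; rewrite big_cons.
Qed.

Section vector_functions.
Context d (S : measurableType d) (R : realType) (n : nat) (Y : 'I_n -> S -> R).
Implicit Types N : 'M[R]_n.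

Lemma measurable_qform N : (forall i, measurable_fun setT (Y i)) ->
  measurable_fun setT (fun w => qform N (\col_i Y i w)).
Proof.
move=> mY; rewrite (_ : (fun w => _) = (fun w => \sum_j \sum_i Y i w * N i j * Y j w)).
  apply: measurable_sumr => j; apply: measurable_sumr => i.
  by apply: measurable_funM => //; apply: measurable_funM.
apply/funext => w; rewrite qformE; apply: eq_bigr => j _; apply: eq_bigr => i _.
by rewrite !mxE.
Qed.

Lemma measurable_mulmx N k : (forall i, measurable_fun setT (Y i)) ->
  measurable_fun setT (fun w => (N *m \col_i Y i w) k 0).
Proof.
move=> mY; rewrite (_ : (fun w => _) = (fun w => \sum_j N k j * Y j w)).
  by apply: measurable_sumr => j; apply: measurable_funM.
by apply/funext => w; rewrite mxE; apply: eq_bigr => j _; rewrite mxE.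
Qed.

Lemma tame_qform (P : probability S R) N : (forall i, tame P (Y i)) ->
  tame P (fun w => qform N (\col_i Y i w)).
Proof.
move=> tY; apply: (@eq_tame _ _ _ _ (fun w => \sum_j \sum_i Y i w * N i j * Y j w)).
  apply: tame_sum => j _; apply: tame_sum => i _.
  apply: tameM => //; apply: tameM => //; exact: tame_cst.
move=> w; rewrite qformE; apply: eq_bigr => j _; apply: eq_bigr => i _.
by rewrite !mxE.
Qed.

Lemma tame_mulmx (P : probability S R) N k : (forall i, tame P (Y i)) ->
  tame P (fun w => (N *m \col_i Y i w) k 0).
Proof.
move=> tY; apply: (@eq_tame _ _ _ _ (fun w => \sum_j N k j * Y j w)).
  by apply: tame_sum => j _; exact: tameZ.
by move=> w; rewrite mxE; apply: eq_bigr => j _; rewrite mxE.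
Qed.

End vector_functions.

Section line_restrictions.
Context (R : realType) (n : nat).
Implicit Types (M : 'M[R]_n) (u : 'cV[R]_n).

Lemma is_derive_mulmx_upd M u k (x : R) :
  is_derive x 1 (fun y => (M *m upd u k y) k 0) (M k k).
Proof.
have := is_derive_aff ((M *m upd u k 0) k 0) (M k k) x.
by congr is_derive; apply/funext => y; rewrite [RHS]mulmx_upd.
Qed.

Lemma is_derive_qform_upd u k (x : R) M : M^T = M ->
  is_derive x 1 (fun y => qform M (upd u k y)) (2 * (M *m upd u k x) k 0).
Proof.
move=> MT; rewrite mulmx_upd.
have := is_derive_quad (qform M (upd u k 0)) ((M *m upd u k 0) k 0) (M k k) x.
by congr is_derive; apply/funext => y; rewrite [RHS]qform_upd.
Qed.

Lemma is_derive_qform_upd_shift c u k (x : R) M : M^T = M ->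
  is_derive x 1 (fun y => c + qform M (upd u k y)) (2 * (M *m upd u k x) k 0).
Proof.
move=> MT; have h := is_derive_qform_upd u k x MT.
rewrite -[X in is_derive _ _ _ X]add0r.
exact: (is_deriveD (f := cst c)).
Qed.

Let poly_growthZ c (f : R -> R) :
  poly_growth f -> poly_growth (fun y : R => c * f y).
Proof. exact: (poly_growthM (poly_growth_cst c)). Qed.

Lemma poly_growth_mulmx_upd M u k : poly_growth (fun y : R => (M *m upd u k y) k 0).
Proof.
rewrite (_ : (fun y => _) = (fun y : R => (M *m upd u k 0) k 0 + M k k * y)).
  exact: (poly_growthD (poly_growth_cst _) (poly_growthZ (M k k) (@poly_growth_id R))).
by apply/funext => y; rewrite mulmx_upd.
Qed.

Lemma poly_growth_qform_upd u k M : M^T = M ->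
  poly_growth (fun y : R => qform M (upd u k y)).
Proof.
move=> MT; rewrite (_ : (fun y => _) = (fun y : R => qform M (upd u k 0) +
      2 * (M *m upd u k 0) k 0 * y + M k k * y ^+ 2)).
  apply: (poly_growthD _ (poly_growthZ (M k k) (poly_growthX 2 (@poly_growth_id R)))).
  exact: (poly_growthD (poly_growth_cst _) (poly_growthZ _ (@poly_growth_id R))).
by apply/funext => y; rewrite qform_upd.
Qed.

Lemma is_derive_continuous (f f' : R -> R) :
  (forall x : R, is_derive x 1 f (f' x)) -> continuous f.
Proof.
move=> df x; apply: differentiable_continuous; apply/derivable1_diffP.
by have [] := df x.
Qed.

End line_restrictions.

Section gaussian_ibp.
Context d (Om : measurableType d) (R : realType) (P : probability Om R) (n : nat)
  (X : 'I_n -> {mfun Om >-> measurableTypeR R}) (s : R).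
Hypothesis s0 : 0 < s.
Hypothesis indX : forall A : 'I_n -> set (measurableTypeR R),
  (forall i, measurable (A i)) ->
  P (\bigcap_(i in setT) X i @^-1` A i) = (\prod_i P (X i @^-1` A i))%E.
Hypothesis lawX : forall k A, measurable A ->
  distribution P (X k) A = normal_prob 0 s A.

Let v (w : Om) : 'cV[R]_n := \col_k X k w.

Variables (L N Q : 'M[R]_n) (dl : R) (a l : nat).
Hypotheses (LT : L^T = L) (NT : N^T = N) (QT : Q^T = Q) (dl0 : 0 < dl).
Hypothesis Q0 : forall u, 0 <= qform Q u.

Let D u := (dl + qform Q u)^-1.

Lemma regularized_inv u : 0 <= D u <= dl^-1.
Proof.
have h : 0 < dl + qform Q u by rewrite ltr_wpDr.
by rewrite /D invr_ge0 ltW//= lef_pV2 ?posrE// lerDl.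
Qed.

Lemma measurable_regularized d' (S : measurableType d') (Y : 'I_n -> S -> R) :
  (forall i, measurable_fun setT (Y i)) ->
  measurable_fun setT (fun w => D (\col_i Y i w)).
Proof.
move=> mY; apply: measurable_inv_ge0.
  by apply: measurable_funD => //; exact: measurable_qform.
by move=> w; rewrite addr_ge0// ltW.
Qed.

Lemma tame_regularized : tame P (fun w => D (v w)).
Proof.
apply: (@tame_bounded _ _ _ _ _ dl^-1).
  by apply: measurable_regularized => i; exact: tame_measurable (tame_coord s0 lawX i).
by move=> w; have /andP[h1 h2] := regularized_inv (v w); rewrite ger0_norm.
Qed.

(** As v'Lv is the sum of v_k (L v)_k, this is Stein's identity for (L v)_k q^a D^l summed over k.
    The gradients of the two forms are 2 N v and 2 Q v, which produces the forms of [L *m N] and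
    [L *m Q]. For a = 0 the term with [a.-1] carries the coefficient 0. *)
Lemma gaussian_ibp :
  mean P (fun w => qform L (v w) * (qform N (v w) ^+ a * D (v w) ^+ l)) =
  s ^+ 2 * (\tr L * mean P (fun w => qform N (v w) ^+ a * D (v w) ^+ l) +
    2 * a%:R * mean P (fun w => qform (L *m N) (v w) * qform N (v w) ^+ a.-1 * D (v w) ^+ l) -
    2 * l%:R * mean P (fun w => qform (L *m Q) (v w) * qform N (v w) ^+ a * D (v w) ^+ l.+1)).
Proof.
have tX k := tame_coord s0 lawX k.
have tD := tame_regularized.
have tq M := tame_qform M tX.
have tm M k := tame_mulmx M k tX.
pose Phi k u := (L *m u) k 0 * (qform N u ^+ a * D u ^+ l).
pose Phi' k u := L k k * (qform N u ^+ a * D u ^+ l) +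
  (L *m u) k 0 * (a%:R * qform N u ^+ a.-1 * (2 * (N *m u) k 0) * D u ^+ l -
    l%:R * qform N u ^+ a * D u ^+ l.+1 * (2 * (Q *m u) k 0)).
have tX' e (f : Om -> R) : tame P f -> tame P (fun w => f w ^+ e) := @tameX _ _ _ _ e f.
have tqX M e := tX' e _ (tq M).
have tDX e := tX' e _ tD.
have tPhi k : tame P (fun w => Phi k (v w)).
  exact: tameM (tm L k) (tameM (tqX _ _) (tDX _)).
have tPhi' k : tame P (fun w => Phi' k (v w)).
  rewrite /Phi'; apply: tameD; first exact: tameZ (tameM (tqX _ _) (tDX _)).
  apply: (tameM (tm L k)); apply: tameB.
    exact: tameM (tameM (tameZ _ (tqX _ _)) (tameZ _ (tm _ _))) (tDX _).
  exact: tameM (tameM (tameZ _ (tqX _ _)) (tDX _)) (tameZ _ (tm _ _)).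
have gZ c (f : R -> R) : poly_growth f -> poly_growth (fun y : R => c * f y) :=
  poly_growthM (poly_growth_cst c).
have gm (u : 'cV[R]_n) M k := poly_growth_mulmx_upd M u k.
have gq (u : 'cV[R]_n) k e M (MT : M^T = M) := poly_growthX e (poly_growth_qform_upd u k MT).
have gD u k e : poly_growth (fun y : R => D (upd u k y) ^+ e).
  apply: poly_growthX; apply: (@poly_growth_le R (cst dl^-1)) => [|y]; first exact: poly_growth_cst.
  have /andP[h1 h2] := regularized_inv (upd u k y).
  by rewrite !ger0_norm// (le_trans h1).
transitivity (\sum_k mean P (fun w => v w k 0 * Phi k (v w))).
  rewrite -mean_sum; last first.
    move=> k _; apply: tameM => //; apply: eq_tame (tX k) _ => w; by rewrite mxE.
  apply: eq_mean => w; rewrite qform_sum big_distrl/=.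
  by apply: eq_bigr => k _; rewrite /Phi -[LHS]mulrA.
transitivity (\sum_k s ^+ 2 * mean P (fun w => Phi' k (v w))).
  apply: eq_bigr => k _; apply: (coord_ibp s0 indX lawX) => //.
  - move=> d' S Y mY.
    have mq M := measurable_qform M mY.
    have mm M j := measurable_mulmx M j mY.
    have mD := measurable_regularized mY.
    have mqX M e := measurable_funX e (mq M).
    have mDX e := measurable_funX e mD.
    have mZ c (f : S -> R) : measurable_fun setT f ->
        measurable_fun setT (fun w => c * f w) by exact: measurable_funM.
    split; first exact: measurable_funM (mm L k) (measurable_funM (mqX _ _) (mDX _)).
    apply: measurable_funD; first exact: mZ (measurable_funM (mqX _ _) (mDX _)).
    apply: measurable_funM (mm L k) _; apply: measurable_funB.
      exact: measurable_funM (measurable_funM (mZ _ _ (mqX _ _)) (mZ _ _ (mm _ _))) (mDX _).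
    exact: measurable_funM (measurable_funM (mZ _ _ (mqX _ _)) (mDX _)) (mZ _ _ (mm _ _)).
  - move=> u x.
    have g0 : dl + qform Q (upd u k x) != 0 by rewrite gt_eqF// ltr_wpDr.
    have dL := is_derive_mulmx_upd L u k x.
    have dq := is_derive_qform_upd u k x NT.
    have dg := is_derive_qform_upd_shift dl u k x QT.
    have h := @is_derive_line R _ (fun y => dl + qform Q (upd u k y)) _ _ _ _ a l x g0 dL dq dg.
    by apply: (is_derive_eq h); rewrite /Phi' /D; ring.
  - move=> u.
    have cq M e : M^T = M -> continuous (fun y => qform M (upd u k y) ^+ e).
      move=> MT; apply: (is_derive_continuous (f' := fun x => (e%:R * qform M (upd u k x) ^+ e.-1) * (2 * (M *m upd u k x) k 0))) => x.
      have h := is_derive_qform_upd u k x MT.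
      by rewrite -[X in is_derive _ _ X]exprfctE; apply: is_deriveX.
    have cm M : continuous (fun y => (M *m upd u k y) k 0) :=
      is_derive_continuous (is_derive_mulmx_upd M u k).
    have g0 x : dl + qform Q (upd u k x) != 0 by rewrite gt_eqF// ltr_wpDr.
    have cD e : continuous (fun y => D (upd u k y) ^+ e) :=
      is_derive_continuous (fun x =>
        @is_derive_inv_expr R (fun y => dl + qform Q (upd u k y)) _ e x (g0 x)
          (is_derive_qform_upd_shift dl u k x QT)).
    have cM (f g : R -> R) : continuous f -> continuous g -> continuous (fun y => f y * g y).
      by move=> cf cg y; apply: cvgM; [exact: cf|exact: cg].
    have cZ c (f : R -> R) : continuous f -> continuous (fun y => c * f y).
      by move=> cf y; apply: cvgM; [exact: cvg_cst|exact: cf].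
    move=> y; apply: cvgD.
      exact: (cZ _ _ (cM _ _ (cq _ _ NT) (cD _))).
    apply: cvgM; first exact: cm; apply: cvgB.
      exact: (cM _ _ (cM _ _ (cZ _ _ (cq _ _ NT)) (cZ _ _ (cm _))) (cD _)).
    exact: (cM _ _ (cM _ _ (cZ _ _ (cq _ _ NT)) (cD _)) (cZ _ _ (cm _))).
  - by move=> u; exact: (poly_growthM (gm u L k) (poly_growthM (gq u k a N NT) (gD u k l))).
  - move=> u; rewrite /Phi'.
    have g1 := gZ (L k k) _ (poly_growthM (gq u k a N NT) (gD u k l)).
    have g2 := poly_growthM (poly_growthM (gZ a%:R _ (gq u k a.-1 N NT))
      (gZ 2 _ (gm u N k))) (gD u k l).
    have g3 := poly_growthM (poly_growthM (gZ (- l%:R) _ (gq u k a N NT)) (gD u k l.+1))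
      (gZ 2 _ (gm u Q k)).
    apply: poly_growth_le (poly_growthD g1 (poly_growthM (gm u L k) (poly_growthD g2 g3))) _ => y.
    by rewrite !mulNr.
  - exact: tPhi.
  - exact: tPhi'.
rewrite -mulr_sumr; congr (_ * _).
rewrite -mean_sum//.
have t1 := tameM (tqX N a) (tDX l).
have t2 := tameM (tameM (tq (L *m N)) (tqX N a.-1)) (tDX l).
have t3 := tameM (tameM (tq (L *m Q)) (tqX N a)) (tDX l.+1).
rewrite -!meanZ// -meanD; [|exact: tameZ|exact: tameZ].
rewrite -meanB; [|by apply: tameD; exact: tameZ|exact: tameZ].
apply: eq_mean => w; rewrite big_split/= -mulr_suml /mxtrace -addrA; congr (_ + _).
rewrite !qformM_sum// -!mulrA !big_distrl/= !big_distrr/= -sumrB.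
by apply: eq_bigr => k _; ring.
Qed.

End gaussian_ibp.

(** Lagrange's identity: the gap between the two sides is half the double sum of (a_i b_j - a_j
    b_i)^2. *)
Lemma cauchy_schwarz_sum (R : realFieldType) (I : finType) (a b : I -> R) :
  (\sum_i a i * b i) ^+ 2 <= (\sum_i a i ^+ 2) * (\sum_i b i ^+ 2).
Proof.
have h : 0 <= \sum_i \sum_j (a i * b j - a j * b i) ^+ 2.
  by apply: sumr_ge0 => i _; apply: sumr_ge0 => j _; exact: sqr_ge0.
have e : \sum_i \sum_j (a i * b j - a j * b i) ^+ 2 =
    2 * ((\sum_i a i ^+ 2) * (\sum_i b i ^+ 2) - (\sum_i a i * b i) ^+ 2).
  transitivity (\sum_i \sum_j (a i ^+ 2 * b j ^+ 2) + \sum_i \sum_j (a j ^+ 2 * b i ^+ 2)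
      - 2 * \sum_i \sum_j (a i * b i * (a j * b j))).
    rewrite mulr_sumr -big_split/= -sumrB; apply: eq_bigr => i _.
    rewrite mulr_sumr -big_split/= -sumrB; apply: eq_bigr => j _.
    by ring.
  rewrite [X in _ + X - _]exchange_big/= -!big_distrlr/= expr2; ring.
by move: h; rewrite e pmulr_rge0// subr_ge0.
Qed.

Section trace_form.
Context (R : realFieldType) (n : nat).
Implicit Types (M N Q : 'M[R]_n).

Lemma mxtrace_mulE M N : \tr (M *m N) = \sum_i \sum_j M i j * N j i.
Proof. by rewrite /mxtrace; apply: eq_bigr => i _; rewrite mxE. Qed.

Lemma mxtrace_sqrE M : M^T = M -> \tr (M *m M) = \sum_i \sum_j M i j ^+ 2.
Proof.
move=> MT; rewrite mxtrace_mulE; apply: eq_bigr => i _; apply: eq_bigr => j _.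
by rewrite -{2}MT mxE expr2.
Qed.

Lemma mxtrace_sqr_ge0 M : M^T = M -> 0 <= \tr (M *m M).
Proof.
move=> MT; rewrite mxtrace_sqrE//.
by apply: sumr_ge0 => i _; apply: sumr_ge0 => j _; exact: sqr_ge0.
Qed.

(** Cauchy-Schwarz entry by entry: the square of (M^2)_ij is at most the product of the squared
    norms of rows i and j of M; then sum over i and j. *)
Lemma mxtrace_pow4 M : M^T = M ->
  \tr (M *m M *m (M *m M)) <= \tr (M *m M) ^+ 2.
Proof.
move=> MT.
have MMT : (M *m M)^T = M *m M by rewrite trmx_mul MT.
rewrite mxtrace_sqrE// mxtrace_sqrE// expr2 big_distrlr/=.
apply: ler_sum => i _; apply: ler_sum => j _.
rewrite mxE (eq_bigr (fun k => M i k * M j k)); last first.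
  by move=> k _; rewrite -{2}MT mxE.
exact: cauchy_schwarz_sum.
Qed.

End trace_form.

(** * Moments of a normalised quadratic form of a projected Gaussian vector *)

Section projection_ratio.
Context (R : realType) (n : nat).
Variables (Q N : 'M[R]_n).
Hypotheses (QT : Q^T = Q) (QQ : Q *m Q = Q) (NT : N^T = N) (QN : Q *m N = N).

Let NQ : N *m Q = N.
Proof. by rewrite -NT -{1}QT -trmx_mul QN. Qed.

Lemma qform_projE u : qform Q u = \sum_k (Q *m u) k 0 ^+ 2.
Proof. by rewrite -{1}QQ qformM_sum//; apply: eq_bigr => k _; rewrite expr2. Qed.

Lemma qform_proj_ge0 u : 0 <= qform Q u.
Proof. by rewrite qform_projE; apply: sumr_ge0 => k _; exact: sqr_ge0. Qed.

Lemma qform_proj u : qform N u = qform N (Q *m u).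
Proof. by rewrite /qform trmx_mul QT -!mulmxA (mulmxA N) NQ (mulmxA Q) QN. Qed.

Definition mx_abs_sum (M : 'M[R]_n) := \sum_j \sum_i `|M i j|.

Lemma mx_abs_sum_ge0 M : 0 <= mx_abs_sum M.
Proof. by apply: sumr_ge0 => j _; exact: sumr_ge0. Qed.

(** The constant is crude: what matters is that q / r is bounded and that q vanishes wherever r
    does. *)
Lemma qform_le u : `|qform N u| <= mx_abs_sum N * qform Q u.
Proof.
rewrite qform_proj qform_projE qformE /mx_abs_sum big_distrl/=.
apply: le_trans (ler_norm_sum _ _ _) _; apply: ler_sum => j _.
rewrite big_distrl/=; apply: le_trans (ler_norm_sum _ _ _) _; apply: ler_sum => i _.
rewrite !normrM mulrAC mulrC ler_wpM2l//.
set y := Q *m u.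
have h l : y l 0 ^+ 2 <= \sum_k y k 0 ^+ 2.
  by rewrite (bigD1 l)//= lerDl; apply: sumr_ge0 => k _; exact: sqr_ge0.
have := h i; have := h j; rewrite -!(real_normK (num_real (y _ 0))).
by set a := `|y i 0|; set b := `|y j 0| => *; nra.
Qed.

End projection_ratio.

Section projection_moments.
Context d (Om : measurableType d) (R : realType) (P : probability Om R) (n : nat)
  (X : 'I_n -> {mfun Om >-> measurableTypeR R}) (s : R).
Hypothesis s0 : 0 < s.
Hypothesis indX : forall A : 'I_n -> set (measurableTypeR R),
  (forall i, measurable (A i)) ->
  P (\bigcap_(i in setT) X i @^-1` A i) = (\prod_i P (X i @^-1` A i))%E.
Hypothesis lawX : forall k A, measurable A ->
  distribution P (X k) A = normal_prob 0 s A.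

Let v (w : Om) : 'cV[R]_n := \col_k X k w.

Variables (Q : 'M[R]_n) (m : R).
Hypotheses (QT : Q^T = Q) (QQ : Q *m Q = Q) (trQ : \tr Q = m) (m0 : 0 < m).

Let r w := qform Q (v w).
Let D (dl : R) w := (dl + r w)^-1.

Let r0 w : 0 <= r w. Proof. exact: qform_proj_ge0. Qed.
Let tX k : tame P (X k). Proof. exact: tame_coord s0 lawX k. Qed.
Let tq M : tame P (fun w => qform M (v w)). Proof. exact: tame_qform. Qed.
Let tD dl : 0 < dl -> tame P (D dl).
Proof. by move=> dl0; apply: (tame_regularized s0 lawX dl0) => u; exact: qform_proj_ge0. Qed.

Let cvg_D w : r w != 0 -> D (harmonic k) w @[k --> \oo] --> (r w)^-1.
Proof.
move=> rw; apply: cvgV => //; rewrite -[X in _ --> X]add0r.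
apply: cvgD; [exact: cvg_harmonic|exact: cvg_cst].
Qed.

Let cvgXn (f : nat -> R) (l : R) e : f k @[k --> \oo] --> l -> f k ^+ e @[k --> \oo] --> l ^+ e.
Proof.
move=> fl; elim: e => [|e ih]; first by rewrite expr0; exact: cvg_cst.
rewrite exprS; under eq_cvg do rewrite exprS; exact: cvgM.
Qed.

Lemma harmonic_gt0' k : 0 < harmonic k :> R.
Proof. by rewrite /harmonic/= invr_gt0 ltr0n. Qed.

Let rD_bound dl w : 0 < dl -> 0 <= r w * D dl w <= 1.
Proof.
move=> dl0; have h : 0 < dl + r w by rewrite ltr_wpDr.
rewrite mulr_ge0 ?invr_ge0 ?(ltW h)//= ler_pdivrMr// mul1r.
by rewrite lerDr ltW.
Qed.

Section quotient.
Variable N : 'M[R]_n.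
Hypotheses (NT : N^T = N) (QN : Q *m N = N).
Let q w := qform N (v w).

(** Dominated convergence. From |q| <= C r and r D <= 1 comes the bound C^a r^(a + b - c), a genuine
    power as c <= a + b. Where r = 0 also q = 0, and a > 0 makes both sides vanish. *)
Lemma cvg_regularized a b c : (0 < a)%N -> (c <= a + b)%N ->
  mean P (fun w => r w ^+ b * q w ^+ a * D (harmonic k) w ^+ c) @[k --> \oo] -->
  mean P (fun w => r w ^+ b * q w ^+ a * (r w)^-1 ^+ c).
Proof.
move=> a0 cab; set C := mx_abs_sum N.
have C0 : 0 <= C by exact: mx_abs_sum_ge0.
have tr : tame P r by exact: tq.
apply: (@mean_dominated_cvg _ _ R P _ _ (fun w => C ^+ a * r w ^+ (a + b - c))).
- move=> k; apply: (@tame_measurable _ _ _ P).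
  exact: tameM (tameM (tameX _ tr) (tameX _ (tq N))) (tameX _ (tD (harmonic_gt0' k))).
- by apply: tameZ; exact: tameX.
- move=> k w; have dl0 := harmonic_gt0' k.
  have /andP[h0 h1] := rD_bound w dl0.
  have D0 : 0 <= D (harmonic k) w by rewrite invr_ge0 addr_ge0// ltW.
  have rb : r w ^+ (a + b) * D (harmonic k) w ^+ c <= r w ^+ (a + b - c).
    rewrite -{1}(subnK cab) exprD -mulrA -exprMn ler_piMr ?exprn_ge0//.
    exact: exprn_ile1.
  rewrite !normrM !normrX (ger0_norm (r0 w)) (ger0_norm D0).
  apply: (@le_trans _ _ (C ^+ a * (r w ^+ (a + b) * D (harmonic k) w ^+ c))); last first.
    by rewrite ler_wpM2l// exprn_ge0.
  rewrite mulrA ler_wpM2r ?exprn_ge0// exprD mulrA mulrC ler_wpM2r ?exprn_ge0//.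
  rewrite -exprMn; apply: lerXn2r; rewrite ?nnegrE ?mulr_ge0//.
  exact: qform_le.
- move=> w; have [rw|rw] := eqVneq (r w) 0.
    have -> : q w = 0.
      by apply/eqP; rewrite -normr_eq0 eq_le normr_ge0 andbT;
        have := qform_le QT QQ NT QN (v w); rewrite -/(r w) rw mulr0.
    rewrite expr0n -[a == 0%N]negbK -lt0n a0/= mulr0 mul0r.
    by under eq_cvg do rewrite mul0r; exact: cvg_cst.
  by apply: cvgM; [exact: cvg_cst|apply: cvgXn; exact: cvg_D].
Qed.

Let q0 w : r w = 0 -> q w = 0.
Proof.
move=> rw; apply/eqP; rewrite -normr_eq0 eq_le normr_ge0 andbT.
by have := qform_le QT QQ NT QN (v w); rewrite -/(r w) rw mulr0.
Qed.

(* Integration by parts is applied to q^a / (r + dl)^l and then dl is sent to 0,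
   which avoids the singularity of 1 / r. *)
Lemma quotient_step a l : (l < a)%N ->
  mean P (fun w => q w ^+ a * (r w)^-1 ^+ l) =
  s ^+ 2 * (m + 2 * (a - l.+1)%:R) * mean P (fun w => q w ^+ a * (r w)^-1 ^+ l.+1).
Proof.
move=> la; have a0 : (0 < a)%N by exact: leq_ltn_trans la.
have tr : tame P r by exact: tq.
pose F dl b c w := r w ^+ b * q w ^+ a * D dl w ^+ c.
have tF dl b c : 0 < dl -> tame P (F dl b c).
  move=> dl0; exact: tameM (tameM (tameX _ tr) (tameX _ (tq N))) (tameX _ (tD dl0)).
(* Integration by parts with L = Q: since Q N = N and Q Q = Q, the forms on the right are again q
   and r, so the identity closes up. *)
have step dl : 0 < dl -> mean P (F dl 1 l.+1) =
    s ^+ 2 * ((m + 2 * a%:R) * mean P (F dl 0 l.+1) - 2 * l.+1%:R * mean P (F dl 1 l.+2)).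
  move=> dl0.
  have := gaussian_ibp s0 indX lawX a l.+1 QT NT QT dl0 (qform_proj_ge0 QT QQ).
  rewrite QN QQ trQ => e.
  transitivity (mean P (fun w => qform Q (v w) * (qform N (v w) ^+ a * D dl w ^+ l.+1))).
    by apply: eq_mean => w; rewrite /F expr1 mulrA.
  rewrite [LHS]e [RHS]mulrBr [LHS]mulrBr.
  congr (_ - _); congr (_ * _).
    rewrite [RHS]mulrDl; congr (_ * _ + _ * _); apply: eq_mean => w.
      by rewrite /F expr0 mul1r.
    by rewrite /F expr0 mul1r -exprS prednK.
have c1 : mean P (F (harmonic k) 1 l.+1) @[k --> \oo] -->
    mean P (fun w => r w ^+ 1 * q w ^+ a * (r w)^-1 ^+ l.+1).
  by apply: cvg_regularized => //; rewrite addn1 ltnS ltnW.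
have c2 : mean P (F (harmonic k) 0 l.+1) @[k --> \oo] -->
    mean P (fun w => r w ^+ 0 * q w ^+ a * (r w)^-1 ^+ l.+1).
  by apply: cvg_regularized => //; rewrite addn0.
have c3 : mean P (F (harmonic k) 1 l.+2) @[k --> \oo] -->
    mean P (fun w => r w ^+ 1 * q w ^+ a * (r w)^-1 ^+ l.+2).
  by apply: cvg_regularized => //; rewrite addn1.
have c4 : s ^+ 2 * ((m + 2 * a%:R) * mean P (F (harmonic k) 0 l.+1) -
      2 * l.+1%:R * mean P (F (harmonic k) 1 l.+2)) @[k --> \oo] -->
    s ^+ 2 * ((m + 2 * a%:R) * mean P (fun w => r w ^+ 0 * q w ^+ a * (r w)^-1 ^+ l.+1) -
      2 * l.+1%:R * mean P (fun w => r w ^+ 1 * q w ^+ a * (r w)^-1 ^+ l.+2)).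
  by apply: cvgMr; apply: cvgB; apply: cvgMr.
have e : (fun k => mean P (F (harmonic k) 1 l.+1)) = (fun k => s ^+ 2 *
    ((m + 2 * a%:R) * mean P (F (harmonic k) 0 l.+1) - 2 * l.+1%:R * mean P (F (harmonic k) 1 l.+2))).
  by apply/funext => k; rewrite step// harmonic_gt0'.
have e1 : mean P (fun w => r w ^+ 1 * q w ^+ a * (r w)^-1 ^+ l.+1) =
    mean P (fun w => q w ^+ a * (r w)^-1 ^+ l).
  apply: eq_mean => w; rewrite expr1; have [rw|rw] := eqVneq (r w) 0.
    by rewrite (q0 rw) expr0n -[a == 0%N]negbK -lt0n a0/= mulr0 !mul0r.
  by rewrite exprS mulrACA divff// mul1r.
have e3 : mean P (fun w => r w ^+ 1 * q w ^+ a * (r w)^-1 ^+ l.+2) =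
    mean P (fun w => q w ^+ a * (r w)^-1 ^+ l.+1).
  apply: eq_mean => w; rewrite expr1; have [rw|rw] := eqVneq (r w) 0.
    by rewrite (q0 rw) expr0n -[a == 0%N]negbK -lt0n a0/= mulr0 !mul0r.
  by rewrite exprS mulrACA divff// mul1r.
have e2 : mean P (fun w => r w ^+ 0 * q w ^+ a * (r w)^-1 ^+ l.+1) =
    mean P (fun w => q w ^+ a * (r w)^-1 ^+ l.+1).
  by apply: eq_mean => w; rewrite expr0 mul1r.
rewrite e1 e in c1; rewrite e2 e3 in c4.
by rewrite (cvg_unique _ c1 c4)// natrB//; ring.
Qed.

End quotient.
(** The residual is almost surely nonzero, by integration by parts alone. With D = 1 / (dl + r), E
    (dl r D) = s^2 (m E (dl D) - 2 E (dl D r D)). As dl tends to 0, dl D tends to the indicator of r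
    = 0 while the other two means vanish, which leaves s^2 m P(r = 0) = 0. *)
Lemma mean_proj_eq0 : mean P (fun w => (r w == 0)%:R) = 0.
Proof.
have tr : tame P r by exact: tq.
pose e (k : nat) : R := harmonic k.
have e0 k : 0 < e k by exact: harmonic_gt0'.
have ce : e k @[k --> \oo] --> 0 by exact: cvg_harmonic.
have eD_bound k w : 0 <= e k * D (e k) w <= 1.
  have h : 0 < e k + r w by rewrite ltr_wpDr.
  rewrite mulr_ge0 ?invr_ge0 ?(ltW h) ?(ltW (e0 _))//= ler_pdivrMr// mul1r.
  by rewrite lerDl.
have step k : mean P (fun w => e k * (r w * D (e k) w)) =
    s ^+ 2 * (m * mean P (fun w => e k * D (e k) w) -
      2 * mean P (fun w => e k * D (e k) w * (r w * D (e k) w))).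
  have tDk := tD (e0 k).
  have := gaussian_ibp s0 indX lawX 0 1 QT QT QT (e0 k) (qform_proj_ge0 QT QQ).
  rewrite mulr0 mul0r addr0 mulr1 QQ trQ => h.
  rewrite meanZ; last exact: tameM.
  rewrite [X in _ * (m * X - _)]meanZ//.
  rewrite (_ : mean P (fun w => e k * D (e k) w * (r w * D (e k) w)) =
      e k * mean P (fun w => r w * D (e k) w ^+ 2)); last first.
    rewrite -meanZ; last by exact: tameM tr (tameX 2 tDk).
    by apply: eq_mean => w; ring.
  rewrite (_ : mean P (fun w => r w * D (e k) w) = s ^+ 2 * (m * mean P (D (e k)) -
      2 * mean P (fun w => r w * D (e k) w ^+ 2))); first by ring.
  transitivity (mean P (fun w => qform Q (v w) * (qform Q (v w) ^+ 0 * D (e k) w ^+ 1))).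
    by apply: eq_mean => w; rewrite expr0 mul1r.
  rewrite [LHS]h; congr (_ * (_ * _ - _ * _)); apply: eq_mean => w.
    by rewrite expr0 mul1r.
  by rewrite expr0 mulr1.
have c1 : mean P (fun w => e k * (r w * D (e k) w)) @[k --> \oo] --> 0.
  apply/norm_cvg0P; apply: (@squeeze_cvgr _ _ _ _ (cst 0) e) => //; last exact: cvg_cst.
  near=> k; rewrite normr_ge0/=.
  have t1 : tame P (fun w => e k * (r w * D (e k) w)).
    by apply: tameZ; apply: tameM => //; exact: tD.
  apply: le_trans (norm_mean t1) _; rewrite -[leRHS](mean_cst P).
  apply: le_mean; [exact: tame_norm|exact: tame_cst|move=> w].
  have /andP[h0 h1] := rD_bound w (e0 k).
  by rewrite normrM (gtr0_norm (e0 k)) (ger0_norm h0) ler_piMr// ltW.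
have c2 : mean P (fun w => e k * D (e k) w) @[k --> \oo] --> mean P (fun w => (r w == 0)%:R).
  apply: (@mean_dominated_cvg _ _ R P _ _ (cst 1)).
  - by move=> k; apply: (@tame_measurable _ _ _ P); apply: tameZ; exact: tD.
  - exact: tame_cst.
  - by move=> k w; have /andP[h0 h1] := eD_bound k w; rewrite ger0_norm.
  - move=> w; have [rw|rw] := eqVneq (r w) 0.
      apply: cvg_near_cst; near=> k; rewrite /D rw addr0 divff//.
      by rewrite gt_eqF.
    rewrite -[X in _ --> X](mul0r (r w)^-1); apply: cvgM => //; exact: cvg_D.
have c3 : mean P (fun w => e k * D (e k) w * (r w * D (e k) w)) @[k --> \oo] --> mean P (cst 0).
  apply: (@mean_dominated_cvg _ _ R P _ _ (cst 1)).
  - move=> k; apply: (@tame_measurable _ _ _ P).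
    exact: tameM (tameZ _ (tD (e0 k))) (tameM tr (tD (e0 k))).
  - exact: tame_cst.
  - move=> k w; have /andP[h0 h1] := eD_bound k w; have /andP[h2 h3] := rD_bound w (e0 k).
    by rewrite normrM (ger0_norm h0) (ger0_norm h2) -[leRHS]mulr1 ler_pM.
  - move=> w; have [rw|rw] := eqVneq (r w) 0.
      by apply: cvg_near_cst; near=> k; rewrite rw mul0r mulr0.
    rewrite (_ : cst 0 w = 0 * (r w)^-1 * (r w * (r w)^-1)); last by rewrite !mul0r.
    apply: cvgM; first by apply: cvgM => //; exact: cvg_D.
    by apply: cvgMr; exact: cvg_D.
rewrite mean_cst in c3.
have c4 : s ^+ 2 * (m * mean P (fun w => e k * D (e k) w) -
      2 * mean P (fun w => e k * D (e k) w * (r w * D (e k) w))) @[k --> \oo] -->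
     s ^+ 2 * (m * mean P (fun w => (r w == 0)%:R) - 2 * 0).
  by apply: cvgMr; apply: cvgB; apply: cvgMr.
have E := funext step.
rewrite E in c1.
have : s ^+ 2 * (m * mean P (fun w => (r w == 0)%:R) - 2 * 0) = 0.
  by apply: (cvg_unique _ c4 c1).
move/eqP.
rewrite mulr0 subr0 mulrA mulf_eq0 => /orP[|/eqP//].
by rewrite gt_eqF// mulr_gt0// exprn_gt0.
Unshelve. all: by end_near.
Qed.

Section moments.
Variable M : 'M[R]_n.
Hypothesis MT : M^T = M.
(** The compression of [M] to the range of [Q], made trace-free. With A the projection onto the
    residual, its form divided by r is tr ((A - Q / m) M). *)
Let N := Q *m M *m Q - (\tr (Q *m M) / m) *: Q.
Let kappa := \tr (N *m N).
Let q w := qform N (v w).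

Let NT : N^T = N.
Proof. by rewrite /N linearB/= linearZ/= !trmx_mul QT MT mulmxA. Qed.

Let QN : Q *m N = N.
Proof. by rewrite /N mulmxBr !mulmxA QQ -scalemxAr QQ. Qed.

Let trN : \tr N = 0.
Proof.
rewrite /N linearB/= linearZ/= trQ -mulmxA mxtrace_mulC -mulmxA QQ.
rewrite [\tr (M *m Q)]mxtrace_mulC.
by rewrite divfK ?gt_eqF// subrr.
Qed.

Lemma kappaE : kappa = \tr (Q *m M *m Q *m M) - \tr (Q *m M) ^+ 2 / m.
Proof.
have NN : N *m N = Q *m M *m N - (\tr (Q *m M) / m) *: N.
  transitivity ((Q *m M *m Q - (\tr (Q *m M) / m) *: Q) *m N) => //.
  by rewrite mulmxBl -scalemxAl -(mulmxA (Q *m M)) !QN.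
rewrite /kappa NN linearB/= linearZ/= trN mulr0 subr0 /N.
rewrite mulmxBr -scalemxAr linearB/= linearZ/= !mulmxA.
rewrite mxtrace_mulC !mulmxA QQ [\tr (Q *m M *m Q)]mxtrace_mulC mulmxA QQ.
by congr (_ - _); ring.
Qed.

Let ibpN L a : L^T = L -> mean P (fun w => qform L (v w) * q w ^+ a) =
  s ^+ 2 * (\tr L * mean P (fun w => q w ^+ a) +
    2 * a%:R * mean P (fun w => qform (L *m N) (v w) * q w ^+ a.-1)).
Proof.
move=> LT.
have := gaussian_ibp s0 indX lawX a 0 LT NT QT ltr01 (qform_proj_ge0 QT QQ).
rewrite mulr0 mul0r subr0 => h.
transitivity (mean P (fun w => qform L (v w) * (qform N (v w) ^+ a * D 1 w ^+ 0))).
  by apply: eq_mean => w; rewrite expr0 mulr1.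
rewrite [LHS]h; congr (_ * (_ * _ + _ * _)); apply: eq_mean => w.
  by rewrite expr0 mulr1.
by rewrite expr0 mulr1.
Qed.

Let mean_qform L : L^T = L -> mean P (fun w => qform L (v w)) = s ^+ 2 * \tr L.
Proof.
move=> LT; rewrite (_ : s ^+ 2 * \tr L = mean P (fun w => qform L (v w) * q w ^+ 0)).
  by apply: eq_mean => w; rewrite mulr1.
rewrite ibpN// mulr0 mul0r addr0 (_ : mean P _ = 1) ?mulr1//.
exact: (mean_cst P 1).
Qed.

Let NNT : (N *m N)^T = N *m N. Proof. by rewrite trmx_mul NT. Qed.

Let qX a : mean P (fun w => q w ^+ a.+1) =
  2 * a%:R * s ^+ 2 * mean P (fun w => qform (N *m N) (v w) * q w ^+ a.-1).
Proof.
transitivity (mean P (fun w => qform N (v w) * q w ^+ a)).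
  by apply: eq_mean => w; rewrite exprS.
by rewrite ibpN// trN mul0r add0r; ring.
Qed.

(** Integration by parts gives E q^4 = 6 s^2 E (h q^2), with h the form of N^2. By AM-GM half of E
    q^4 is absorbed, leaving 36 s^4 E h^2, and E h^2 <= 3 s^4 kappa^2 because tr N^4 <= kappa^2.
    Hence 108 = 36 * 3. *)
Let mean_q4 : mean P (fun w => q w ^+ 4) <= 108 * s ^+ 8 * kappa ^+ 2.
Proof.
pose h w := qform (N *m N) (v w).
have th : tame P h by exact: tq.
have tqq : tame P q by exact: tq.
have h2 : mean P (fun w => h w ^+ 2) <= 3 * s ^+ 4 * kappa ^+ 2.
  have := gaussian_ibp s0 indX lawX 1 0 NNT NNT QT ltr01 (qform_proj_ge0 QT QQ).
  rewrite mulr0 mul0r subr0 mulr1 => e.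
  rewrite (_ : mean P (fun w => h w ^+ 2) = mean P
     (fun w => qform (N *m N) (v w) * (qform (N *m N) (v w) ^+ 1 * D 1 w ^+ 0))); last first.
    by apply: eq_mean => w; rewrite mulr1 expr1 expr2.
  rewrite e.
  rewrite (_ : mean P (fun w => qform (N *m N) (v w) ^+ 1 * D 1 w ^+ 0) = s ^+ 2 * kappa); last first.
    by rewrite -(mean_qform NNT); apply: eq_mean => w; rewrite mulr1.
  rewrite (_ : mean P (fun w => qform (N *m N *m (N *m N)) (v w) * qform (N *m N) (v w) ^+ 0 * D 1 w ^+ 0)
     = s ^+ 2 * \tr (N *m N *m (N *m N))); last first.
    rewrite -mean_qform; first by apply: eq_mean => w; rewrite !mulr1.
    by rewrite trmx_mul NNT.
  have := mxtrace_pow4 NT; rewrite -/kappa.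
  set t := \tr _ => ht.
  rewrite (_ : 3 * s ^+ 4 * kappa ^+ 2 = s ^+ 2 * (kappa * (s ^+ 2 * kappa) + 2 * (s ^+ 2 * kappa ^+ 2))); last by ring.
  by rewrite ler_wpM2l ?sqr_ge0// lerD2l !ler_wpM2l// sqr_ge0.
have e4 := qX 3.
have le6 : 6 * s ^+ 2 * mean P (fun w => h w * q w ^+ 2) <=
    2^-1 * mean P (fun w => q w ^+ 4) + 18 * s ^+ 4 * mean P (fun w => h w ^+ 2).
  have t1 := tameX 4 tqq; have t2 := tameX 2 th.
  rewrite -!meanZ//; last by apply: tameM => //; exact: tameX.
  rewrite -meanD; [|exact: tameZ|exact: tameZ].
  apply: le_mean; [by apply: tameZ; apply: tameM => //; exact: tameX|by apply: tameD; exact: tameZ|].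
  move=> w; set x := q w ^+ 2; have -> : q w ^+ 4 = x ^+ 2 by rewrite /x -exprM.
  rewrite -subr_ge0; have -> : 2^-1 * x ^+ 2 + 18 * s ^+ 4 * h w ^+ 2 - 6 * s ^+ 2 * (h w * x)
    = 2^-1 * (x - 6 * s ^+ 2 * h w) ^+ 2 by field.
  by rewrite mulr_ge0// sqr_ge0.
have {}e4 : mean P (fun w => q w ^+ 4) = 6 * s ^+ 2 * mean P (fun w => h w * q w ^+ 2).
  by rewrite e4; ring.
have s4 : 0 <= s ^+ 4 by rewrite exprn_ge0// ltW.
have h3 : s ^+ 4 * mean P (fun w => h w ^+ 2) <= s ^+ 4 * (3 * s ^+ 4 * kappa ^+ 2).
  exact: ler_wpM2l.
have -> : 108 * s ^+ 8 * kappa ^+ 2 = 36 * (s ^+ 4 * (3 * s ^+ 4 * kappa ^+ 2)) by ring.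
lra.
Qed.

Let divE a w : (q w / r w) ^+ a = q w ^+ a * (r w)^-1 ^+ a.
Proof. by rewrite exprMn. Qed.

Let s2 : s ^+ 2 != 0. Proof. by rewrite expf_neq0// gt_eqF. Qed.

Lemma mean_ratio : mean P (fun w => q w / r w) = 0.
Proof.
have := quotient_step NT QN (ltn0Sn 0).
rewrite subnn mulr0 addr0 => /eqP.
rewrite (_ : mean P (fun w => q w ^+ 1 * (r w)^-1 ^+ 0) = 0); last first.
  have := qX 0; rewrite mulr0 !mul0r => e; rewrite -[RHS]e.
  by apply: eq_mean => w; rewrite mulr1.
rewrite eq_sym mulf_eq0 mulf_eq0 (negbTE s2) (gt_eqF m0) => /eqP e; rewrite -[RHS]e.
by apply: eq_mean => w; rewrite !expr1.
Qed.

(** Two uses of [quotient_step] contribute the factors s^2 (m + 2) and s^2 m, while E q^2 = 2 s^4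
    kappa. *)
Lemma mean_ratio_sqr :
  mean P (fun w => (q w / r w) ^+ 2) = 2 * kappa / (m * (m + 2)).
Proof.
have e1 := quotient_step NT QN (ltn0Sn 1).
have e2 := quotient_step NT QN (ltnSn 1).
rewrite subnn mulr0 addr0 in e2; rewrite e2 subSS subn0 mulr1 in e1.
have e0 : mean P (fun w => q w ^+ 2 * (r w)^-1 ^+ 0) = 2 * s ^+ 4 * kappa.
  transitivity (mean P (fun w => q w ^+ 2)); first by apply: eq_mean => w; rewrite mulr1.
  rewrite (qX 1) (_ : mean P _ = s ^+ 2 * kappa).
    by rewrite mulr1; ring.
  by rewrite -(mean_qform NNT); apply: eq_mean => w; rewrite mulr1.
rewrite (eq_mean P (divE 2)).
have m2 : m + 2 != 0 by rewrite gt_eqF// addr_gt0.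
have mn := gt_eqF m0.
move: e1; rewrite e0 => /(congr1 (fun t => t / (s ^+ 4 * (m * (m + 2))))) e.
rewrite (_ : 2 * kappa / (m * (m + 2)) = 2 * s ^+ 4 * kappa / (s ^+ 4 * (m * (m + 2)))).
  by rewrite e; field; rewrite mn m2 gt_eqF.
by field; rewrite mn m2 gt_eqF.
Qed.

(** Four uses of [quotient_step] contribute s^8 (m + 6) (m + 4) (m + 2) m, which is at least s^8
    m^4; then [mean_q4] applies. *)
Lemma mean_ratio_pow4 :
  mean P (fun w => (q w / r w) ^+ 4) <= 108 * kappa ^+ 2 / m ^+ 4.
Proof.
have e1 := quotient_step NT QN (isT : 0 < 4)%N.
have e2 := quotient_step NT QN (isT : 1 < 4)%N.
have e3 := quotient_step NT QN (isT : 2 < 4)%N.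
have e4 := quotient_step NT QN (isT : 3 < 4)%N.
rewrite e2 e3 e4 in e1.
rewrite (eq_mean P (divE 4)).
set x := mean P (fun w => q w ^+ 4 * (r w)^-1 ^+ 4) in e1 *.
have x0 : 0 <= x.
  by apply: mean_ge0 => w; rewrite -divE -[4%N]/(2 * 2)%N exprM sqr_ge0.
have : mean P (fun w => q w ^+ 4) <= 108 * s ^+ 8 * kappa ^+ 2 := mean_q4.
rewrite (_ : mean P (fun w => q w ^+ 4) = mean P (fun w => q w ^+ 4 * (r w)^-1 ^+ 0)); last first.
  by apply: eq_mean => w; rewrite mulr1.
rewrite e1 !subSS !subn0 => h.
have s8 : 0 < s ^+ 8 by rewrite exprn_gt0.
rewrite ler_pdivlMr ?exprn_gt0// -(ler_pM2l s8).
rewrite (_ : s ^+ 8 * (108 * kappa ^+ 2) = 108 * s ^+ 8 * kappa ^+ 2); last by ring.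
apply: le_trans h.
rewrite (_ : s ^+ 8 * (x * m ^+ 4) = s ^+ 8 * x * (m * m * m * m)); last by ring.
rewrite (_ : s ^+ 2 * (m + 2 * 3%:R) * _ = s ^+ 8 * x * ((m + 6) * (m + 4) * (m + 2) * m)); last by ring.
apply: ler_wpM2l; first by rewrite mulr_ge0// ltW.
by rewrite ler_wpM2r ?(ltW m0)// !ler_pM ?mulr_ge0 ?(ltW m0)// lerDl.
Qed.

End moments.
End projection_moments.

(** * From the multivariate density to independent normal coordinates *)

Section tuple_integral.
Context (R : realType).
Local Notation mu := (@lebesgue_measure R).

(** The constant [c] absorbs the factor of the coordinate already fixed by the outer integral, which
    makes the induction on the dimension go through. *)
Lemma lebesgue_integral_tuple_prod n (h : 'I_n -> R -> R) (I : 'I_n -> R) (c : R) :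
  0 <= c -> (forall k x, 0 <= h k x) ->
  (forall k, measurable_fun setT (h k)) ->
  (forall k, \int[mu]_x (h k x)%:E = (I k)%:E)%E ->
  lebesgue_integral_tuple (fun t : n.-tuple R => (c * \prod_k h k (tnth t k))%:E) =
  (c * \prod_k I k)%:E.
Proof.
elim: n h I c => [|n ih] h I c c0 h0 mh hI /=; first by rewrite !big_ord0.
transitivity (\int[mu]_x (h ord0 x * (c * \prod_k I (lift ord0 k)))%:E)%E.
  apply: eq_integral => x _.
  rewrite mulrA (mulrC (h ord0 x)) -[RHS](ih (fun k => h (lift ord0 k)) (fun k => I (lift ord0 k)))//.
  - congr lebesgue_integral_tuple; apply/funext => t; congr EFin.
    rewrite big_ord_recl mulrA; congr (c * _ * _).
    by apply: eq_bigr => k _; rewrite tnthS.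
  - by rewrite mulr_ge0.
under eq_integral do rewrite EFinM.
have I0 k : 0 <= I k by rewrite -lee_fin -hI integral_ge0// => x _; rewrite lee_fin.
rewrite ge0_integralZr//.
- by rewrite hI -EFinM big_ord_recl; congr EFin; ring.
- by apply/measurable_EFinP; exact: mh.
- by move=> x _; rewrite lee_fin.
- by rewrite lee_fin mulr_ge0// prodr_ge0.
Qed.

Lemma normal_peak_exp n (s : R) : 0 < s ->
  (Num.sqrt ((2 * pi) ^+ n * \det ((s ^+ 2)%:M : 'M[R]_n)))^-1 = normal_peak s ^+ n.
Proof.
move=> s0; rewrite det_scalar -exprMn /normal_peak exprVn; congr (_^-1).
have -> : 2 * pi * s ^+ 2 = s ^+ 2 * pi *+ 2 by rewrite -mulr_natl; ring.
have : 0 <= s ^+ 2 * pi *+ 2 by rewrite pmulrn_lge0// mulr_ge0 ?sqr_ge0 ?pi_ge0.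
set y := _ *+ 2 => y0; elim: n => [|n ih]; first by rewrite !expr0 sqrtr1.
by rewrite !exprS sqrtrM ?ih.
Qed.

Lemma multinormal_pdf_prod n (s : R) (t : n.-tuple R) : 0 < s ->
  multinormal_pdf 0 (s ^+ 2)%:M (col_of_tuple t) =
  \prod_k normal_pdf 0 s (tnth t k).
Proof.
move=> s0; have s1 : s != 0 by rewrite gt_eqF.
rewrite /multinormal_pdf normal_peak_exp// subr0 invmx_scalar mul_mx_scalar -scalemxAl.
under eq_bigr do rewrite normal_pdf0E//.
rewrite big_split/= prodr_const card_ord mulrC; congr (_ * _).
rewrite -expR_sum; congr expR; rewrite !mxE sumrN; congr (- _).
rewrite mulr_sumr mulr_suml; apply: eq_bigr => k _; rewrite !mxE.
by field.
Qed.

End tuple_integral.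

Section multinormal_coordinates.
Context d (Om : measurableType d) (R : realType) (Pr : probability Om R) (n : nat)
  (e : {RV Pr >-> n.-tuple R}) (s : R).
Hypothesis s0 : 0 < s.
Hypothesis he : multinormal_law e 0 (s ^+ 2)%:M.

Definition tuple_coord (k : 'I_n) (t : n.-tuple R) : measurableTypeR R := tnth t k.

Let measurable_tuple_coord k : measurable_fun setT (tuple_coord k).
Proof. exact: measurable_tnth. Qed.

HB.instance Definition _ k :=
  isMeasurableFun.Build _ _ _ _ (tuple_coord k) (measurable_tuple_coord k).

(** The covariance is scalar, so the density factorises and the iterated integral over a box is a
    product. Both the marginal laws and the independence of the coordinates are read off from
    this. *)
Lemma multinormal_box (A : 'I_n -> set (measurableTypeR R)) :
  (forall k, measurable (A k)) ->
  distribution Pr e (\bigcap_(k in setT) tuple_coord k @^-1` A k) =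
  (\prod_k normal_prob 0 s (A k))%E.
Proof.
move=> mA; rewrite he; last first.
  apply: fin_bigcap_measurable => [|k _]; first exact: finite_finset.
  by rewrite -[X in measurable X]setTI; exact: measurable_tuple_coord.
have fA k : normal_prob 0 s (A k) \is a fin_num by exact: fin_num_measure.
transitivity ((1 * \prod_k fine (normal_prob 0 s (A k)))%:E).
  rewrite -(@lebesgue_integral_tuple_prod _ _ (fun k x => normal_pdf 0 s x * \1_(A k) x))//.
  - congr lebesgue_integral_tuple; apply/funext => t; congr EFin.
    rewrite mul1r multinormal_pdf_prod// big_split/=; congr (_ * _).
    rewrite indicE.
    have [h|h] := boolP (t \in _).
      rewrite big1// => k _; rewrite indicE mem_set//.
      by have := set_mem h; apply.
    have /existsNP[k hk] : ~ forall k, A k (tnth t k).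
      by move=> H; move/negP: h; apply; apply/mem_set => k _; exact: H.
    by apply/esym; rewrite (bigD1 k)//= indicE memNset ?mul0r.
  - by move=> k x; rewrite mulr_ge0// normal_pdf_ge0.
  - by move=> k; apply: measurable_funM; [exact: measurable_normal_pdf|apply: measurable_indic; exact: mA].
  - move=> k; rewrite fineK// /normal_prob [RHS]integral_mkcond; apply: eq_integral => x _.
    by rewrite patchE indicE; case: ifP => _; rewrite ?mulr1 ?mulr0.
rewrite mul1r.
rewrite (big_morph EFin (@EFinM R) (erefl 1%:E)).
by apply: eq_bigr => k _; rewrite fineK.
Qed.

Lemma multinormal_coord_law k (A : set (measurableTypeR R)) : measurable A ->
  distribution (distribution Pr e) (tuple_coord k) A = normal_prob 0 s A.
Proof.
move=> mA; pose B i := if i == k then A else setT.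
transitivity (distribution Pr e (\bigcap_(i in setT) tuple_coord i @^-1` B i)).
  congr (distribution Pr e _); apply/seteqP; split=> [t tA i _|t /(_ k Logic.I)].
    by rewrite /B /=; case: eqP => [->|].
  by rewrite /B /= eqxx.
have mB i : measurable (B i) by rewrite /B; case: ifP.
rewrite (multinormal_box mB).
rewrite (bigD1 k)//= /B eqxx big1 ?mule1// => i /negbTE ->.
exact: probability_setT.
Qed.

Lemma multinormal_coord_independent (A : 'I_n -> set (measurableTypeR R)) :
  (forall k, measurable (A k)) ->
  distribution Pr e (\bigcap_(k in setT) tuple_coord k @^-1` A k) =
  (\prod_k distribution Pr e (tuple_coord k @^-1` A k))%E.
Proof.
move=> mA; rewrite multinormal_box//; apply: eq_bigr => k _.
by rewrite -(multinormal_coord_law k (mA k)).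
Qed.

End multinormal_coordinates.

(** The nullity of r = 0 is phrased as a vanishing mean because this is the form in which the limit
    argument of [mean_proj_eq0] delivers it. *)
Lemma mean_ae_eq d (Om : measurableType d) (R : realType) (P : probability Om R)
    (f g r : Om -> R) :
  tame P f -> tame P g -> measurable_fun setT r ->
  mean P (fun w => (r w == 0)%:R) = 0 -> (forall w, r w != 0 -> f w = g w) ->
  mean P f = mean P g.
Proof.
move=> tf tg mr r0 fg; congr fine; apply: ae_eq_integral => //.
- exact/measurable_EFinP/tame_measurable/tf.
- exact/measurable_EFinP/tame_measurable/tg.
have m0 : measurable (r @^-1` [set 0]) by rewrite -[X in measurable X]setTI; exact: mr.
exists (r @^-1` [set 0]); split => //.
- have : mean P (\1_(r @^-1` [set 0]) : Om -> R) = 0.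
    rewrite -[RHS]r0; apply: eq_mean => w; rewrite indicE; congr ((nat_of_bool _)%:R).
    by apply/idP/idP => [/set_mem rw|/eqP rw]; [exact/eqP|exact/mem_set].
  rewrite /mean /Rintegral integral_indic// setIT => h.
  by rewrite -[LHS]fineK ?h// fin_num_measure.
- move=> w /= H; apply/eqP; apply: contra_notT H => rw _.
  by rewrite fg.
Qed.

Lemma mxtraceB (R : pzRingType) n (M N : 'M[R]_n) : \tr (M - N) = \tr M - \tr N.
Proof. exact: linearB. Qed.

(** * The rank-one projection onto a residual and its moments *)

Section direction_matrix.
Context (R : realType) (n : nat).
Implicit Types (Q M : 'M[R]_n) (u e : 'cV[R]_n).

Lemma qform_trace M e : qform M e = \tr (e *m e^T *m M).
Proof. by rewrite -mulmxA mxtrace_mulC /qform /mxtrace big_ord1. Qed.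

(* The value u u' on the null event [qform Q e == 0] makes A e a rank-one
   projection everywhere. *)
Definition direction_mx Q u e : 'M[R]_n :=
  if qform Q e == 0 then u *m u^T else (qform Q e)^-1 *: (Q *m e *m (Q *m e)^T).

Variables (Q : 'M[R]_n) (u : 'cV[R]_n).
Hypotheses (QT : Q^T = Q) (QQ : Q *m Q = Q) (Qu : Q *m u = u) (uu : u^T *m u = 1%:M).
Local Notation A := (direction_mx Q u).

Lemma direction_mx_sym e : (A e)^T = A e.
Proof.
rewrite /direction_mx; case: eqP => _; first by rewrite trmx_mul trmxK.
by rewrite linearZ/= !trmx_mul !trmxK.
Qed.

Lemma proj_direction_mx e : Q *m A e = A e.
Proof.
rewrite /direction_mx; case: eqP => _; first by rewrite mulmxA Qu.
by rewrite -scalemxAr !mulmxA QQ.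
Qed.

Lemma qform_proj_mulmx e : (Q *m e)^T *m (Q *m e) = (qform Q e)%:M.
Proof.
rewrite trmx_mul QT -mulmxA (mulmxA Q) QQ mulmxA.
by apply/matrixP => i j; rewrite !ord1 /qform [RHS]mxE mulr1n.
Qed.

Lemma direction_mx_idem e : A e *m A e = A e.
Proof.
rewrite /direction_mx; case: eqP => [_|/eqP r0].
  by rewrite mulmxA -(mulmxA u) uu mulmx1.
rewrite -scalemxAl -scalemxAr mulmxA -(mulmxA (Q *m e)) qform_proj_mulmx.
by rewrite mul_mx_scalar -scalemxAl (scalerA (qform Q e)^-1 (qform Q e)) mulVf// scale1r.
Qed.

Lemma direction_mx_trace e : \tr (A e) = 1.
Proof.
rewrite /direction_mx; case: eqP => [_|/eqP r0].
  by rewrite mxtrace_mulC uu mxtrace1.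
rewrite linearZ/= mxtrace_mulC qform_proj_mulmx mxtrace_scalar mulr1n.
by rewrite mulVf.
Qed.

Lemma direction_mx_qform M e : qform Q e != 0 ->
  \tr (A e *m M) = qform (Q *m M *m Q) e / qform Q e.
Proof.
move=> r0; rewrite /direction_mx (negbTE r0) -scalemxAl linearZ/= mulrC.
congr (_ / _); rewrite trmx_mul QT qform_trace -!mulmxA mxtrace_mulC.
by rewrite -!mulmxA.
Qed.

End direction_matrix.

Section direction_moments.
Context d (Om : measurableType d) (R : realType) (Pr : probability Om R) (n : nat)
  (e : {RV Pr >-> n.-tuple R}) (s : R).
Hypothesis s0 : 0 < s.
Hypothesis he : multinormal_law e 0 (s ^+ 2)%:M.
Variables (Q : 'M[R]_n) (u : 'cV[R]_n) (m : R).
Hypotheses (QT : Q^T = Q) (QQ : Q *m Q = Q) (Qu : Q *m u = u)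
  (uu : u^T *m u = 1%:M) (trQ : \tr Q = m) (m0 : 0 < m).
Local Notation mu := (distribution Pr e).
Let A (t : n.-tuple R) := direction_mx Q u (col_of_tuple t).

Lemma measurable_direction_mx i j : measurable_fun setT (fun t => A t i j).
Proof.
have mt (k : 'I_n) : measurable_fun setT (fun t : n.-tuple R => tnth t k).
  exact: measurable_tnth.
have mr : measurable_fun setT (fun t : n.-tuple R => qform Q (col_of_tuple t)).
  exact: measurable_qform.
have mm k : measurable_fun setT (fun t : n.-tuple R => (Q *m col_of_tuple t) k 0).
  exact: measurable_mulmx.
pose g t := if qform Q (col_of_tuple t) == 0 then (u *m u^T) i j else
  (qform Q (col_of_tuple t))^-1 * ((Q *m col_of_tuple t) i 0 * (Q *m col_of_tuple t) j 0).
rewrite (_ : (fun t => A t i j) = g).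
  apply: measurable_fun_ifT => //.
    exact: measurable_fun_eqr.
  apply: measurable_funM; last exact: measurable_funM.
  by apply: measurable_inv_ge0 => // t; exact: qform_proj_ge0.
apply/funext => t; rewrite /A /g /direction_mx; case: ifP => // _.
by rewrite [LHS]mxE; congr (_ * _); rewrite [LHS]mxE big_ord1 [X in _ * X]mxE.
Qed.

(** The squared entries of [A t] sum to tr (A A) = tr A = 1. Bounded entries make every polynomial
    in them tame. *)
Lemma direction_mx_entry_le1 t i j : `|A t i j| <= 1.
Proof.
have AT := direction_mx_sym Q u (col_of_tuple t).
have : \tr (A t *m A t) = 1.
  by rewrite direction_mx_idem// direction_mx_trace.
rewrite mxtrace_sqrE// => h; rewrite -(ler_pXn2r (n := 2))// ?nnegrE// expr1n real_normK ?num_real//.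
rewrite -h (bigD1 i)//= (bigD1 j)//= -addrA lerDl addr_ge0//.
  by apply: sumr_ge0 => k _; exact: sqr_ge0.
by apply: sumr_ge0 => k _; apply: sumr_ge0 => l _; exact: sqr_ge0.
Qed.

Variable M : 'M[R]_n.
Hypothesis MT : M^T = M.
Let B t := A t - m^-1 *: Q.
Let kappa := \tr (Q *m M *m Q *m M) - \tr (Q *m M) ^+ 2 / m.

Let tame_BM : tame mu (fun t => \tr (B t *m M)).
Proof.
apply: (eq_tame (g := fun t => \sum_i \sum_j (A t i j - m^-1 * Q i j) * M j i)).
  apply: tame_sum => i _; apply: tame_sum => j _; apply: tameM; last exact: tame_cst.
  apply: tameB; last exact: tame_cst.
  apply: (@tame_bounded _ _ _ _ _ 1); first exact: measurable_direction_mx.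
  by move=> t; exact: direction_mx_entry_le1.
move=> t; rewrite mxtrace_mulE; apply: eq_bigr => i _; apply: eq_bigr => j _.
by rewrite !mxE.
Qed.

Let N := Q *m M *m Q - (\tr (Q *m M) / m) *: Q.
Let r t := qform Q (col_of_tuple t).

Let BM_ratio t : r t != 0 -> \tr (B t *m M) = qform N (col_of_tuple t) / r t.
Proof.
move=> r0; rewrite /B mulmxBl mxtraceB -scalemxAl mxtraceZ direction_mx_qform//.
rewrite /N !qform_trace mulmxBr mxtraceB -scalemxAr mxtraceZ -!qform_trace -/(r t).
by field; rewrite r0 gt_eqF.
Qed.

Let tameN : tame mu (fun t => qform N (col_of_tuple t)).
Proof.
apply: tame_qform => k.
exact: (tame_coord s0 (multinormal_coord_law s0 he)).
Qed.

Let mr : measurable_fun setT r. Proof. by apply: measurable_qform => k; exact: measurable_tnth. Qed.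

Let null : mean mu (fun t => (r t == 0)%:R) = 0.
Proof.
exact: (mean_proj_eq0 s0 (multinormal_coord_independent s0 he)
  (multinormal_coord_law s0 he) QT QQ trQ m0).
Qed.

Let tame_ratio : tame mu (fun t => qform N (col_of_tuple t) / r t).
Proof.
have NT : N^T = N.
  by rewrite /N linearB/= linearZ/= !trmx_mul QT MT mulmxA.
have QN : Q *m N = N by rewrite /N mulmxBr !mulmxA QQ -scalemxAr QQ.
apply: (@tame_bounded _ _ _ _ _ (mx_abs_sum N)).
  apply: measurable_funM; first exact: tame_measurable tameN.
  by apply: measurable_inv_ge0 => // t; exact: qform_proj_ge0.
move=> t; have r0 : 0 <= r t by exact: qform_proj_ge0.
have := qform_le QT QQ NT QN (col_of_tuple t); rewrite -/(r t).
rewrite normrM normfV (ger0_norm r0); move: r0; rewrite le_eqVlt => /orP[/eqP <- _|r0].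
  by rewrite invr0 mulr0 mx_abs_sum_ge0.
by rewrite ler_pdivrMr.
Qed.

(** The two integrands are equal off the null event r = 0, on which [A] was given a conventional
    value. *)
Let BMX a : mean mu (fun t => \tr (B t *m M) ^+ a) =
  mean mu (fun t => (qform N (col_of_tuple t) / r t) ^+ a).
Proof.
apply: (mean_ae_eq _ _ mr null).
- exact: tameX.
- exact: tameX.
- by move=> t rt; rewrite BM_ratio.
Qed.

Lemma mean_direction : mean mu (fun t => \tr (B t *m M)) = 0.
Proof.
have := BMX 1; rewrite (_ : mean mu (fun t => (qform N (col_of_tuple t) / r t) ^+ 1) = 0).
  by move=> h; rewrite -[RHS]h; apply: eq_mean => t; rewrite expr1.
have := mean_ratio s0 (multinormal_coord_independent s0 he)
  (multinormal_coord_law s0 he) QT QQ trQ m0 MT.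
by move=> h; rewrite -[RHS]h; apply: eq_mean => t; rewrite expr1.
Qed.

Lemma mean_direction_sqr :
  mean mu (fun t => \tr (B t *m M) ^+ 2) = 2 * kappa / (m * (m + 2)).
Proof.
rewrite BMX (mean_ratio_sqr s0 (multinormal_coord_independent s0 he)
  (multinormal_coord_law s0 he) QT QQ trQ m0 MT).
by rewrite (kappaE QQ trQ m0).
Qed.

Lemma mean_direction_pow4 :
  mean mu (fun t => \tr (B t *m M) ^+ 4) <= 108 * kappa ^+ 2 / m ^+ 4.
Proof.
rewrite BMX; have := mean_ratio_pow4 s0 (multinormal_coord_independent s0 he)
  (multinormal_coord_law s0 he) QT QQ trQ m0 MT.
by rewrite (kappaE QQ trQ m0).
Qed.

Lemma direction_ae : mean mu (fun t => (r t == 0)%:R) = 0.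
Proof. exact: null. Qed.

End direction_moments.

(** * Lindeberg replacement *)

Section taylor.
Context (R : realType).
Implicit Types (A : R) (f g : R -> R).

Lemma continuous_of_modulus g K :
  (forall x h : R, `|g (x + h) - g x| <= K * (`|h| + h ^+ 2 + `|h| ^+ 3)) ->
  continuous g.
Proof.
move=> gK x; apply/cvgrPdist_lt => e e0.
have K0 : 0 <= `|K| by [].
have nx (a : R) : 0 < a -> \forall y \near x, `|x - y| < a.
  by have /cvgrPdist_lt := @cvg_id _ (nbhs x); exact.
near=> y.
rewrite distrC; have := gK x (y - x); rewrite subrKC => /le_lt_trans; apply.
have hy : `|y - x| < 1 by rewrite distrC; near: y; exact: nx.
have hy2 : `|y - x| < e / (3 * `|K| + 1).
  rewrite distrC; near: y; apply: nx.
  by rewrite divr_gt0// ltr_wpDl// mulr_ge0.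
move: hy hy2; set h := y - x => hy hy2.
have h0 : 0 <= `|h| by [].
rewrite -(real_normK (num_real h)); set t := `|h| in h0 hy hy2 *.
have t3 : t + t ^+ 2 + t ^+ 3 <= 3 * t.
  have : t ^+ 2 <= t by rewrite expr2 ler_piMl// ltW.
  have : t ^+ 3 <= t by rewrite exprSr ler_piMl// exprn_ile1// ltW.
  lra.
apply: (@le_lt_trans _ _ (`|K| * (3 * t))).
  apply: (@le_trans _ _ (`|K| * (t + t ^+ 2 + t ^+ 3))).
    by rewrite ler_wpM2r ?ler_norm// !addr_ge0// exprn_ge0.
  exact: ler_wpM2l.
move: hy2; rewrite ltr_pdivlMr ?ltr_wpDl ?mulr_ge0// => hy2.
nra.
Unshelve. all: by end_near.
Qed.

Lemma is_derive_of_taylor g (l x A : R) :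
  (forall h : R, `|g (x + h) - g x - l * h| <= A * h ^+ 2) -> is_derive x 1 g l.
Proof.
move=> gA.
have c : (h^-1 *: (g (h *: 1 + x) - g x)) @[h --> 0^'] --> l.
  apply/cvgrPdist_lt => e e0; near=> h.
  have h0 : h != 0 by near: h; exact: nbhs_dnbhs_neq.
  have he : `|h| < e / (`|A| + 1).
    near: h; apply: dnbhs0_lt.
    by rewrite divr_gt0// ltr_wpDl.
  have -> : l - h^-1 *: (g (h *: 1 + x) - g x) = - (h^-1 * (g (x + h) - g x - l * h)).
    by rewrite /GRing.scale/= mulr1 (addrC h x); field.
  rewrite normrN normrM normfV mulrC ltr_pdivrMr ?normr_gt0//.
  apply: le_lt_trans (gA h) _; rewrite -(real_normK (num_real h)).
  have hp : 0 < `|h| by rewrite normr_gt0.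
  move: he; rewrite ltr_pdivlMr ?ltr_wpDl// => he.
  apply: (@le_lt_trans _ _ (`|A| * `|h| ^+ 2)); first by rewrite ler_wpM2r ?sqr_ge0 ?ler_norm.
  nra.
apply: DeriveDef; first by apply/cvg_ex; exists l.
exact: cvg_lim c.
Unshelve. all: by end_near.
Qed.

(* f1 and f2 play the role of the first two derivatives of f; Taylor bounds
   are stable under Gaussian smoothing without differentiating an integral. *)
Definition smooth3 A f f1 f2 : Prop :=
  [/\ forall x, `|f x| <= A /\ `|f1 x| <= A, forall x, `|f2 x| <= A,
      forall x h : R, `|f (x + h) - f x - f1 x * h - f2 x * h ^+ 2 / 2| <= A * `|h| ^+ 3,
      forall x h : R, `|f1 (x + h) - f1 x - f2 x * h| <= A * h ^+ 2 &
      forall x h : R, `|f2 (x + h) - f2 x| <= A * `|h|].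

Section smooth3.
Variables (A : R) (f f1 f2 : R -> R).
Hypothesis sf : smooth3 A f f1 f2.

Lemma smooth3_ge0 : 0 <= A.
Proof. by case: sf => _ h _ _ _; exact: le_trans (h 0). Qed.

Lemma smooth3_continuous : [/\ continuous f, continuous f1 & continuous f2].
Proof.
have A0 := smooth3_ge0; case: sf => b01 b2 t0 t1 t2; split.
- apply: (continuous_of_modulus (K := A)) => x h.
  have t0x := t0 x h; have [_ h1] := b01 x; have h2 := b2 x.
  have dec : `|f (x + h) - f x| <= `|f (x + h) - f x - f1 x * h - f2 x * h ^+ 2 / 2| +
     `|f1 x| * `|h| + `|f2 x| * (`|h| ^+ 2 / 2).
    have -> : f (x + h) - f x = (f (x + h) - f x - f1 x * h - f2 x * h ^+ 2 / 2) +
      f1 x * h + f2 x * (h ^+ 2 / 2) by ring.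
    apply: le_trans (ler_normD _ _) _; apply: lerD; last first.
      by rewrite normrM normf_div normrX (ger0_norm (ler0n _ 2)).
    by apply: le_trans (ler_normD _ _) _; rewrite [X in _ + X]normrM; apply: lerD => //; rewrite le_eqVlt; apply/orP; left; apply/eqP; congr (`|_|); ring.
  rewrite -[X in _ + X + _](real_normK (num_real h)).
  have v0 : 0 <= `|h| ^+ 2 by rewrite exprn_ge0.
  have m1 : `|f1 x| * `|h| <= A * `|h| by rewrite ler_wpM2r.
  have m2 : `|f2 x| * (`|h| ^+ 2 / 2) <= A * (`|h| ^+ 2 / 2).
    by rewrite ler_wpM2r// divr_ge0.
  have m3 : 0 <= A * `|h| ^+ 2 by rewrite mulr_ge0.
  lra.
- apply: (continuous_of_modulus (K := A)) => x h.
  have := t1 x h; have h2 := b2 x.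
  have : `|f1 (x + h) - f1 x| <= `|f1 (x + h) - f1 x - f2 x * h| + `|f2 x| * `|h|.
    by rewrite -normrM; apply: le_trans (ler_normD _ _); rewrite subrK.
  have m1 : `|f2 x| * `|h| <= A * `|h| by rewrite ler_wpM2r.
  have m3 : 0 <= A * `|h| ^+ 3 by rewrite mulr_ge0// exprn_ge0.
  lra.
- apply: (continuous_of_modulus (K := A)) => x h.
  apply: le_trans (t2 x h) _; rewrite ler_wpM2l// -addrA lerDl.
  by rewrite addr_ge0 ?sqr_ge0 ?exprn_ge0.
Qed.

End smooth3.
End taylor.

Section heat.
Context (R : realType).
Implicit Types (A a x : R) (f : R -> R).
Local Notation gauss := (normal_prob (0 : R) 1).

(** The heat semigroup, parametrised by the standard deviation [a] rather than the variance. *)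
Definition heat (a : R) (f : R -> R) (x : R) : R :=
  mean gauss (fun z => f (x + a * z)).

(** In [heat_step], the first mean comes from the third-order Taylor remainder, the second from
    replacing Z^2 by 1 in the second-order term. *)
Definition heat_const : R :=
  mean gauss (fun z => `|z| ^+ 3) + mean gauss (fun z => `|z * (z ^+ 2 - 1)|).

Lemma tame_id : tame gauss (fun z : R => z).
Proof. by apply: tame_poly_growth => //; exact: poly_growth_id. Qed.

Lemma heat_const_ge0 : 0 <= heat_const.
Proof. by rewrite addr_ge0//; apply: mean_ge0 => z //; rewrite exprn_ge0. Qed.

Lemma mean_normal_sqr : mean gauss (fun z => z * z) = 1.
Proof.
rewrite (@normal_ibp R 1 ltr01 (fun z => z) (cst 1)) ?expr1n ?mul1r.
- exact: (mean_cst gauss 1).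
- by move=> x; exact: cvg_cst.
- exact: poly_growth_id.
- exact: poly_growth_cst.
Qed.

Lemma continuous_affine a x f : continuous f -> continuous (fun z : R => f (x + a * z)).
Proof.
move=> cf z; apply: (@continuous_comp _ _ _ (fun z : R => x + a * z) f); last exact: cf.
by apply: cvgD; [exact: cvg_cst|apply: cvgMr; exact: cvg_id].
Qed.

Lemma tame_heat a x f A : continuous f -> (forall x, `|f x| <= A) ->
  tame gauss (fun z => f (x + a * z)).
Proof.
move=> cf fA; apply: (@tame_bounded _ _ _ _ _ A) => //.
exact: continuous_measurable_fun (continuous_affine cf).
Qed.

Lemma heat_bound a x f A : continuous f -> (forall x, `|f x| <= A) ->
  `|heat a f x| <= A.
Proof.
move=> cf fA; have t := tame_heat a x cf fA.
apply: le_trans (norm_mean t) _; rewrite -[leRHS](mean_cst gauss).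
by apply: le_mean => //; [exact: tame_norm|exact: tame_cst].
Qed.

(** Each clause bounds an expression linear in the functions, uniformly in the base point, so it
    survives averaging over shifts with the same constant. *)
Lemma smooth3_heat a A f f1 f2 : smooth3 A f f1 f2 ->
  smooth3 A (heat a f) (heat a f1) (heat a f2).
Proof.
move=> sf; have [c0 c1 c2] := smooth3_continuous sf.
case: sf => b01 b2 h0 h1 h2.
have b0 x : `|f x| <= A by case: (b01 x).
have b1 x : `|f1 x| <= A by case: (b01 x).
have t0 x := tame_heat a x c0 b0.
have t1 x := tame_heat a x c1 b1.
have t2 x := tame_heat a x c2 b2.
have avg (g : R -> R) B : tame gauss g -> (forall z, `|g z| <= B) -> `|mean gauss g| <= B.
  move=> tg gB; apply: le_trans (norm_mean tg) _; rewrite -[leRHS](mean_cst gauss).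
  by apply: le_mean => //; [exact: tame_norm|exact: tame_cst].
split.
- by move=> x; split; exact: heat_bound.
- by move=> x; exact: heat_bound.
- move=> x h; rewrite /heat.
  have tz1 := tameZ h (t1 x); have tz2 := tameZ (h ^+ 2 / 2) (t2 x).
  have tb := tameB (t0 (x + h)) (t0 x); have tb1 := tameB tb tz1.
  have tb2 := tameB tb1 tz2.
  rewrite (_ : _ - _ - _ - _ = mean gauss (fun z => f (x + h + a * z) - f (x + a * z) -
     h * f1 (x + a * z) - (h ^+ 2 / 2) * f2 (x + a * z))); last first.
    by rewrite (meanB tb1 tz2) (meanB tb tz1) (meanB (t0 (x + h)) (t0 x)) !meanZ//; ring.
  apply: avg => // z; have := h0 (x + a * z) h; congr (`|_| <= _).
  by rewrite (addrAC x h); ring.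
- move=> x h; rewrite /heat.
  have tz1 := tameZ h (t2 x).
  have tb := tameB (t1 (x + h)) (t1 x); have tb1 := tameB tb tz1.
  rewrite (_ : _ - _ - _ = mean gauss (fun z => f1 (x + h + a * z) - f1 (x + a * z) -
     h * f2 (x + a * z))); last first.
    by rewrite (meanB tb tz1) (meanB (t1 (x + h)) (t1 x)) meanZ//; ring.
  apply: avg => // z; have := h1 (x + a * z) h; congr (`|_| <= _).
  by rewrite (addrAC x h); ring.
- move=> x h; rewrite /heat -!meanB//; apply: avg; first exact: tameB.
  by move=> z; have := h2 (x + a * z) h; rewrite (addrAC x h).
Qed.

(** With c = b - a, Taylor expansion at x + a Z gives c E (Z f1) + c^2 / 2 E (Z^2 f2). Stein's
    identity turns the first term into c a E f2, and c a + c^2 / 2 = (b^2 - a^2) / 2. Both the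
    remainder, of order c^3, and the replacement of Z^2 by 1, of order c^2 a, are bounded by the 3/2
    power of b^2 - a^2. *)
Lemma heat_step A f f1 f2 a b x : smooth3 A f f1 f2 -> 0 <= a -> a <= b ->
  `|heat b f x - heat a f x - (b ^+ 2 - a ^+ 2) / 2 * heat a f2 x| <=
  heat_const * A * ((b ^+ 2 - a ^+ 2) * Num.sqrt (b ^+ 2 - a ^+ 2)).
Proof.
move=> sf a0 ab; have [c0 c1 c2] := smooth3_continuous sf.
have A0 := smooth3_ge0 sf.
case: sf => b01 b2 h0 h1 h2.
have b0 y : `|f y| <= A by case: (b01 y).
have b1 y : `|f1 y| <= A by case: (b01 y).
have ti := tame_id.
pose c := b - a.
have t0b := tame_heat b x c0 b0.
have t0 := tame_heat a x c0 b0.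
have t1 := tame_heat a x c1 b1.
have t2 := tame_heat a x c2 b2.
have tz1 := tameM ti t1.
have tz2 := tameM (tameX 2 ti) t2.
have ibp : mean gauss (fun z => z * f1 (x + a * z)) = a * heat a f2 x.
  rewrite -meanZ// -[RHS]mul1r -[X in X * _](expr1n R 2).
  apply: (@normal_ibp R 1 ltr01 (fun z => f1 (x + a * z)) (fun z => a * f2 (x + a * z))).
  - move=> z; apply: (is_derive_of_taylor (A := A * a ^+ 2)) => h.
    have := h1 (x + a * z) (a * h).
    rewrite exprMn (_ : x + a * z + a * h = x + a * (z + h)); last by ring.
    by rewrite (mulrCA (f2 _) a h) -(mulrA A) (mulrA a).
  - by move=> z; apply: cvgM; [exact: cvg_cst|exact: continuous_affine].
  - by apply: poly_growth_le (poly_growth_cst A) _ => z; rewrite (le_trans (b1 _))// ler_norm.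
  - apply: poly_growth_le (poly_growth_cst (a * A)) _ => z.
    by rewrite !normrM ler_wpM2l// (le_trans (b2 _))// ler_norm.
pose E2 := mean gauss (fun z => z ^+ 2 * f2 (x + a * z)).
have tt : tame gauss (fun z : R => z ^+ 2 - 1) by apply: tameB; [exact: tameX|exact: tame_cst].
have tabs : tame gauss (fun z : R => `|z * (z ^+ 2 - 1)|) by apply: tame_norm; exact: tameM.
have tabs3 : tame gauss (fun z : R => `|z| ^+ 3) by apply: tameX; exact: tame_norm.
have mt : mean gauss (fun z : R => z ^+ 2 - 1) = 0.
  rewrite meanB; [|exact: tameX|exact: tame_cst].
  by rewrite (mean_cst gauss 1) (_ : mean _ _ = 1) ?subrr// -[RHS]mean_normal_sqr.
(* The factor Z^2 - 1 is centred, so the constant [f2 x] may be subtracted from f2 (x + a Z); the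
   Lipschitz bound on [f2] then gains a |Z|. *)
have e2 : `|E2 - heat a f2 x| <= A * a * mean gauss (fun z : R => `|z * (z ^+ 2 - 1)|).
  have tf := tameM tt t2; have tc := tameZ (f2 x) tt.
  rewrite (_ : E2 - heat a f2 x =
      mean gauss (fun z => (z ^+ 2 - 1) * f2 (x + a * z) - f2 x * (z ^+ 2 - 1))); last first.
    rewrite (meanB tf tc) meanZ// mt mulr0 subr0 /E2 /heat -meanB//.
    by apply: eq_mean => z; ring.
  have td := tameB tf tc.
  apply: le_trans (norm_mean td) _; rewrite -meanZ//.
  apply: le_mean; [exact: tame_norm|exact: tameZ|move=> z].
  have -> : (z ^+ 2 - 1) * f2 (x + a * z) - f2 x * (z ^+ 2 - 1) =
    (f2 (x + a * z) - f2 x) * (z ^+ 2 - 1) by ring.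
  rewrite !normrM mulrA ler_wpM2r//; apply: le_trans (h2 _ _) _.
  by rewrite normrM (ger0_norm a0) mulrA.
have e3 : `|heat b f x - heat a f x - c * (a * heat a f2 x) - c ^+ 2 / 2 * E2| <=
    A * c ^+ 3 * mean gauss (fun z : R => `|z| ^+ 3).
  have tb := tameB t0b t0; have tc1 := tameZ c tz1; have tc2 := tameZ (c ^+ 2 / 2) tz2.
  have tb1 := tameB tb tc1; have tb2 := tameB tb1 tc2.
  rewrite -ibp (_ : _ - _ - _ - _ = mean gauss (fun z => f (x + b * z) - f (x + a * z) -
     c * (z * f1 (x + a * z)) - c ^+ 2 / 2 * (z ^+ 2 * f2 (x + a * z)))); last first.
    by rewrite (meanB tb1 tc2) (meanB tb tc1) (meanB t0b t0) !meanZ.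
  apply: le_trans (norm_mean tb2) _; rewrite -meanZ//.
  apply: le_mean; [exact: tame_norm|exact: tameZ|move=> z].
  have c0' : 0 <= c by rewrite subr_ge0.
  have := h0 (x + a * z) (c * z); rewrite normrM (ger0_norm c0') (_ : A * (c * `|z|) ^+ 3 = A * c ^+ 3 * `|z| ^+ 3); last by ring.
  have -> : x + a * z + c * z = x + b * z by rewrite /c; ring.
  move=> H; apply: le_trans H; rewrite le_eqVlt; apply/orP; left; apply/eqP; congr (`|_|).
  by ring.
set m3 := mean gauss _ in e3; set m4 := mean gauss _ in e2.
have m30 : 0 <= m3 by apply: mean_ge0 => z; rewrite exprn_ge0.
have m40 : 0 <= m4 by apply: mean_ge0 => z.
have cc : 0 <= c by rewrite subr_ge0.
pose dl := b ^+ 2 - a ^+ 2.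
have dlE : dl = c * (c + 2 * a) by rewrite /dl /c; ring.
have dl0 : 0 <= dl by rewrite dlE mulr_ge0// addr_ge0// mulr_ge0.
have sq : Num.sqrt dl ^+ 2 = dl by rewrite sqr_sqrtr.
have sq0 : 0 <= Num.sqrt dl by exact: sqrtr_ge0.
have csq : c <= Num.sqrt dl.
  rewrite -(ler_pXn2r (n := 2))// ?nnegrE// sq dlE expr2 ler_wpM2l// lerDl mulr_ge0//.
have cc2 : c ^+ 2 <= dl by rewrite dlE expr2 ler_wpM2l// lerDl mulr_ge0.
have c3 : c ^+ 3 <= dl * Num.sqrt dl.
  by rewrite exprSr ler_pM// exprn_ge0.
have c2a : c ^+ 2 / 2 * a <= dl * Num.sqrt dl.
  rewrite (_ : c ^+ 2 / 2 * a = (c * a / 2) * c); last by ring.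
  apply: ler_pM => //; first by rewrite divr_ge0// mulr_ge0.
  rewrite dlE; have := mulr_ge0 cc a0; have := mulr_ge0 cc cc; nra.
have -> : heat b f x - heat a f x - (b ^+ 2 - a ^+ 2) / 2 * heat a f2 x =
  (heat b f x - heat a f x - c * (a * heat a f2 x) - c ^+ 2 / 2 * E2) +
  c ^+ 2 / 2 * (E2 - heat a f2 x).
  by rewrite /c; field.
apply: le_trans (ler_normD _ _) _.
rewrite -/dl /heat_const -/m3 -/m4 normrM (ger0_norm (_ : 0 <= c ^+ 2 / 2)); last by rewrite divr_ge0// exprn_ge0.
apply: (@le_trans _ _ (A * (dl * Num.sqrt dl) * m3 + A * (dl * Num.sqrt dl) * m4)); last first.
  by rewrite le_eqVlt; apply/orP; left; apply/eqP; ring.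
apply: lerD.
  by apply: le_trans e3 _; rewrite ler_wpM2r// ler_wpM2l.
apply: (@le_trans _ _ (c ^+ 2 / 2 * (A * a * m4))).
  by rewrite ler_wpM2l// divr_ge0// exprn_ge0.
rewrite (_ : _ / 2 * _ = A * (c ^+ 2 / 2 * a) * m4); last by ring.
by rewrite ler_wpM2r// ler_wpM2l.
Qed.

End heat.

Section lindeberg.
Context d (Om : measurableType d) (R : realType) (P : probability Om R).
Variables (A : R) (f f1 f2 : R -> R).
Hypothesis sf : smooth3 A f f1 f2.

Lemma tame_bounded_comp (g : R -> R) (S : Om -> R) :
  continuous g -> (forall x, `|g x| <= A) -> measurable_fun setT S ->
  tame P (fun w => g (S w)).
Proof.
move=> cg gA mS; apply: (@tame_bounded _ _ _ _ _ A) => //.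
by apply: measurableT_comp mS; exact: continuous_measurable_fun.
Qed.

(** The increment [D] is compared with a Gaussian of variance [v], both expanded to second order at
    [S]. The first-order term vanishes and the second-order terms differ by f2 (V - v) / 2 after
    smoothing, [V] acting as the conditional variance of [D]. The last hypothesis is applied with g
    the smoothed derivatives of [f]. *)
Lemma lindeberg_step (S D V : Om -> R) (v b b' : R) :
  measurable_fun setT S -> tame P D -> tame P V ->
  0 <= b' -> b' <= b -> b ^+ 2 - b' ^+ 2 = v ->
  (forall g : R -> R, continuous g -> (forall x, `|g x| <= A) ->
     mean P (fun w => g (S w) * D w) = 0 /\
     mean P (fun w => g (S w) * D w ^+ 2) = mean P (fun w => g (S w) * V w)) ->
  `|mean P (fun w => heat b' f (S w + D w)) - mean P (fun w => heat b f (S w))| <=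
  A / 2 * mean P (fun w => `|V w - v|) + A * mean P (fun w => `|D w| ^+ 3) +
    heat_const R * A * (v * Num.sqrt v).
Proof.
move=> mS tD tV b0 bb bv hg.
have A0 := smooth3_ge0 sf.
have su := smooth3_heat b' sf.
have [cu cu1 cu2] := smooth3_continuous su.
have sub := smooth3_heat b sf.
have [cb _ _] := smooth3_continuous sub.
have bB x : `|heat b f x| <= A by case: sub => /(_ x)[].
case: (su) => u01 uB2 t0 _ _.
have uB x : `|heat b' f x| <= A by case: (u01 x).
have uB1 x : `|heat b' f1 x| <= A by case: (u01 x).
set u := heat b' f in cu uB t0 *; set u1 := heat b' f1 in cu1 uB1 t0 *.
set u2 := heat b' f2 in cu2 uB2 t0 *; set ub := heat b f in cb bB *.
have mD := tame_measurable tD.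
have tu : tame P (fun w => u (S w)) by exact: tame_bounded_comp.
have tu1 : tame P (fun w => u1 (S w)) by exact: tame_bounded_comp.
have tu2 : tame P (fun w => u2 (S w)) by exact: tame_bounded_comp.
have tub : tame P (fun w => ub (S w)) by exact: tame_bounded_comp.
have tuD : tame P (fun w => u (S w + D w)).
  by apply: tame_bounded_comp => //; exact: measurable_funD.
have [z1 _] := hg u1 cu1 uB1.
have [_ z2] := hg u2 cu2 uB2.
(* The Taylor remainder of the step [D] minus the remainder of the heat step. *)
pose e w := (u (S w + D w) - u (S w) - u1 (S w) * D w - u2 (S w) * D w ^+ 2 / 2) -
  (ub (S w) - u (S w) - v / 2 * u2 (S w)).
have t1 := tameM tu1 tD.
have t2 := tameM tu2 (tameX 2 tD).
have t3 := tameM tu2 tV.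
have te : tame P e.
  apply: tameB.
    apply: tameB; first by apply: tameB => //; exact: tameB.
    by apply: tameM t2 _; exact: tame_cst.
  by apply: tameB; [exact: tameB|exact: tameZ].
have tVv : tame P (fun w => V w - v) by apply: tameB => //; exact: tame_cst.
have tuv := tameM tu2 tVv.
have -> : mean P (fun w => u (S w + D w)) - mean P (fun w => ub (S w)) =
    mean P e + 2^-1 * mean P (fun w => u2 (S w) * (V w - v)).
  have eD : mean P (fun w => u (S w + D w)) - mean P (fun w => ub (S w)) =
      mean P e + (mean P (fun w => u1 (S w) * D w) +
      (2^-1 * mean P (fun w => u2 (S w) * D w ^+ 2) - v / 2 * mean P (fun w => u2 (S w)))).
    have tz1 := tameZ 2^-1 t2; have tz2 := tameZ (v / 2) tu2.
    rewrite -meanB// -!meanZ// -(meanB tz1 tz2) -(meanD t1 (tameB tz1 tz2)).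
    rewrite -(meanD te (tameD t1 (tameB tz1 tz2))); apply: eq_mean => w.
    by rewrite /e; field.
  rewrite eD z1 z2 add0r; congr (_ + _).
  have -> : mean P (fun w => u2 (S w) * (V w - v)) =
      mean P (fun w => u2 (S w) * V w) - v * mean P (fun w => u2 (S w)).
    rewrite -meanZ// -meanB//; last exact: tameZ.
    by apply: eq_mean => w; ring.
  by field.
have tD3 : tame P (fun w => `|D w| ^+ 3) by apply: tameX; exact: tame_norm.
have tabsV := tame_norm tVv.
apply: le_trans (ler_normD _ _) _; rewrite -addrA addrC; apply: lerD.
  apply: le_trans (norm_mean te) _.
  have hz := tameZ A tD3.
  rewrite -meanZ// -(mean_cst P (heat_const R * A * (v * Num.sqrt v))) -meanD//; last exact: tame_cst.
  apply: le_mean; [exact: tame_norm|by apply: tameD => //; exact: tame_cst|move=> w].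
  rewrite /e; apply: le_trans (ler_normB _ _) _; apply: lerD; first exact: t0.
  by have := heat_step (S w) sf b0 bb; rewrite bv.
rewrite normrM (ger0_norm (_ : 0 <= 2^-1)) ?invr_ge0// mulrC [A / 2]mulrC mulrC -mulrA ler_wpM2l ?invr_ge0//.
apply: le_trans (norm_mean tuv) _; rewrite -meanZ//.
apply: le_mean; [exact: tame_norm|exact: tameZ|move=> w].
by rewrite normrM ler_wpM2r.
Qed.

(** The means of [heat (b k) f (S k)] telescope, b_k^2 being the variance still to be supplied: k =
    0 gives the Gaussian mean of [f], and k = N gives the mean of f (S N). *)
Lemma lindeberg (S D V : nat -> Om -> R) (v b : nat -> R) (N : nat) :
  (forall k, (k < N)%N -> measurable_fun setT (S k)) ->
  (forall k, (k < N)%N -> tame P (D k)) -> (forall k, (k < N)%N -> tame P (V k)) ->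
  (forall w, S 0 w = 0) -> (forall k w, (k < N)%N -> S k.+1 w = S k w + D k w) ->
  (forall k, 0 <= b k) -> (forall k, b k.+1 <= b k) ->
  (forall k, (k < N)%N -> b k ^+ 2 - b k.+1 ^+ 2 = v k) -> b 0 = 1 -> b N = 0 ->
  (forall k (g : R -> R), (k < N)%N -> continuous g -> (forall x, `|g x| <= A) ->
     mean P (fun w => g (S k w) * D k w) = 0 /\
     mean P (fun w => g (S k w) * D k w ^+ 2) = mean P (fun w => g (S k w) * V k w)) ->
  `|mean P (fun w => f (S N w)) - mean (normal_prob 0 1) f| <=
  \sum_(k < N) (A / 2 * mean P (fun w => `|V k w - v k|) +
     A * mean P (fun w => `|D k w| ^+ 3) + heat_const R * A * (v k * Num.sqrt (v k))).
Proof.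
move=> mS tD tV S0 SD b0 bb bv b1 bN hg.
have h0 : mean (normal_prob 0 1) f = mean P (fun w => heat (b 0) f (S 0 w)).
  rewrite -[LHS](mean_cst P); apply: eq_mean => w; rewrite S0 b1 /heat.
  by apply: eq_mean => z; rewrite add0r mul1r.
have hN : mean P (fun w => f (S N w)) = mean P (fun w => heat (b N) f (S N w)).
  apply: eq_mean => w; rewrite bN /heat -[LHS](mean_cst (normal_prob (0 : R) 1)).
  by apply: eq_mean => z; rewrite mul0r addr0.
rewrite h0 hN -(telescope_sumr (fun k => mean P (fun w => heat (b k) f (S k w))) (leq0n N)).
rewrite big_mkord; apply: le_trans (ler_norm_sum _ _ _) _; apply: ler_sum => k _.
have kN := ltn_ord k.
rewrite (_ : mean P (fun w => heat (b k.+1) f (S k.+1 w)) =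
  mean P (fun w => heat (b k.+1) f (S k w + D k w))); last first.
  by apply: eq_mean => w; rewrite SD.
exact: (lindeberg_step (mS k kN) (tD k kN) (tV k kN) (b0 k.+1) (bb k) (bv k kN)
  (fun g => hg k g kN)).
Qed.

End lindeberg.

(* The squared Frobenius norm of P X P - (tr (P X) / m) P. *)
Definition kap (R : realType) n (P : 'M[R]_n) (m : R) (X : 'M[R]_n) : R :=
  \tr (P *m X *m P *m X) - \tr (P *m X) ^+ 2 / m.

Section projection_defect.
Context (R : realType) (n : nat) (P : 'M[R]_n) (m : R).
Hypotheses (PT : P^T = P) (PP : P *m P = P) (trP : \tr P = m) (m0 : 0 < m).
Implicit Types X Y : 'M[R]_n.

Local Notation kapP := (kap P m).
Local Notation Q := (1%:M - P).

Let red X := P *m X *m P - (\tr (P *m X) / m) *: P.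

Let kap_red X : kapP X = \tr (red X *m red X).
Proof. by rewrite (kappaE PP trP m0). Qed.

Let red_sym X : X^T = X -> (red X)^T = red X.
Proof. by move=> XT; rewrite /red linearB/= linearZ/= !trmx_mul PT XT mulmxA. Qed.

Lemma kap_ge0 X : X^T = X -> 0 <= kapP X.
Proof. by move=> XT; rewrite kap_red; exact: mxtrace_sqr_ge0 (red_sym XT). Qed.

(** [red] acts as an orthogonal projection for the trace form: tr (X red X) = tr (red X red X) = kap
    X, so the gap is the squared norm of X - red X. *)
Lemma kap_le X : X^T = X -> kapP X <= \tr (X *m X).
Proof.
move=> XT; rewrite -subr_ge0.
have e : \tr (X *m red X) = kapP X.
  rewrite /red mulmxBr mxtraceB -scalemxAr mxtraceZ !mulmxA mxtrace_mulC !mulmxA /kap.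
  by rewrite [\tr (X *m P)]mxtrace_mulC expr2 mulrAC.
move: (red_sym XT) e (kap_red X); move: (red X) => N NT e kN.
have -> : \tr (X *m X) - kapP X = \tr ((X - N) *m (X - N)).
  rewrite mulmxBl !mulmxBr !mxtraceB -kN [\tr (N *m X)]mxtrace_mulC e; ring.
by apply: mxtrace_sqr_ge0; rewrite linearB/= XT NT.
Qed.

Let kapb X Y := \tr (P *m X *m P *m Y) - \tr (P *m X) * \tr (P *m Y) / m.

Let kapbD X Y c : kapP (X + c *: Y) = kapP X + 2 * c * kapb X Y + c ^+ 2 * kapP Y.
Proof.
have PD : P *m (X + c *: Y) = P *m X + c *: (P *m Y) by rewrite mulmxDr scalemxAr.
rewrite /kap /kapb -!(mulmxA (_ *m _)) PD; move: (P *m X) (P *m Y) => a b.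
rewrite mulmxDl !mulmxDr -!scalemxAl -!scalemxAr !mxtraceD !mxtraceZ.
by rewrite [\tr (b *m a)]mxtrace_mulC; field; exact: lt0r_neq0.
Qed.

(** [kapP] is a nonnegative quadratic form with polar form [kapb]. Its nonnegativity at X + c Y for
    c = 1 / l and c = - 1 / l is Young's inequality 2 |kapb X Y| <= l kapP X + kapP Y / l. *)
Lemma kap_sub X Y l : X^T = X -> Y^T = Y -> 0 < l ->
  `|kapP (X - Y) - kapP X| <= l * \tr (X *m X) + (1 + l^-1) * \tr (Y *m Y).
Proof.
move=> XT YT l0.
have h c : 0 <= kapP X + 2 * c * kapb X Y + c ^+ 2 * kapP Y.
  by rewrite -kapbD; apply: kap_ge0; rewrite linearD/= linearZ/= XT YT.
have e := kapbD X Y (-1); rewrite scaleN1r in e; rewrite e.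
have h1 := h l^-1; have h2 := h (- l^-1).
have kX := kap_le XT; have kY := kap_le YT.
have kX0 := kap_ge0 XT; have kY0 := kap_ge0 YT.
have li : 0 < l^-1 by rewrite invr_gt0.
have ll : l * l^-1 = 1 by rewrite divff// gt_eqF.
have a1 : - (l * kapP X + l^-1 * kapP Y) <= 2 * kapb X Y <= l * kapP X + l^-1 * kapP Y.
  have q1 := mulr_ge0 (ltW l0) h1; have q2 := mulr_ge0 (ltW l0) h2.
  move: q1 q2 ll; set q := l^-1 => q1 q2 ll.
  have r1 : l * (kapP X + 2 * q * kapb X Y + q ^+ 2 * kapP Y) =
    l * kapP X + (l * q) * (2 * kapb X Y) + (l * q) * (q * kapP Y) by ring.
  have r2 : l * (kapP X + 2 * - q * kapb X Y + (- q) ^+ 2 * kapP Y) =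
    l * kapP X - (l * q) * (2 * kapb X Y) + (l * q) * (q * kapP Y) by ring.
  rewrite r1 ll !mul1r in q1; rewrite r2 ll !mul1r in q2.
  apply/andP; split; lra.
have b1 : l * kapP X <= l * \tr (X *m X) by rewrite ler_pM2l.
have b2 : l^-1 * kapP Y <= l^-1 * \tr (Y *m Y) by rewrite ler_pM2l.
have /andP[a2 a3] := a1.
rewrite ler_norml; apply/andP; split; lra.
Qed.

(* The defect is nonnegative and measures the part of X which P does not see;
   along the partial sums it grows only by O(1/m) in mean at each step. *)
Definition defect X := \tr (X *m X) - kapP X.

(** Half the gradient of [defect] for the trace form. The cross term in [defectD] is linear in Y, so
    it averages to zero when Y is a centred increment independent of X. *)
Definition defect_grad X := X - P *m X *m P + (\tr (P *m X) / m) *: P.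

Lemma defect_grad_sym X : X^T = X -> (defect_grad X)^T = defect_grad X.
Proof.
by move=> XT; rewrite /defect_grad linearD/= linearB/= linearZ/= !trmx_mul PT XT mulmxA.
Qed.

Lemma defectD X Y : defect (X + Y) =
  defect X + defect Y + 2 * \tr (Y *m defect_grad X).
Proof.
have e := kapbD X Y 1; rewrite scale1r in e; rewrite /defect e.
have -> : \tr (Y *m defect_grad X) = \tr (X *m Y) - kapb X Y.
  rewrite /defect_grad mulmxDr mulmxBr mxtraceD mxtraceB -scalemxAr mxtraceZ.
  rewrite [\tr (Y *m X)]mxtrace_mulC [\tr (Y *m P)]mxtrace_mulC.
  by rewrite [\tr (Y *m (P *m X *m P))]mxtrace_mulC /kapb; ring.
rewrite mulmxDl !mulmxDr !mxtraceD [\tr (Y *m X)]mxtrace_mulC; ring.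
Qed.

(** With Q = 1 - P, tr X^2 - tr (P X P X) = 2 tr (X^2 Q) - tr (Q X Q X), and the last trace is
    nonnegative. Moreover tr (P X) = - tr (X Q) as X is trace-free. The bound thus involves the
    complement Q only, whose rank will be p. *)
Lemma defect_le X : X^T = X -> \tr X = 0 ->
  defect X <= 2 * \tr (X *m X *m Q) + \tr (X *m Q) ^+ 2 / m.
Proof.
move=> XT X0.
have QT : Q^T = Q by rewrite linearB/= trmx1 PT.
have QQ : Q *m Q = Q by rewrite mulmxBl !mulmxBr !mul1mx mulmx1 PP subrr subr0.
have h : 0 <= \tr (Q *m X *m Q *m X).
  have -> : \tr (Q *m X *m Q *m X) = \tr (Q *m X *m Q *m (Q *m X *m Q)).
    have -> : Q *m X *m Q *m (Q *m X *m Q) = Q *m X *m Q *m X *m Q.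
      by rewrite -!mulmxA (mulmxA Q Q) QQ.
    by rewrite [RHS]mxtrace_mulC !mulmxA QQ.
  by apply: mxtrace_sqr_ge0; rewrite !trmx_mul QT XT mulmxA.
have e1 : \tr (X *m Q) = - \tr (P *m X).
  by rewrite mulmxBr mulmx1 mxtraceB X0 sub0r mxtrace_mulC.
have e2 : \tr (X *m X *m Q) = \tr (X *m X) - \tr (P *m X *m X).
  by rewrite mulmxBr mulmx1 mxtraceB [\tr (X *m X *m P)]mxtrace_mulC mulmxA.
have e3 : \tr (Q *m X *m Q *m X) = \tr (X *m X) - 2 * \tr (P *m X *m X) + \tr (P *m X *m P *m X).
  rewrite mulmxBl mul1mx !mulmxBr mulmx1 !mulmxBl !mxtraceB.
  rewrite (_ : \tr (X *m P *m X) = \tr (P *m X *m X)); first by ring.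
  by rewrite mxtrace_mulC mulmxA mxtrace_mulC mulmxA.
rewrite /defect /kap e1 e2 sqrrN; lra.
Qed.

End projection_defect.

Section function_algebra.
Context (S : Type) (R : realType).

(** One set of closure rules serves three classes: tame functions, measurable functions, and
    functions of the other residuals only. *)
Definition function_algebra (C : (S -> R) -> Prop) : Prop :=
  [/\ forall c, C (fun=> c),
      forall f g, C f -> C g -> C (fun w => f w + g w) &
      forall f g, C f -> C g -> C (fun w => f w * g w)].

Variable C : (S -> R) -> Prop.
Hypothesis CA : function_algebra C.

Let Ccst c : C (fun=> c). Proof. by case: CA. Qed.
Let CD f g : C f -> C g -> C (fun w => f w + g w). Proof. by case: CA => _ + _; apply. Qed.
Let CM f g : C f -> C g -> C (fun w => f w * g w). Proof. by case: CA => _ _; apply. Qed.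
Let Ceq f g : C g -> f =1 g -> C f. Proof. by move=> Cg /funext ->. Qed.

Lemma algebraB f g : C f -> C g -> C (fun w => f w - g w).
Proof.
move=> Cf Cg; apply: (Ceq (CD Cf (CM (Ccst (-1)) Cg))) => w.
by rewrite mulN1r.
Qed.

Lemma algebraX k f : C f -> C (fun w => f w ^+ k).
Proof.
move=> Cf; elim: k => [|k ih]; first exact: (Ccst 1).
by apply: (Ceq (CM Cf ih)) => w; rewrite exprS.
Qed.

Lemma algebra_sum I (r : seq I) (F : I -> S -> R) :
  (forall i, C (F i)) -> C (fun w => \sum_(i <- r) F i w).
Proof.
move=> CF; elim: r => [|i r ih]; first by apply: (Ceq (Ccst 0)) => w; rewrite big_nil.
by apply: (Ceq (CD (CF i) ih)) => w; rewrite big_cons.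
Qed.

Definition entries_in n1 n2 (X : S -> 'M[R]_(n1, n2)) : Prop :=
  forall a b, C (fun w => X w a b).

Variables (n : nat).
Implicit Types X Y : S -> 'M[R]_n.

Lemma entries_cst (M : 'M[R]_n) : entries_in (fun=> M).
Proof. by move=> a b; exact: Ccst. Qed.

Lemma entriesD X Y : entries_in X -> entries_in Y -> entries_in (fun w => X w + Y w).
Proof. by move=> CX CY a b; apply: (Ceq (CD (CX a b) (CY a b))) => w; rewrite mxE. Qed.

Lemma entriesZ f X : C f -> entries_in X -> entries_in (fun w => f w *: X w).
Proof. by move=> Cf CX a b; apply: (Ceq (CM Cf (CX a b))) => w; rewrite mxE. Qed.

Lemma entriesB X Y : entries_in X -> entries_in Y -> entries_in (fun w => X w - Y w).
Proof.
by move=> CX CY a b; apply: (Ceq (algebraB (CX a b) (CY a b))) => w; rewrite !mxE.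
Qed.

Lemma entriesM X Y : entries_in X -> entries_in Y -> entries_in (fun w => X w *m Y w).
Proof.
move=> CX CY a b; apply: (@Ceq _ (fun w => \sum_j X w a j * Y w j b)).
  by apply: algebra_sum => j; exact: CM.
by move=> w; rewrite mxE.
Qed.

Lemma entries_sum k (F : nat -> S -> 'M[R]_n) :
  (forall i, (i < k)%N -> entries_in (F i)) -> entries_in (fun w => \sum_(i < k) F i w).
Proof.
elim: k => [|k ih] CF a b.
  by apply: (Ceq (Ccst 0)) => w; rewrite big_ord0 mxE.
have h : entries_in (fun w => \sum_(i < k) F i w + F k w).
  by apply: entriesD; [apply: ih => i ik; apply: CF; exact: ltnW|exact: CF].
by apply: (Ceq (h a b)) => w; rewrite big_ord_recr.
Qed.

Lemma algebra_trace X : entries_in X -> C (fun w => \tr (X w)).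
Proof. by move=> CX; apply: algebra_sum => i; exact: CX. Qed.

Lemma algebra_kap P m X : entries_in X -> C (fun w => kap P m (X w)).
Proof.
move=> CX; have PX := entriesM (entries_cst P) CX.
have h1 := algebra_trace (entriesM (entriesM PX (entries_cst P)) CX).
exact: algebraB h1 (CM (algebraX 2 (algebra_trace PX)) (Ccst m^-1)).
Qed.

Lemma entries_defect_grad P m X : entries_in X ->
  entries_in (fun w => defect_grad P m (X w)).
Proof.
move=> CX; have PX := entriesM (entries_cst P) CX.
apply: entriesD.
  by apply: entriesB => //; apply: entriesM => //; exact: entries_cst.
apply: entriesZ; last exact: entries_cst.
exact: CM (algebra_trace PX) (Ccst m^-1).
Qed.

End function_algebra.

Lemma function_algebra_tame d (Om : measurableType d) (R : realType)
  (P : probability Om R) : function_algebra (tame P).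
Proof. by split=> [c|f g|f g]; [exact: tame_cst|exact: tameD|exact: tameM]. Qed.

Lemma function_algebra_measurable d (S : measurableType d) (R : realType) :
  function_algebra (fun f : S -> R => measurable_fun setT f).
Proof. by split=> [c|f g|f g]; [exact: measurable_cst|exact: measurable_funD|exact: measurable_funM]. Qed.

Lemma sqrrD_le (R : realFieldType) (x y z : R) :
  y ^+ 2 <= z -> (x + y) ^+ 2 <= 2 * x ^+ 2 + 2 * z.
Proof. by have := sqr_ge0 (x - y); rewrite sqrrB sqrrD; lra. Qed.

Lemma mxtrace_sqrD (R : comPzRingType) n (X Y : 'M[R]_n) :
  \tr ((X + Y) *m (X + Y)) = \tr (X *m X) + 2 * \tr (Y *m X) + \tr (Y *m Y).
Proof.
rewrite mulmxDl !mulmxDr !mxtraceD [\tr (X *m Y)]mxtrace_mulC; ring.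
Qed.

Lemma mxtrace_sqrB (R : comPzRingType) n (X Y : 'M[R]_n) :
  \tr ((X - Y) *m (X - Y)) = \tr (X *m X) - 2 * \tr (Y *m X) + \tr (Y *m Y).
Proof.
rewrite mulmxBl !mulmxBr !mxtraceB [\tr (X *m Y)]mxtrace_mulC; ring.
Qed.

(** The trace of P Q is the squared Frobenius norm of P Q. *)
Lemma mxtrace_proj_ge0 (R : realFieldType) n (P Q : 'M[R]_n) :
  P^T = P -> P *m P = P -> Q^T = Q -> Q *m Q = Q -> 0 <= \tr (P *m Q).
Proof.
move=> PT PP QT QQ.
have -> : \tr (P *m Q) = \tr ((P *m Q)^T *m (P *m Q)).
  by rewrite trmx_mul PT QT mulmxA -(mulmxA Q) PP [RHS]mxtrace_mulC mulmxA QQ mxtrace_mulC.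
rewrite mxtrace_mulE; apply: sumr_ge0 => i _; apply: sumr_ge0 => j _.
by rewrite mxE -expr2 sqr_ge0.
Qed.

(** * The martingale of residual directions *)

Section martingale_core.
Context d (Om : measurableType d) (R : realType) (Pr : probability Om R).
Variables (n N : nat) (m p : R) (P : nat -> 'M[R]_n) (A : nat -> Om -> 'M[R]_n).
Variable Past : nat -> (Om -> R) -> Prop.
Hypotheses (m1 : 1 <= m) (p0 : 0 <= p) (nE : n%:R = m + p).
Hypothesis PA : forall k, function_algebra (Past k).
Hypothesis PT : forall k, (k < N)%N -> (P k)^T = P k.
Hypothesis PP : forall k, (k < N)%N -> P k *m P k = P k.
Hypothesis trP : forall k, (k < N)%N -> \tr (P k) = m.
Hypothesis AT : forall k w, (k < N)%N -> (A k w)^T = A k w.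
Hypothesis AA : forall k w, (k < N)%N -> A k w *m A k w = A k w.
Hypothesis trA : forall k w, (k < N)%N -> \tr (A k w) = 1.
Hypothesis PkA : forall k w, (k < N)%N -> P k *m A k w = A k w.
Hypothesis tameA : forall k, (k < N)%N -> entries_in (tame Pr) (A k).
Hypothesis pastA : forall i k, (i < N)%N -> (k < N)%N -> i != k ->
  entries_in (Past k) (A i).

Let B k w := A k w - m^-1 *: P k.

(** The form in which conditioning on the other residuals is used: [g] and [X] are frozen and the
    moments of the k-th direction are inserted. Exact values are needed up to order two, where the
    martingale property and the limiting variance are decided; at order four a bound is enough. *)
Hypothesis cond : forall k (g : Om -> R) (X : Om -> 'M[R]_n), (k < N)%N ->
  (forall w, (X w)^T = X w) -> entries_in (Past k) X -> entries_in (tame Pr) X ->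
  Past k g -> tame Pr g ->
  [/\ mean Pr (fun w => g w * \tr (B k w *m X w)) = 0,
      mean Pr (fun w => g w * \tr (B k w *m X w) ^+ 2) =
        mean Pr (fun w => g w * (2 * kap (P k) m (X w) / (m * (m + 2)))) &
      mean Pr (fun w => \tr (B k w *m X w) ^+ 4) <=
        mean Pr (fun w => 108 * kap (P k) m (X w) ^+ 2 / m ^+ 4)].

Let tA : function_algebra (tame Pr). Proof. exact: function_algebra_tame. Qed.
Let m0 : 0 < m. Proof. exact: lt_le_trans m1. Qed.
Let mn0 : m != 0. Proof. by rewrite gt_eqF. Qed.
Let m20 : m + 2 != 0. Proof. by rewrite gt_eqF// addr_gt0. Qed.
Let mi : 0 < m^-1. Proof. by rewrite invr_gt0. Qed.
Let mi1 : m^-1 <= 1. Proof. by rewrite invf_le1. Qed.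

Let AP k w : (k < N)%N -> A k w *m P k = A k w.
Proof. by move=> kN; rewrite -{1}(AT w kN) -{1}(PT kN) -trmx_mul PkA// AT. Qed.

Let BT k w : (k < N)%N -> (B k w)^T = B k w.
Proof. by move=> kN; rewrite /B linearB/= linearZ/= AT// PT. Qed.

Let trB k w : (k < N)%N -> \tr (B k w) = 0.
Proof. by move=> kN; rewrite /B mxtraceB mxtraceZ trA// trP// mulVf// subrr. Qed.

(** The square of B is affine in B, which makes tr B^2 deterministic and reduces tr (B^2 Q) to a
    centred term plus a constant. *)
Let BB k w : (k < N)%N ->
  B k w *m B k w = (1 - 2 / m) *: B k w + (m^-1 * (1 - m^-1)) *: P k.
Proof.
move=> kN; rewrite {1 2}/B mulmxBl !mulmxBr -!scalemxAl -!scalemxAr AA// AP// PkA// PP//.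
by apply/matrixP => a b; rewrite !mxE; field.
Qed.

Let trBB k w : (k < N)%N -> \tr (B k w *m B k w) = 1 - m^-1.
Proof.
move=> kN; rewrite BB// mxtraceD !mxtraceZ trB// trP// mulr0 add0r.
by rewrite mulrAC mulVf// mul1r.
Qed.

Let M k w := \sum_(i < k) B i w.

Let MS k w : M k.+1 w = M k w + B k w. Proof. exact: big_ord_recr. Qed.

Let MT k w : (k <= N)%N -> (M k w)^T = M k w.
Proof.
elim: k => [|k ih] kN; first by rewrite /M big_ord0 trmx0.
by rewrite MS linearD/= ih ?BT// ltnW.
Qed.

Let tB k : (k < N)%N -> entries_in (tame Pr) (B k).
Proof. by move=> kN; apply: entriesB => //; [exact: tameA|exact: entries_cst]. Qed.

Let tM k : (k <= N)%N -> entries_in (tame Pr) (M k).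
Proof. by move=> kN; apply: entries_sum => // i ik; apply: tB; exact: leq_trans kN. Qed.

Let pM j k : (j <= k)%N -> (k < N)%N -> entries_in (Past k) (M j).
Proof.
move=> jk kN; apply: entries_sum => // i ij; have ik := leq_trans ij jk.
apply: entriesB => //; last exact: entries_cst.
by apply: pastA => //; [exact: ltn_trans kN|rewrite neq_ltn ik].
Qed.

Let t k w := \tr (M k w *m M k w).
Let tt k : (k <= N)%N -> tame Pr (t k).
Proof. by move=> kN; apply: algebra_trace => //; apply: entriesM => //; exact: tM. Qed.
Let pt k : (k < N)%N -> Past k (t k).
Proof. by move=> kN; apply: (algebra_trace (PA k)); apply: (entriesM (PA k)); exact: pM. Qed.

Let BM k w := \tr (B k w *m M k w).
Let tBM k : (k < N)%N -> tame Pr (BM k).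
Proof.
move=> kN; apply: algebra_trace => //; apply: entriesM => //; first exact: tB.
by apply: tM; exact: ltnW.
Qed.

(** The trace of M_k^2, centred. As tr B_k^2 = 1 - 1 / m is deterministic, this is a martingale with
    increments 2 tr (B_k M_k). *)
Let Y k w := t k w - k%:R * (1 - m^-1).

Let tY k : (k <= N)%N -> tame Pr (Y k).
Proof. by move=> kN; apply: tameB; [exact: tt|exact: tame_cst]. Qed.

Let YS k w : (k < N)%N -> Y k.+1 w = Y k w + 2 * BM k w.
Proof.
move=> kN; rewrite /Y /t MS mxtrace_sqrD trBB// -/(BM k w) -natr1; ring.
Qed.

Let pY k : (k < N)%N -> Past k (Y k).
Proof.
move=> kN; apply: (algebraB (PA k) (pt kN)).
by case: (PA k) => h _ _; exact: h.
Qed.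

Let Past_cst k c : Past k (fun=> c).
Proof. by case: (PA k) => h _ _; exact: h. Qed.

Let condM k (kN : (k < N)%N) g (pg : Past k g) (tg : tame Pr g) :=
  @cond k g (M k) kN (fun w => MT w (ltnW kN)) (pM (leqnn k) kN) (tM (ltnW kN)) pg tg.

Let meanBM k : (k < N)%N -> mean Pr (BM k) = 0.
Proof.
move=> kN; have [h _ _] := condM kN (Past_cst k 1) (tame_cst Pr 1).
by rewrite -[RHS]h; apply: eq_mean => w; rewrite mul1r.
Qed.

Let mean_t k : (k <= N)%N -> mean Pr (t k) = k%:R * (1 - m^-1).
Proof.
move=> kN; suff h : mean Pr (Y k) = 0.
  move: h; rewrite /Y meanB; [|exact: tt|exact: tame_cst].
  by rewrite mean_cst => /eqP; rewrite subr_eq0 => /eqP.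
elim: k kN => [|k ih] kN.
  rewrite -[RHS](mean_cst Pr 0); apply: eq_mean => w.
  by rewrite /Y /t /M big_ord0 mul0mx mxtrace0 mul0r subrr.
transitivity (mean Pr (fun w => Y k w + 2 * BM k w)).
  by apply: eq_mean => w; rewrite YS.
rewrite meanD; [|by apply: tY; exact: ltnW|by apply: tameZ; exact: tBM].
by rewrite meanZ ?meanBM ?ih ?(ltnW kN)//; [rewrite mulr0 addr0|exact: tBM].
Qed.

Let t_ge0 k w : (k <= N)%N -> 0 <= t k w.
Proof. by move=> kN; apply: mxtrace_sqr_ge0; exact: MT. Qed.

Let kapM_le k w : (k < N)%N -> 0 <= kap (P k) m (M k w) <= t k w.
Proof.
move=> kN; have MTk := MT w (ltnW kN).
by rewrite (kap_ge0 (PT kN) (PP kN) (trP kN) m0 MTk) (kap_le (PT kN) (PP kN) (trP kN) m0 MTk).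
Qed.

Let tkap k X : entries_in (tame Pr) X -> tame Pr (fun w => kap (P k) m (X w)).
Proof. exact: algebra_kap. Qed.

Let inv_mm2 : (m * (m + 2))^-1 <= (m ^+ 2)^-1.
Proof.
rewrite lef_pV2 ?posrE ?exprn_gt0//; last by rewrite mulr_gt0// addr_gt0.
by rewrite expr2 ler_wpM2l ?(ltW m0)// lerDl.
Qed.

Let mean_BM2 k : (k < N)%N -> mean Pr (fun w => BM k w ^+ 2) <= 2 * k%:R / m ^+ 2.
Proof.
move=> kN; have [_ h _] := condM kN (Past_cst k 1) (tame_cst Pr 1).
rewrite (_ : mean Pr _ = mean Pr (fun w => 1 * (2 * kap (P k) m (M k w) / (m * (m + 2))))); last first.
  by rewrite -h; apply: eq_mean => w; rewrite mul1r.
have tk := tt (ltnW kN); have tkk := tkap k (tM (ltnW kN)).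
apply: (@le_trans _ _ (mean Pr (fun w => 2 / m ^+ 2 * t k w))).
  apply: le_mean.
  - apply: tameZ; apply: tameM; [exact: tameZ|exact: tame_cst].
  - exact: tameZ.
  - move=> w; have /andP[k0 k1] := kapM_le w kN.
    rewrite mul1r [leRHS]mulrAC; apply: ler_pM (inv_mm2).
    + by rewrite mulr_ge0.
    + by rewrite invr_ge0 mulr_ge0 ?addr_ge0// ltW.
    + by rewrite ler_wpM2l.
rewrite meanZ// mean_t ?(ltnW kN)// mulrAC ler_wpM2r ?invr_ge0 ?exprn_ge0 ?(ltW m0)//.
by rewrite ler_wpM2l// ler_piMr// lerBlDl lerDr ltW.
Qed.

(** Increments are orthogonal, each adds at most 8 k / m^2, and 4 k^2 + 8 k <= 4 (k + 1)^2. *)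
Let mean_Y2 k : (k <= N)%N -> mean Pr (fun w => Y k w ^+ 2) <= 4 * k%:R ^+ 2 / m ^+ 2.
Proof.
elim: k => [|k ih] kN.
  rewrite (_ : mean _ _ = 0); first by rewrite expr0n mulr0 mul0r.
  rewrite -[RHS](mean_cst Pr 0); apply: eq_mean => w.
  by rewrite /Y /t /M big_ord0 mul0mx mxtrace0 mul0r subrr expr0n.
have kN' := ltnW kN.
have t1 := tameX 2 (tY kN'); have t2 := tameM (tY kN') (tBM kN); have t3 := tameX 2 (tBM kN).
rewrite (_ : mean _ _ = mean Pr (fun w => Y k w ^+ 2) + 4 * mean Pr (fun w => Y k w * BM k w) +
    4 * mean Pr (fun w => BM k w ^+ 2)); last first.
  have tz2 := tameZ 4 t2; have tz3 := tameZ 4 t3.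
  rewrite -!meanZ// -(meanD t1 tz2) -(meanD (tameD t1 tz2) tz3).
  by apply: eq_mean => w; rewrite YS//; ring.
have [-> _ _] := condM kN (pY kN) (tY kN').
rewrite mulr0 addr0; have := ih kN'; have := mean_BM2 kN.
rewrite -natr1; have := ler0n R k; have i0 : 0 < m ^- 2 by rewrite invr_gt0 exprn_gt0.
move: (mean Pr _) (mean Pr _) => x y; move: (m ^- 2) i0 => i i0 k0 h1 h2.
nra.
Qed.

Let Q j : 'M[R]_n := 1%:M - P j.
Let QT j : (j < N)%N -> (Q j)^T = Q j.
Proof. by move=> jN; rewrite /Q linearB/= trmx1 PT. Qed.
Let QQ j : (j < N)%N -> Q j *m Q j = Q j.
Proof. by move=> jN; rewrite /Q mulmxBl !mulmxBr !mul1mx mulmx1 PP// subrr subr0. Qed.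
Let trQ j : (j < N)%N -> \tr (Q j) = p.
Proof. by move=> jN; rewrite /Q mxtraceB mxtrace1 trP// nE addrC addKr. Qed.

Let tdefect j X : entries_in (tame Pr) X -> tame Pr (fun w => defect (P j) m (X w)).
Proof.
move=> tX; apply: tameB; last exact: tkap.
by apply: algebra_trace => //; exact: entriesM.
Qed.

(** Through [defect_le] only Q_j = 1 - P_j, of trace p, matters. The part linear in B_i is centred,
    tr (P_i Q_j) <= p contributes at most 2 p / m, and the squared trace another 2 p / m. *)
Let mean_defectB i j : (i < N)%N -> (j < N)%N ->
  mean Pr (fun w => defect (P j) m (B i w)) <= 4 * p / m.
Proof.
move=> iN jN.
have pQ : entries_in (Past i) (fun=> Q j) by exact: entries_cst.
have tQ : entries_in (tame Pr) (fun=> Q j) by exact: entries_cst.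
have [h1 h2 _] := cond iN (fun=> QT jN) pQ tQ (Past_cst i 1) (tame_cst Pr 1).
have tBQ : tame Pr (fun w => \tr (B i w *m Q j)).
  by apply: algebra_trace => //; apply: entriesM => //; exact: tB.
have kQ0 := kap_ge0 (PT iN) (PP iN) (trP iN) m0 (QT jN).
have kQ : kap (P i) m (Q j) <= p.
  apply: le_trans (kap_le (PT iN) (PP iN) (trP iN) m0 (QT jN)) _.
  by rewrite QQ// trQ.
have PQ0 : 0 <= \tr (P i *m Q j).
  by apply: mxtrace_proj_ge0; [exact: PT|exact: PP|exact: QT|exact: QQ].
have PQ : \tr (P i *m Q j) <= p.
  have : 0 <= \tr (Q i *m Q j).
    by apply: mxtrace_proj_ge0; [exact: QT|exact: QQ|exact: QT|exact: QQ].
  by rewrite {1}/Q mulmxBl mul1mx mxtraceB trQ// subr_ge0.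
pose F w := 2 * ((1 - 2 / m) * \tr (B i w *m Q j) + m^-1 * (1 - m^-1) * \tr (P i *m Q j)) +
  \tr (B i w *m Q j) ^+ 2 / m.
apply: (@le_trans _ _ (mean Pr F)).
  apply: le_mean; first exact: tdefect (tB iN).
    apply: tameD; last by apply: tameM; [exact: tameX|exact: tame_cst].
    by apply: tameZ; apply: tameD; [exact: tameZ|exact: tame_cst].
  move=> w; have := defect_le m (PT jN) (PP jN) (BT w iN) (trB w iN).
  rewrite (_ : \tr (B i w *m B i w *m Q j) = (1 - 2 / m) * \tr (B i w *m Q j) +
    m^-1 * (1 - m^-1) * \tr (P i *m Q j))//.
  by rewrite BB// mulmxDl -!scalemxAl mxtraceD !mxtraceZ.
have s1 : mean Pr (fun w => \tr (B i w *m Q j)) = 0.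
  by rewrite -[RHS]h1; apply: eq_mean => w; rewrite mul1r.
have s2 : mean Pr (fun w => \tr (B i w *m Q j) ^+ 2) = 2 * kap (P i) m (Q j) / (m * (m + 2)).
  rewrite -[RHS](mean_cst Pr) -[RHS](eq_mean _ (fun w => mul1r _)) -h2.
  by apply: eq_mean => w; rewrite mul1r.
rewrite (_ : mean Pr F = 2 * (m^-1 * (1 - m^-1) * \tr (P i *m Q j)) +
    2 * kap (P i) m (Q j) / (m * (m + 2)) / m); last first.
  have u1 := tameZ (2 * (1 - 2 / m)) tBQ.
  have u2 := tame_cst Pr (2 * (m^-1 * (1 - m^-1) * \tr (P i *m Q j))).
  have u3 := tameZ m^-1 (tameX 2 tBQ).
  transitivity (mean Pr (fun w => 2 * (1 - 2 / m) * \tr (B i w *m Q j) +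
    2 * (m^-1 * (1 - m^-1) * \tr (P i *m Q j)) + m^-1 * \tr (B i w *m Q j) ^+ 2)).
    by apply: eq_mean => w; rewrite /F; ring.
  rewrite (meanD (tameD u1 u2) u3) (meanD u1 u2) (mean_cst Pr) !meanZ//; last exact: tameX.
  by rewrite s1 s2; ring.
have b1 : m^-1 * (1 - m^-1) * \tr (P i *m Q j) <= m^-1 * p.
  rewrite -mulrA ler_wpM2l ?(ltW mi)//; apply: le_trans PQ.
  by rewrite ler_piMl// lerBlDl lerDr ltW.
have b2 : 2 * kap (P i) m (Q j) / (m * (m + 2)) <= 2 * p.
  rewrite -mulrA ler_wpM2l//; apply: le_trans kQ; rewrite ler_piMr//.
  apply: le_trans inv_mm2 _; rewrite invf_le1 ?exprn_gt0//.
  by rewrite exprn_ege1.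
have b3 : 2 * kap (P i) m (Q j) / (m * (m + 2)) / m <= 2 * p / m by rewrite ler_wpM2r// ltW.
have -> : 4 * p / m = 2 * (m^-1 * p) + 2 * p / m by ring.
lra.
Qed.

Let mean_defectM i j : (i <= N)%N -> (j < N)%N ->
  mean Pr (fun w => defect (P j) m (M i w)) <= 4 * p / m * i%:R.
Proof.
move=> + jN; elim: i => [|i ih] iN.
  rewrite (_ : mean _ _ = 0) ?mulr0// -[RHS](mean_cst Pr 0); apply: eq_mean => w.
  by rewrite /defect /kap /M big_ord0 !mulmx0 !mxtrace0 expr0n mul0r !subr0.
have iN' := ltnW iN.
pose G w := defect_grad (P j) m (M i w).
have tG : entries_in (tame Pr) G by apply: entries_defect_grad => //; exact: tM.
have pG : entries_in (Past i) G by apply: (entries_defect_grad (PA i)); exact: pM.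
have GT w : (G w)^T = G w by apply: defect_grad_sym; [exact: PT|exact: MT].
have [h _ _] := cond iN GT pG tG (Past_cst i 1) (tame_cst Pr 1).
have t1 := tdefect j (tM iN'); have t2 := tdefect j (tB iN).
have t3 : tame Pr (fun w => \tr (B i w *m G w)).
  by apply: algebra_trace => //; apply: entriesM => //; exact: tB.
have -> : mean Pr (fun w => defect (P j) m (M i.+1 w)) =
    mean Pr (fun w => defect (P j) m (M i w)) + mean Pr (fun w => defect (P j) m (B i w)) +
    2 * mean Pr (fun w => \tr (B i w *m G w)).
  rewrite -meanZ// -(meanD t1 t2) -(meanD (tameD t1 t2) (tameZ 2 t3)).
  apply: eq_mean => w; rewrite MS.
  exact: defectD.
have -> : mean Pr (fun w => \tr (B i w *m G w)) = 0.
  by rewrite -[RHS]h; apply: eq_mean => w; rewrite mul1r.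
rewrite mulr0 addr0 -(natr1 i) mulrDr mulr1; apply: lerD; first exact: ih.
exact: mean_defectB.
Qed.

Variable K : nat -> 'M[R]_n.
Hypothesis N0 : (0 < N)%N.
Hypothesis Nm : N%:R <= m ^+ 2.
Hypothesis KT : forall k, (k < N)%N -> (K k)^T = K k.
Hypothesis trKK : forall k, (k < N)%N ->
  \tr (K k *m K k) <= N%:R ^+ 2 * p / m ^+ 2.

Let NR : R := N%:R.
Let NR1 : 1 <= NR. Proof. by rewrite /NR ler1n. Qed.
Let NR0 : 0 < NR. Proof. exact: lt_le_trans NR1. Qed.
(** [nu] and [eta] are the two rates of the final bound, and the hypothesis [Nm] says that eta <= 1.
    The ratio [c] is close to 1 since n = m + p, and [tau] is the bound N^2 p / m^2 on tr K_k^2,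
    written in terms of eta. *)
Let nu := Num.sqrt NR^-1.
Let eta := Num.sqrt NR / m.
Let c := n%:R ^+ 2 / (m * (m + 2)).
Let tau := NR * (eta ^+ 2 * p).

Let nu2 : nu ^+ 2 = NR^-1. Proof. by rewrite /nu sqr_sqrtr// invr_ge0 ltW. Qed.
Let nu0 : 0 < nu. Proof. by rewrite /nu sqrtr_gt0 invr_gt0. Qed.
Let nu1 : nu <= 1.
Proof. by rewrite /nu -[leRHS]sqrtr1 ler_wsqrtr// invf_le1. Qed.
Let eta0 : 0 < eta. Proof. by rewrite /eta divr_gt0// sqrtr_gt0. Qed.
Let eta2 : eta ^+ 2 = NR / m ^+ 2.
Proof. by rewrite /eta expr_div_n sqr_sqrtr// ltW. Qed.
Let eta1 : eta <= 1.
Proof.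
rewrite -(ler_pXn2r (n := 2))// ?nnegrE ?(ltW eta0)// eta2 expr1n.
by rewrite ler_pdivrMr ?exprn_gt0// mul1r.
Qed.
Let mi_eta : m^-1 <= eta.
Proof.
by rewrite /eta ler_peMl ?(ltW mi)// -[leLHS]sqrtr1 ler_wsqrtr.
Qed.
Let n_le : n%:R <= (1 + p) * m.
Proof. by rewrite nE mulrDl mul1r lerD2l ler_peMr. Qed.
Let c0 : 0 <= c.
Proof. by rewrite divr_ge0 ?exprn_ge0// mulr_ge0 ?addr_ge0// ltW. Qed.
Let c_le : c <= (1 + p) ^+ 2.
Proof.
rewrite /c ler_pdivrMr; last by rewrite mulr_gt0// addr_gt0.
apply: (@le_trans _ _ ((1 + p) ^+ 2 * m ^+ 2)).
  by rewrite -exprMn; apply: lerXn2r; rewrite ?nnegrE ?mulr_ge0 ?addr_ge0 ?(ltW m0).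
by rewrite ler_wpM2l ?sqr_ge0// expr2 ler_wpM2l ?(ltW m0)// lerDl.
Qed.
(** Since n = m + p, the difference is a rational function of order 1 / m, and 1 / m <= eta. The
    constant is a crude bound on the coefficients of its numerator. *)
Let cbeta : `|c * (1 - m^-1) - 1| <= (2 * p ^+ 2 + 4 * p + 3) * eta.
Proof.
apply: (@le_trans _ _ ((2 * p ^+ 2 + 4 * p + 3) / m)); last first.
  by rewrite ler_wpM2l// !addr_ge0 ?mulr_ge0 ?exprn_ge0.
have e : c * (1 - m^-1) - 1 =
    ((2 * p - 3) * m ^+ 2 + (p ^+ 2 - 2 * p) * m - p ^+ 2) / (m ^+ 2 * (m + 2)).
  by rewrite /c nE; field; rewrite m20 mn0.
have den : 0 < m ^+ 2 * (m + 2) by rewrite mulr_gt0 ?exprn_gt0 ?addr_gt0.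
rewrite e normrM normfV (gtr0_norm den) ler_pdivrMr//.
have -> : (2 * p ^+ 2 + 4 * p + 3) / m * (m ^+ 2 * (m + 2)) =
  (2 * p ^+ 2 + 4 * p + 3) * (m * (m + 2)) by field.
have mm : m <= m ^+ 2 by rewrite expr2 ler_peMl// ltW.
have mm1 : 1 <= m ^+ 2 by exact: exprn_ege1.
have pm : p * m <= p * m ^+ 2 by rewrite ler_wpM2l.
have p2 : 0 <= p ^+ 2 by exact: sqr_ge0.
have p2m : p ^+ 2 * m <= p ^+ 2 * m ^+ 2 by rewrite ler_wpM2l.
have p2m1 : p ^+ 2 <= p ^+ 2 * m ^+ 2 by rewrite ler_peMr.
have pm0 : 0 <= p * m ^+ 2 by rewrite mulr_ge0// exprn_ge0// ltW.
have pm1 : 0 <= p * m by rewrite mulr_ge0// ltW.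
have p2m0 : 0 <= p ^+ 2 * m by rewrite mulr_ge0// ltW.
have m0' := ltW m0.
have C1 : (2 * p ^+ 2 + 4 * p + 3) * (m * (m + 2)) = 2 * (p ^+ 2 * m ^+ 2) +
  4 * (p ^+ 2 * m) + 4 * (p * m ^+ 2) + 8 * (p * m) + 3 * m ^+ 2 + 6 * m by ring.
have C2 : (2 * p - 3) * m ^+ 2 + (p ^+ 2 - 2 * p) * m - p ^+ 2 =
  2 * (p * m ^+ 2) - 3 * m ^+ 2 + p ^+ 2 * m - 2 * (p * m) - p ^+ 2 by ring.
rewrite C1 C2 ler_norml.
move: p2 p2m p2m1 pm0 pm1 p2m0 m0' mm mm1.
move: (p ^+ 2 * m ^+ 2) (p ^+ 2 * m) (p * m ^+ 2) (p * m) (p ^+ 2) (m ^+ 2) => x1 x2 x3 x4 x5 x6 *.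
apply/andP; split; lra.
Qed.
Let tau_ge0 : 0 <= tau. Proof. by rewrite /tau !mulr_ge0 ?exprn_ge0// ltW. Qed.
Let tau_le : tau <= NR * p.
Proof.
by rewrite /tau ler_wpM2l ?(ltW NR0)// ler_piMl// exprn_ile1// ltW.
Qed.
Let trKK' k : (k < N)%N -> \tr (K k *m K k) <= tau.
Proof.
move=> kN; apply: le_trans (trKK kN) _; rewrite le_eqVlt; apply/orP; left; apply/eqP.
by rewrite /tau eta2 /NR; ring.
Qed.

Let M' k w := M k w - K k.
Let M'T k w : (k < N)%N -> (M' k w)^T = M' k w.
Proof. by move=> kN; rewrite /M' linearB/= KT// MT// ltnW. Qed.
Let tM' k : (k < N)%N -> entries_in (tame Pr) (M' k).
Proof. by move=> kN; exact: (entriesB tA (tM (ltnW kN)) (entries_cst tA (K k))). Qed.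
Let pM' j k : (j <= k)%N -> (k < N)%N -> entries_in (Past k) (M' j).
Proof. by move=> jk kN; exact: (entriesB (PA k) (pM jk kN) (entries_cst (PA k) (K j))). Qed.

Let kap' k w := kap (P k) m (M' k w).
Let tkap' k : (k < N)%N -> tame Pr (kap' k).
Proof. by move=> kN; apply: tkap; exact: tM'. Qed.

(** [kap_sub] is used with parameter eta, which makes eta t and tau / eta both of order N eta. The
    contributions are N eta from t, 2 p N eta from K_k and 4 p N eta from the defect. *)
Let mean_dev k : (k < N)%N ->
  mean Pr (fun w => `|kap' k w - t k w|) <= NR * ((1 + 6 * p) * eta).
Proof.
move=> kN; have kN' := ltnW kN.
have kNR : k%:R <= NR by rewrite /NR ler_nat.
have td := tdefect k (tM kN'); have tk := tt kN'.
have t1 := tameZ eta tk; have t2 := tame_cst Pr ((1 + eta^-1) * tau).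
apply: (@le_trans _ _ (mean Pr (fun w => eta * t k w + (1 + eta^-1) * tau +
    defect (P k) m (M k w)))).
  apply: le_mean.
  - by apply: tame_norm; apply: tameB => //; exact: tkap'.
  - by apply: tameD => //; exact: tameD.
  move=> w; have MTk := MT w kN'.
  have h1 := kap_sub (PT kN) (PP kN) (trP kN) m0 MTk (KT kN) eta0.
  have /andP[_ h2] := kapM_le w kN.
  have -> : kap' k w - t k w = (kap (P k) m (M k w - K k) - kap (P k) m (M k w)) -
      defect (P k) m (M k w) by rewrite /defect -/(t k w) /kap' /M'; ring.
  apply: le_trans (ler_normB _ _) _; apply: lerD.
    apply: le_trans h1 _; rewrite lerD2l ler_wpM2l ?trKK'//.
    by rewrite addr_ge0// invr_ge0 ltW.
  by rewrite ger0_norm// /defect subr_ge0.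
rewrite (meanD (tameD t1 t2) td) (meanD t1 t2) (mean_cst Pr) meanZ// mean_t//.
have d1 : mean Pr (fun w => defect (P k) m (M k w)) <= NR * (4 * p * eta).
  apply: le_trans (mean_defectM kN' kN) _.
  rewrite mulrC; apply: ler_pM => //; first by rewrite divr_ge0 ?mulr_ge0// ltW.
  by rewrite ler_wpM2l ?mulr_ge0.
have d2 : eta * (k%:R * (1 - m^-1)) <= NR * eta.
  rewrite mulrC ler_wpM2r ?(ltW eta0)//; apply: le_trans kNR.
  by rewrite ler_piMr// lerBlDl lerDr ltW.
have d3 : (1 + eta^-1) * tau <= NR * (2 * p * eta).
  have -> : (1 + eta^-1) * tau = NR * ((eta + 1) * p * eta).
    by rewrite /tau; field; rewrite gt_eqF.
  rewrite ler_wpM2l ?(ltW NR0)// ler_wpM2r ?(ltW eta0)// ler_wpM2r//.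
  by rewrite -[2]/(1 + 1) lerD2r.
have -> : NR * ((1 + 6 * p) * eta) = NR * eta + NR * (2 * p * eta) + NR * (4 * p * eta) by ring.
by apply: lerD => //; exact: lerD.
Qed.

(** By AM-GM |Y| <= m Y^2 / (2 N) + N / (2 m), with weights suited to Y of order N / m; this takes
    the place of Jensen's inequality. *)
Let mean_absY k : (k < N)%N -> mean Pr (fun w => `|Y k w|) <= NR * (5 / 2 * eta).
Proof.
move=> kN; have kN' := ltnW kN.
have kNR : k%:R <= NR by rewrite /NR ler_nat.
have t1 := tameZ (m / (2 * NR)) (tameX 2 (tY kN')); have t2 := tame_cst Pr (NR / (2 * m)).
apply: (@le_trans _ _ (mean Pr (fun w => m / (2 * NR) * Y k w ^+ 2 + NR / (2 * m)))).
  apply: le_mean; [by apply: tame_norm; exact: tY|exact: tameD|move=> w].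
  rewrite -(real_normK (num_real (Y k w))) -subr_ge0.
  have -> : m / (2 * NR) * `|Y k w| ^+ 2 + NR / (2 * m) - `|Y k w| =
    m / (2 * NR) * (`|Y k w| - NR / m) ^+ 2 by field; rewrite mn0 gt_eqF.
  by rewrite mulr_ge0 ?sqr_ge0// divr_ge0 ?mulr_ge0// ltW.
rewrite (meanD t1 t2) (mean_cst Pr) meanZ; last by apply: tameX; exact: tY.
apply: (@le_trans _ _ (m / (2 * NR) * (4 * NR ^+ 2 / m ^+ 2) + NR / (2 * m))).
  rewrite lerD2r ler_wpM2l ?divr_ge0 ?mulr_ge0 ?(ltW NR0) ?(ltW m0)//.
  apply: le_trans (mean_Y2 kN') _; rewrite ler_wpM2r ?invr_ge0 ?exprn_ge0 ?(ltW m0)//.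
  by rewrite ler_wpM2l//; apply: lerXn2r; rewrite ?nnegrE ?ler0n ?(ltW NR0).
have -> : m / (2 * NR) * (4 * NR ^+ 2 / m ^+ 2) + NR / (2 * m) = NR * (5 / 2 * m^-1).
  by field; rewrite mn0 gt_eqF.
by rewrite ler_wpM2l ?(ltW NR0)// ler_wpM2l.
Qed.

Let V k w := (n%:R / NR) ^+ 2 * (2 * kap' k w / (m * (m + 2))).
Let v k : R := (2 * k%:R + 1) / NR ^+ 2.
Let tV k : (k < N)%N -> tame Pr (V k).
Proof.
by move=> kN; apply: tameZ; apply: tameM; [apply: tameZ; exact: tkap'|exact: tame_cst].
Qed.

(** 6 p + 7 / 2 adds 1 + 6 p from [mean_dev] to 5 / 2 from [mean_absY]; 2 (1 + p)^2 bounds 2 c; the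
    last summand is twice the constant of [cbeta]. *)
Definition core_const1 : R := 2 * (1 + p) ^+ 2 * (6 * p + 7 / 2) + 2 * (2 * p ^+ 2 + 4 * p + 3).

(** V - v splits into kap' - t, the fluctuation Y of t, and the deterministic gap between 2 c k (1 -
    1 / m) and 2 k + 1. The unit in 2 k + 1 costs 1 / N^2 <= nu / N. *)
Let mean_V k : (k < N)%N ->
  mean Pr (fun w => `|V k w - v k|) <= (core_const1 * eta + nu) / NR.
Proof.
move=> kN; have kN' := ltnW kN.
have kNR : k%:R <= NR by rewrite /NR ler_nat.
have tdev : tame Pr (fun w => `|kap' k w - t k w|).
  by apply: tame_norm; apply: tameB; [exact: tkap'|exact: tt].
have tabs := tame_norm (tY kN').
have t1 := tameZ (2 * c / NR ^+ 2) tdev; have t2 := tameZ (2 * c / NR ^+ 2) tabs.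
pose e := (2 / NR ^+ 2) * (k%:R * `|c * (1 - m^-1) - 1|) + 1 / NR ^+ 2.
have t3 := tame_cst Pr e.
have NR2 : 0 < NR ^+ 2 by rewrite exprn_gt0.
have q0 : 0 <= 2 * c / NR ^+ 2 by rewrite divr_ge0 ?(ltW NR2)// mulr_ge0.
apply: (@le_trans _ _ (mean Pr (fun w => 2 * c / NR ^+ 2 * `|kap' k w - t k w| +
    2 * c / NR ^+ 2 * `|Y k w| + e))).
  apply: le_mean.
  - by apply: tame_norm; apply: tameB; [exact: tV|exact: tame_cst].
  - by apply: tameD => //; exact: tameD.
  move=> w.
  have -> : V k w - v k = 2 * c / NR ^+ 2 * (kap' k w - t k w) + 2 * c / NR ^+ 2 * Y k w +
      ((2 / NR ^+ 2) * (k%:R * (c * (1 - m^-1) - 1)) - 1 / NR ^+ 2).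
    by rewrite /V /v /Y /c; field; rewrite m20 mn0 gt_eqF.
  apply: le_trans (ler_normD _ _) _; apply: lerD.
    apply: le_trans (ler_normD _ _) _.
    by rewrite [X in X + _]normrM [X in _ + X]normrM (ger0_norm q0).
  apply: le_trans (ler_normB _ _) _; rewrite /e.
  rewrite (ger0_norm (_ : 0 <= 1 / NR ^+ 2)) ?divr_ge0 ?(ltW NR2)//.
  by rewrite normrM (ger0_norm (_ : 0 <= 2 / NR ^+ 2)) ?divr_ge0 ?(ltW NR2)// normrM (ger0_norm (_ : 0 <= k%:R)).
rewrite (meanD (tameD t1 t2) t3) (meanD t1 t2) (mean_cst Pr) !meanZ//.
have b1 : 2 * c / NR ^+ 2 * mean Pr (fun w => `|kap' k w - t k w|) <=
    2 * (1 + p) ^+ 2 / NR ^+ 2 * (NR * ((1 + 6 * p) * eta)).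
  apply: ler_pM => //; [exact: mean_ge0| |exact: mean_dev].
  by rewrite ler_wpM2r ?invr_ge0 ?(ltW NR2)// ler_wpM2l.
have b2 : 2 * c / NR ^+ 2 * mean Pr (fun w => `|Y k w|) <=
    2 * (1 + p) ^+ 2 / NR ^+ 2 * (NR * (5 / 2 * eta)).
  apply: ler_pM => //; [exact: mean_ge0| |exact: mean_absY].
  by rewrite ler_wpM2r ?invr_ge0 ?(ltW NR2)// ler_wpM2l.
have b3 : e <= (2 / NR ^+ 2) * (NR * ((2 * p ^+ 2 + 4 * p + 3) * eta)) + nu / NR.
  apply: lerD.
    rewrite ler_wpM2l ?divr_ge0 ?(ltW NR2)//; apply: ler_pM => //.
  rewrite mul1r expr2 invfM ler_wpM2r ?invr_ge0 ?(ltW NR0)//.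
  by rewrite -nu2 expr2 ler_piMl// ltW.
apply: le_trans (lerD (lerD b1 b2) b3) _.
rewrite le_eqVlt; apply/orP; left; apply/eqP; rewrite /core_const1; field.
by rewrite gt_eqF.
Qed.

Let D k w := n%:R / NR * \tr (B k w *m M' k w).
Let nNR0 : 0 <= n%:R / NR. Proof. by rewrite divr_ge0// ltW. Qed.

Let tBM' k : (k < N)%N -> tame Pr (fun w => \tr (B k w *m M' k w)).
Proof. by move=> kN; exact: (algebra_trace tA (entriesM tA (tB kN) (tM' kN))). Qed.

Let tD k : (k < N)%N -> tame Pr (D k).
Proof. by move=> kN; apply: tameZ; exact: tBM'. Qed.

Let condM' k (kN : (k < N)%N) g (pg : Past k g) (tg : tame Pr g) :=
  @cond k g (M' k) kN (fun w => M'T w kN) (pM' (leqnn k) kN) (tM' kN) pg tg.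

Let mean_gD k g : (k < N)%N -> Past k g -> tame Pr g ->
  mean Pr (fun w => g w * D k w) = 0 /\
  mean Pr (fun w => g w * D k w ^+ 2) = mean Pr (fun w => g w * V k w).
Proof.
move=> kN pg tg; have [h1 h2 _] := condM' kN pg tg.
have tt1 := tBM' kN; have tk := tkap' kN.
split.
  transitivity (mean Pr (fun w => n%:R / NR * (g w * \tr (B k w *m M' k w)))).
    by apply: eq_mean => w; rewrite /D mulrCA.
  by rewrite meanZ ?h1 ?mulr0//; exact: tameM.
transitivity (mean Pr (fun w => (n%:R / NR) ^+ 2 * (g w * \tr (B k w *m M' k w) ^+ 2))).
  by apply: eq_mean => w; rewrite /D exprMn mulrCA.
rewrite meanZ; last by apply: tameM => //; exact: tameX.
rewrite h2 -meanZ; last first.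
  apply: tameM => //; apply: tameM; [exact: tameZ|exact: tame_cst].
by apply: eq_mean => w; rewrite /V mulrCA.
Qed.

Let kap'_le k w : (k < N)%N -> 0 <= kap' k w <= 2 * t k w + 2 * tau.
Proof.
move=> kN; have XT := M'T w kN.
rewrite (kap_ge0 (PT kN) (PP kN) (trP kN) m0 XT)/=.
apply: le_trans (kap_le (PT kN) (PP kN) (trP kN) m0 XT) _.
have h := trKK' kN.
(* Parallelogram identity: tr (M - K)^2 = 2 tr M^2 + 2 tr K^2 - tr (M + K)^2. *)
have h2 : 0 <= \tr ((M k w + K k) *m (M k w + K k)).
  by apply: mxtrace_sqr_ge0; rewrite linearD/= KT// MT// ltnW.
have e : \tr (M' k w *m M' k w) = \tr (M k w *m M k w) - 2 * \tr (K k *m M k w) + \tr (K k *m K k).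
  exact: mxtrace_sqrB.
rewrite e; rewrite mxtrace_sqrD in h2; rewrite -/(t k w) in h2 *.
move: h h2; move: (\tr _) (\tr _) (t k w) => x y z *; lra.
Qed.

Let mean_D2 k : (k < N)%N -> mean Pr (fun w => D k w ^+ 2) <= 4 * (1 + p) ^+ 3 / NR.
Proof.
move=> kN; have kN' := ltnW kN.
have kNR : k%:R <= NR by rewrite /NR ler_nat.
have [_ h] := mean_gD kN (Past_cst k 1) (tame_cst Pr 1).
rewrite (_ : mean Pr _ = mean Pr (fun w => 1 * V k w)); last first.
  by rewrite -h; apply: eq_mean => w; rewrite mul1r.
have NR2 : 0 < NR ^+ 2 by rewrite exprn_gt0.
have q0 : 0 <= 2 * c / NR ^+ 2 by rewrite divr_ge0 ?(ltW NR2)// mulr_ge0.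
have t1 := tameZ 2 (tt kN'); have t2 := tame_cst Pr (2 * tau).
apply: (@le_trans _ _ (mean Pr (fun w => 2 * c / NR ^+ 2 * (2 * t k w + 2 * tau)))).
  apply: le_mean.
  - by apply: tameZ; exact: tV.
  - by apply: tameZ; exact: tameD.
  - move=> w; have /andP[_ k1] := kap'_le w kN.
    have -> : 1 * V k w = 2 * c / NR ^+ 2 * kap' k w.
      by rewrite /V /c; field; rewrite m20 mn0 gt_eqF.
    exact: ler_wpM2l.
rewrite meanZ; last exact: tameD.
rewrite (meanD t1 t2) (mean_cst Pr) meanZ ?mean_t//; last exact: tt.
have b : 2 * (k%:R * (1 - m^-1)) + 2 * tau <= 2 * (NR * (1 + p)).
  have x1 : k%:R * (1 - m^-1) <= NR.
    by apply: le_trans kNR; rewrite ler_piMr// lerBlDl lerDr ltW.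
  have x2 : tau <= NR * p by [].
  by rewrite [NR * (1 + p)]mulrDr mulr1; move: x1 x2; move: (k%:R * _) (NR * p) => *; lra.
apply: (@le_trans _ _ (2 * (1 + p) ^+ 2 / NR ^+ 2 * (2 * (NR * (1 + p))))).
  apply: ler_pM => //.
    have x0 : 0 <= 1 - m^-1 by rewrite subr_ge0.
    by apply: addr_ge0; apply: mulr_ge0 => //; exact: mulr_ge0.
  by rewrite ler_wpM2r ?invr_ge0 ?(ltW NR2)// ler_wpM2l.
by rewrite le_eqVlt; apply/orP; left; apply/eqP; field; rewrite gt_eqF.
Qed.

(** (1 + p)^4 bounds (n / m)^4, 108 is the fourth-moment constant, 80 = 8 * 10 comes from E t^2 <=
    10 N^2, and 8 p^2 from tau <= N p. *)
Definition core_const4 : R := (1 + p) ^+ 4 * 108 * (80 + 8 * p ^+ 2).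

Let mean_D4 k : (k < N)%N -> mean Pr (fun w => D k w ^+ 4) <= core_const4 / NR ^+ 2.
Proof.
move=> kN; have kN' := ltnW kN.
have kNR : k%:R <= NR by rewrite /NR ler_nat.
have [_ _ h] := condM' kN (Past_cst k 1) (tame_cst Pr 1).
have m4 : 0 < m ^+ 4 by rewrite exprn_gt0.
have tt2 := tameX 2 (tt kN').
have -> : mean Pr (fun w => D k w ^+ 4) =
    (n%:R / NR) ^+ 4 * mean Pr (fun w => \tr (B k w *m M' k w) ^+ 4).
  by rewrite -meanZ; [apply: eq_mean => w; rewrite /D exprMn|apply: tameX; exact: tBM'].
have et2 : mean Pr (fun w => t k w ^+ 2) <= 10 * NR ^+ 2.
  have tY2 := tameX 2 (tY kN').
  apply: (@le_trans _ _ (mean Pr (fun w => 2 * Y k w ^+ 2 + 2 * NR ^+ 2))).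
    apply: le_mean => //; first by apply: tameD; [exact: tameZ|exact: tame_cst].
    move=> w; have e : t k w = Y k w + k%:R * (1 - m^-1) by rewrite /Y subrK.
    rewrite e; have x0 : 0 <= k%:R * (1 - m^-1) by rewrite mulr_ge0// subr_ge0.
    have x1 : k%:R * (1 - m^-1) <= NR.
      by apply: le_trans kNR; rewrite ler_piMr// lerBlDl lerDr ltW.
    have x2 : (k%:R * (1 - m^-1)) ^+ 2 <= NR ^+ 2.
      by apply: lerXn2r; rewrite ?nnegrE ?(ltW NR0).
    exact: sqrrD_le.
  rewrite (meanD (tameZ 2 tY2) (tame_cst Pr _)) (mean_cst Pr) meanZ//.
  have h2 := mean_Y2 kN'.
  have h3 : 4 * k%:R ^+ 2 / m ^+ 2 <= 4 * NR ^+ 2.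
    apply: (@le_trans _ _ (4 * k%:R ^+ 2)).
      by rewrite ler_piMr ?mulr_ge0 ?exprn_ge0// invf_le1 ?exprn_gt0// exprn_ege1.
    by rewrite ler_wpM2l//; apply: lerXn2r; rewrite ?nnegrE ?ler0n ?(ltW NR0).
  rewrite [leRHS](_ : _ = 2 * (4 * NR ^+ 2) + 2 * NR ^+ 2); last by ring.
  by rewrite lerD2r ler_wpM2l// (le_trans h2 h3).
have hk : mean Pr (fun w => 108 * kap' k w ^+ 2 / m ^+ 4) <=
    108 / m ^+ 4 * (8 * (10 * NR ^+ 2) + 8 * tau ^+ 2).
  apply: (@le_trans _ _ (mean Pr (fun w => 108 / m ^+ 4 * (8 * t k w ^+ 2 + 8 * tau ^+ 2)))).
    apply: le_mean.
    - apply: tameM; last exact: tame_cst.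
      by apply: tameZ; apply: tameX; exact: tkap'.
    - by apply: tameZ; apply: tameD; [exact: tameZ|exact: tame_cst].
    move=> w; have /andP[k0 k1] := kap'_le w kN.
    rewrite mulrAC ler_wpM2l ?divr_ge0 ?(ltW m4)//.
    apply: (@le_trans _ _ ((2 * t k w + 2 * tau) ^+ 2)).
      by apply: lerXn2r; rewrite ?nnegrE ?(le_trans k0 k1).
    have := sqr_ge0 (t k w - tau); move: (t k w) tau => x y; rewrite !expr2; nra.
  have t1 := tameZ 8 tt2; have t2 := tame_cst Pr (8 * tau ^+ 2).
  rewrite meanZ; last exact: tameD.
  rewrite (meanD t1 t2) (mean_cst Pr) meanZ// ler_wpM2l ?divr_ge0 ?(ltW m4)//.
  by rewrite lerD2r ler_wpM2l.
apply: (@le_trans _ _ ((n%:R / NR) ^+ 4 * (108 / m ^+ 4 * (8 * (10 * NR ^+ 2) + 8 * (NR * p) ^+ 2)))).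
  rewrite ler_wpM2l ?exprn_ge0//; apply: le_trans h _; apply: le_trans hk _.
  rewrite ler_wpM2l ?divr_ge0 ?(ltW m4)// lerD2l ler_wpM2l//.
  by apply: (lerXn2r _ _ _ tau_le); rewrite nnegrE; [exact: tau_ge0|rewrite mulr_ge0// ltW].
have -> : (n%:R / NR) ^+ 4 * (108 / m ^+ 4 * (8 * (10 * NR ^+ 2) + 8 * (NR * p) ^+ 2)) =
   (n%:R / m) ^+ 4 * 108 * (80 + 8 * p ^+ 2) / NR ^+ 2.
  by field; rewrite mn0 gt_eqF.
rewrite /core_const4 !ler_wpM2r ?invr_ge0 ?exprn_ge0 ?(ltW NR0)//.
  by rewrite addr_ge0// mulr_ge0// sqr_ge0.
have q : n%:R / m <= 1 + p by rewrite ler_pdivrMr.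
by apply: lerXn2r => //; rewrite nnegrE ?addr_ge0// divr_ge0// ltW.
Qed.

Let mean_D3 k : (k < N)%N ->
  mean Pr (fun w => `|D k w| ^+ 3) <= (4 * (1 + p) ^+ 3 + core_const4) / 2 * nu / NR.
Proof.
move=> kN; have td := tD kN.
(* These weights give both terms the order nu / N, as D^2 has mean O(1 / N) and D^4 has mean O(nu^2
   / N). *)
have t1 := tameZ (nu / 2) (tameX 2 td); have t2 := tameZ (2 * nu)^-1 (tameX 4 td).
apply: (@le_trans _ _ (mean Pr (fun w => nu / 2 * D k w ^+ 2 + (2 * nu)^-1 * D k w ^+ 4))).
  apply: le_mean; [by apply: tameX; exact: tame_norm|exact: tameD|move=> w].
  have e2 : D k w ^+ 2 = `|D k w| ^+ 2 by rewrite real_normK ?num_real.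
  have e4 : D k w ^+ 4 = `|D k w| ^+ 4 by rewrite -[4%N]/(2 * 2)%N !exprM e2.
  rewrite e2 e4 -subr_ge0.
  have -> : nu / 2 * `|D k w| ^+ 2 + (2 * nu)^-1 * `|D k w| ^+ 4 - `|D k w| ^+ 3 =
     (2 * nu)^-1 * (`|D k w| * (nu - `|D k w|)) ^+ 2 by field; rewrite gt_eqF.
  by rewrite mulr_ge0 ?sqr_ge0// invr_ge0 mulr_ge0// ltW.
rewrite (meanD t1 t2) !meanZ; [|exact: tameX|exact: tameX].
have b1 : nu / 2 * mean Pr (fun w => D k w ^+ 2) <= nu / 2 * (4 * (1 + p) ^+ 3 / NR).
  by rewrite ler_wpM2l ?mean_D2// divr_ge0// ltW.
have b2 : (2 * nu)^-1 * mean Pr (fun w => D k w ^+ 4) <= (2 * nu)^-1 * (core_const4 / NR ^+ 2).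
  by rewrite ler_wpM2l ?mean_D4// invr_ge0 mulr_ge0// ltW.
apply: le_trans (lerD b1 b2) _; rewrite le_eqVlt; apply/orP; left; apply/eqP.
have -> : core_const4 / NR ^+ 2 = core_const4 * nu ^+ 2 / NR by rewrite nu2; field; rewrite gt_eqF.
by field; rewrite !gt_eqF.
Qed.

Hypothesis Past_comp : forall k (g : R -> R) f, continuous g -> Past k f -> Past k (g \o f).

Let S k w := \sum_(i < k) D i w.

Let tS k : (k <= N)%N -> tame Pr (S k).
Proof.
elim: k => [|k ih] kN.
  by apply: (eq_tame (tame_cst Pr 0)) => w; rewrite /S big_ord0.
apply: (eq_tame (tameD (ih (ltnW kN)) (tD kN))) => w.
by rewrite /S big_ord_recr.
Qed.

Let pS j k : (j <= k)%N -> (k < N)%N -> Past k (S j).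
Proof.
move=> + kN; elim: j => [|j ih] jk.
  rewrite (_ : S 0 = (fun=> 0)); first exact: Past_cst.
  by apply/funext => w; rewrite /S big_ord0.
rewrite (_ : S j.+1 = (fun w => S j w + D j w)); last first.
  by apply/funext => w; rewrite /S big_ord_recr.
have [_ PD PM] := PA k.
apply: PD; first exact: ih (ltnW jk).
apply: PM; first exact: Past_cst.
apply: (algebra_trace (PA k)); apply: (entriesM (PA k)); last exact: pM' (ltnW jk) kN.
apply: (entriesB (PA k) _ (entries_cst (PA k) _)); apply: pastA => //.
- exact: ltn_trans kN.
- by rewrite neq_ltn jk.
Qed.

Definition core_const : R :=
  core_const1 + 1 + (4 * (1 + p) ^+ 3 + core_const4) / 2 + 4 * heat_const R.

(* Summing the N error terms: L1 error of the conditional variance, third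
   moments (by AM-GM from moments 2 and 4), and smoothing errors. *)
Lemma core_bound (Af : R) f f1 f2 : smooth3 Af f f1 f2 ->
  `|mean Pr (fun w => f (S N w)) - mean (normal_prob 0 1) f| <=
  Af * core_const * (eta + nu).
Proof.
move=> sf; have A0 := smooth3_ge0 sf.
(* The variance left after k steps: the sum of (2 j + 1) / N^2 over k <= j < N is 1 - k^2 / N^2. *)
pose b (k : nat) : R := Num.sqrt (1 - k%:R ^+ 2 / NR ^+ 2).
have NR2 : 0 < NR ^+ 2 by rewrite exprn_gt0.
have := @lindeberg _ Om R Pr Af f f1 f2 sf S D V v b N.
move=> /(_ (fun k kN => tame_measurable (tS (ltnW kN))) tD tV) => H.
apply: le_trans (H _ _ _ _ _ _ _ _) _ => {H}.
- by move=> w; rewrite /S big_ord0.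
- by move=> k w _; rewrite /S big_ord_recr.
- by move=> k; exact: sqrtr_ge0.
- move=> k; apply: ler_wsqrtr; rewrite lerB// ler_wpM2r ?invr_ge0 ?(ltW NR2)//.
  by apply: lerXn2r; rewrite ?nnegrE ?ler_nat.
- move=> k kN; have h j : (j <= N)%N -> 0 <= 1 - j%:R ^+ 2 / NR ^+ 2.
    move=> jN; rewrite subr_ge0 ler_pdivrMr// mul1r.
    by apply: lerXn2r; rewrite ?nnegrE ?ler_nat// /NR ler_nat.
  rewrite /b !sqr_sqrtr ?h ?(ltnW kN)// /v -natr1; field.
  by rewrite gt_eqF.
- by rewrite /b expr0n mul0r subr0 sqrtr1.
- by rewrite /b divff ?gt_eqF// subrr sqrtr0.
- move=> k g kN cg gA; apply: mean_gD => //; first exact: (Past_comp cg (pS (leqnn k) kN)).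
  apply: (@tame_bounded_comp _ _ R Pr Af g (S k)) => //.
  exact: tame_measurable (tS (ltnW kN)).
have hc0 := heat_const_ge0 R.
have C10 : 0 <= core_const1.
  by rewrite /core_const1 !addr_ge0 ?mulr_ge0 ?addr_ge0 ?mulr_ge0 ?sqr_ge0 ?divr_ge0.
have C20 : 0 <= (4 * (1 + p) ^+ 3 + core_const4) / 2.
  rewrite /core_const4 divr_ge0// addr_ge0 ?mulr_ge0 ?exprn_ge0 ?addr_ge0//.
  by rewrite mulr_ge0// sqr_ge0.
apply: (@le_trans _ _ (\sum_(k < N) (Af * core_const * (eta + nu)) / NR)); last first.
  rewrite sumr_const card_ord -mulr_natr -/NR divfK// gt_eqF//.
apply: ler_sum => k _; have kN := ltn_ord k.
have v0 : 0 <= v k by rewrite /v divr_ge0 ?(ltW NR2)// addr_ge0// mulr_ge0.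
have v1 : v k <= 2 / NR.
  rewrite /v ler_pdivrMr// (_ : 2 / NR * NR ^+ 2 = 2 * NR); last by field; rewrite gt_eqF.
  have : k%:R + 1 <= NR by rewrite natr1 /NR ler_nat.
  by have := ler0n R k; lra.
have v2 : Num.sqrt (v k) <= 2 * nu.
  rewrite -[leRHS]ger0_norm ?mulr_ge0 ?(ltW nu0)// -sqrtr_sqr; apply: ler_wsqrtr.
  apply: le_trans v1 _; rewrite exprMn nu2 ler_wpM2r ?invr_ge0 ?(ltW NR0)//.
  by rewrite -natrX ler_nat.
have b1 := mean_V kN; have b2 := mean_D3 kN.
have b3 : v k * Num.sqrt (v k) <= 4 * nu / NR.
  apply: le_trans (ler_pM v0 (sqrtr_ge0 _) v1 v2) _.
  by rewrite le_eqVlt; apply/orP; left; apply/eqP; ring.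
apply: (@le_trans _ _ (Af / 2 * ((core_const1 * eta + nu) / NR) +
   Af * ((4 * (1 + p) ^+ 3 + core_const4) / 2 * nu / NR) + heat_const R * Af * (4 * nu / NR))).
  apply: lerD; last by rewrite ler_wpM2l// mulr_ge0.
  by apply: lerD; rewrite ler_wpM2l// divr_ge0.
rewrite /core_const; move: C10 C20; move: core_const1 ((4 * _ + _) / 2) => C1 C2 C10 C20.
rewrite -subr_ge0.
have -> : Af * (C1 + 1 + C2 + 4 * heat_const R) * (eta + nu) / NR -
  (Af / 2 * ((C1 * eta + nu) / NR) + Af * (C2 * nu / NR) + heat_const R * Af * (4 * nu / NR)) =
  Af / NR * (C1 / 2 * eta + eta + C2 * eta + 4 * heat_const R * eta + C1 * nu + nu / 2).
  by field; rewrite gt_eqF.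
have e0 := ltW eta0; have n0 := ltW nu0.
apply: mulr_ge0; first by rewrite divr_ge0// ltW.
by repeat (assumption || apply: addr_ge0 || apply: mulr_ge0 || done).
Qed.

End martingale_core.

(** * Spline test functions *)

Lemma smooth3_affine (R : realType) (A : R) f f1 f2 a b :
  smooth3 A f f1 f2 ->
  smooth3 (A * (1 + `|a|) ^+ 3) (fun x => f (a * x + b)) (fun x => a * f1 (a * x + b))
    (fun x => a ^+ 2 * f2 (a * x + b)).
Proof.
move=> sf; have A0 := smooth3_ge0 sf; case: sf => b01 b2 t0 t1 t2.
have c1 : 1 <= 1 + `|a| by rewrite lerDl.
have ca : `|a| <= 1 + `|a| by rewrite lerDr.
have p1 n : (n <= 3)%N -> `|a| ^+ n <= (1 + `|a|) ^+ 3.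
  move=> n3; apply: (@le_trans _ _ ((1 + `|a|) ^+ n)); last exact: ler_weXn2l.
  by apply: lerXn2r; rewrite ?nnegrE ?addr_ge0.
have q n y z : (n <= 3)%N -> y <= A * z -> 0 <= z -> `|a| ^+ n * y <= A * (1 + `|a|) ^+ 3 * z.
  move=> n3 yz z0; apply: (@le_trans _ _ (`|a| ^+ n * (A * z))).
    by rewrite ler_wpM2l// exprn_ge0.
  by rewrite mulrCA -mulrA ler_wpM2l// ler_wpM2r// p1.
have q1 n y : (n <= 3)%N -> y <= A -> `|a| ^+ n * y <= A * (1 + `|a|) ^+ 3.
  by move=> n3 yA; rewrite -[leRHS]mulr1; apply: q => //; rewrite mulr1.
have ar x h : a * (x + h) + b = (a * x + b) + a * h by ring.
have n2 : a ^+ 2 = `|a| ^+ 2 by rewrite real_normK ?num_real.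
split.
- move=> x; have [h0 h1] := b01 (a * x + b); split.
    by rewrite -[leLHS]mul1r -[1](expr0 `|a|); exact: q1.
  by rewrite normrM -[X in X * _]expr1; exact: q1.
- by move=> x; rewrite normrM normrX; exact: q1.
- move=> x h; rewrite ar.
  rewrite (_ : _ - a ^+ 2 * _ * _ / 2 = f (a * x + b + a * h) - f (a * x + b) - f1 (a * x + b) * (a * h) - f2 (a * x + b) * (a * h) ^+ 2 / 2); last by ring.
  apply: le_trans (t0 _ _) _; rewrite normrM exprMn mulrCA.
  by apply: q => //; rewrite exprn_ge0.
- move=> x h; rewrite ar.
  rewrite (_ : _ - _ * h = a * (f1 (a * x + b + a * h) - f1 (a * x + b) - f2 (a * x + b) * (a * h))); last by ring.
  rewrite normrM; apply: (@le_trans _ _ (`|a| * (A * (a * h) ^+ 2))).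
    by rewrite ler_wpM2l.
  rewrite exprMn n2 [leLHS](_ : _ = `|a| ^+ 3 * (A * h ^+ 2)); last by ring.
  by apply: q => //; exact: sqr_ge0.
- move=> x h; rewrite ar -mulrBr normrM normrX.
  apply: (@le_trans _ _ (`|a| ^+ 2 * (A * `|a * h|))).
    by rewrite ler_wpM2l ?exprn_ge0.
  rewrite normrM [leLHS](_ : _ = `|a| ^+ 3 * (A * `|h|)); last by ring.
  exact: q.
Qed.

Section smooth_step.
Variable R : realType.
Implicit Types x h y : R.

(* The integral of the quadratic B-spline with knots 0, 1, 2, 3. *)
Definition cubic_pos y : R := if 0 <= y then y ^+ 3 else 0.
Definition square_pos y : R := if 0 <= y then y ^+ 2 else 0.
Definition linear_pos y : R := if 0 <= y then y else 0.

Definition smooth_step y : R :=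
  (cubic_pos y - 3 * cubic_pos (y - 1) + 3 * cubic_pos (y - 2) - cubic_pos (y - 3)) / 6.
Definition smooth_step1 y : R :=
  (square_pos y - 3 * square_pos (y - 1) + 3 * square_pos (y - 2) - square_pos (y - 3)) / 2.
Definition smooth_step2 y : R :=
  linear_pos y - 3 * linear_pos (y - 1) + 3 * linear_pos (y - 2) - linear_pos (y - 3).

Lemma cubic_pos_taylor x h :
  `|cubic_pos (x + h) - cubic_pos x - 3 * square_pos x * h - 3 * linear_pos x * h ^+ 2| <= `|h| ^+ 3.
Proof.
rewrite -normrX /cubic_pos /square_pos /linear_pos.
case: (lerP 0 x) => x0; case: (lerP 0 (x + h)) => y0.
- by rewrite le_eqVlt; apply/orP; left; apply/eqP; congr (`|_|); ring.
- rewrite (_ : _ - _ = h ^+ 3 - (x + h) ^+ 3); last by ring.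
  have [h0 y1] : h <= 0 /\ h <= x + h by split; lra.
  have : h ^+ 3 <= (x + h) ^+ 3 by rewrite -subr_ge0; have := sqr_ge0 (x + h); have := sqr_ge0 h; nra.
  have : (x + h) ^+ 3 <= 0 by rewrite exprn_odd_le0 ?ltW.
  by move=> u v; rewrite [leLHS]ler0_norm ?[leRHS]ler0_norm; lra.
- rewrite (_ : _ - _ = (x + h) ^+ 3); last by ring.
  by rewrite !normrX; apply: lerXn2r; rewrite ?nnegrE ?normr_ge0// !ger0_norm; lra.
- by rewrite !(mulr0, mul0r, subr0) normr0.
Qed.

Lemma square_pos_taylor x h :
  `|square_pos (x + h) - square_pos x - 2 * linear_pos x * h| <= h ^+ 2.
Proof.
rewrite /square_pos /linear_pos ler_norml.
by case: (lerP 0 x) => x0; case: (lerP 0 (x + h)) => y0; apply/andP; split; have := sqr_ge0 h; have := sqr_ge0 (x + h); nra.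
Qed.

Lemma pos_lipschitz x h : `|linear_pos (x + h) - linear_pos x| <= `|h|.
Proof.
rewrite /linear_pos.
case: (lerP 0 x) => x0; case: (lerP 0 (x + h)) => y0; rewrite ler_norml; case: (ger0P h) => h0;
 apply/andP; split; lra.
Qed.

Lemma smooth_step_le0 y : y <= 0 -> smooth_step y = 0.
Proof.
move=> y0; rewrite /smooth_step /cubic_pos.
have h1 : (0 <= y - 1) = false by apply/negbTE; rewrite -ltNge; lra.
have h2 : (0 <= y - 2) = false by apply/negbTE; rewrite -ltNge; lra.
have h3 : (0 <= y - 3) = false by apply/negbTE; rewrite -ltNge; lra.
rewrite h1 h2 h3.
case: (lerP 0 y) => h0; last by lra.
by rewrite (le_anti (introT andP (conj y0 h0))) expr0n /=; lra.
Qed.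

(** What linear arithmetic needs about t, t^2 and t^3 to bound the pieces of the spline; the last
    inequality is (1 - t)^2 (1 + 2 t) >= 0. *)
Let powers (t : R) : 0 <= t -> t <= 1 -> [/\ 0 <= t ^+ 2, t ^+ 2 <= t, 0 <= t ^+ 3, t ^+ 3 <= t ^+ 2 & 3 * t ^+ 2 - 2 * t ^+ 3 <= 1].
Proof.
move=> t0 t1; split; rewrite ?exprn_ge0// ?[t ^+ 3]exprS ?expr2 ?ler_piMr// ?ler_piMl ?mulr_ge0//.
have : 0 <= (1 - t) ^+ 2 * (1 + 2 * t) by rewrite mulr_ge0 ?sqr_ge0//; lra.
by rewrite expr2; lra.
Qed.

Lemma smooth_step_bounds y : 0 <= smooth_step y <= 1.
Proof.
case: (lerP y 0) => y0; first by rewrite smooth_step_le0// lexx ler01.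
rewrite /smooth_step /cubic_pos (ltW y0).
case: (lerP 0 (y - 1)) => h1; last first.
  have h2 : (0 <= y - 2) = false by apply/negbTE; rewrite -ltNge; lra.
  have h3 : (0 <= y - 3) = false by apply/negbTE; rewrite -ltNge; lra.
  have [|? ? ? ? ?] := powers (ltW y0); first lra.
  by rewrite h2 h3; apply/andP; split; lra.
case: (lerP 0 (y - 2)) => h2; last first.
  have h3 : (0 <= y - 3) = false by apply/negbTE; rewrite -ltNge; lra.
  have [|? ? ? ? ?] := powers h1; first lra.
  by rewrite h3; apply/andP; split; lra.
case: (lerP 0 (y - 3)) => h3; first by apply/andP; split; lra.
by have [||? ? ? ? ?] := @powers (3 - y); lra.
Qed.

Lemma smooth_step_ge3 y : 3 <= y -> smooth_step y = 1.
Proof.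
move=> y3; rewrite /smooth_step /cubic_pos !ifT; lra.
Qed.

Lemma smooth_step1_bounds y : `|smooth_step1 y| <= 2.
Proof.
rewrite ler_norml /smooth_step1 /square_pos.
case: (lerP 0 y) => h0; last first.
  have h1 : (0 <= y - 1) = false by apply/negbTE; rewrite -ltNge; lra.
  have h2 : (0 <= y - 2) = false by apply/negbTE; rewrite -ltNge; lra.
  have h3 : (0 <= y - 3) = false by apply/negbTE; rewrite -ltNge; lra.
  by rewrite h1 h2 h3; apply/andP; split; lra.
case: (lerP 0 (y - 1)) => h1; last first.
  have h2 : (0 <= y - 2) = false by apply/negbTE; rewrite -ltNge; lra.
  have h3 : (0 <= y - 3) = false by apply/negbTE; rewrite -ltNge; lra.
  have [|? ? ? ? ?] := powers h0; first lra.
  by rewrite h2 h3; apply/andP; split; lra.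
case: (lerP 0 (y - 2)) => h2; last first.
  have h3 : (0 <= y - 3) = false by apply/negbTE; rewrite -ltNge; lra.
  have [|? ? ? ? ?] := powers h1; first lra.
  by rewrite h3; apply/andP; split; lra.
case: (lerP 0 (y - 3)) => h3; first by apply/andP; split; lra.
by have [||? ? ? ? ?] := @powers (3 - y); lra.
Qed.

Lemma smooth_step2_bounds y : `|smooth_step2 y| <= 2.
Proof.
rewrite ler_norml /smooth_step2 /linear_pos.
case: (lerP 0 y) => h0; last first.
  have h1 : (0 <= y - 1) = false by apply/negbTE; rewrite -ltNge; lra.
  have h2 : (0 <= y - 2) = false by apply/negbTE; rewrite -ltNge; lra.
  have h3 : (0 <= y - 3) = false by apply/negbTE; rewrite -ltNge; lra.
  by rewrite h1 h2 h3; apply/andP; split; lra.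
case: (lerP 0 (y - 1)) => h1; last first.
  have h2 : (0 <= y - 2) = false by apply/negbTE; rewrite -ltNge; lra.
  have h3 : (0 <= y - 3) = false by apply/negbTE; rewrite -ltNge; lra.
  have [|? ? ? ? ?] := powers h0; first lra.
  by rewrite h2 h3; apply/andP; split; lra.
case: (lerP 0 (y - 2)) => h2; last first.
  have h3 : (0 <= y - 3) = false by apply/negbTE; rewrite -ltNge; lra.
  have [|? ? ? ? ?] := powers h1; first lra.
  by rewrite h3; apply/andP; split; lra.
case: (lerP 0 (y - 3)) => h3; first by apply/andP; split; lra.
by have [||? ? ? ? ?] := @powers (3 - y); lra.
Qed.

(** Third differences have coefficients 1, 3, 3, 1 in absolute value, of sum 8. The three Taylor
    clauses hold with 8 / 6, 8 / 2 and 8, all covered by 8. *)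
Lemma smooth3_smooth_step : smooth3 8 smooth_step smooth_step1 smooth_step2.
Proof.
split.
- move=> x; split; last by apply: le_trans (smooth_step1_bounds x) _; lra.
  by have /andP[a b] := smooth_step_bounds x; rewrite ger0_norm//; lra.
- by move=> x; apply: le_trans (smooth_step2_bounds x) _; lra.
- move=> x h.
  have := cubic_pos_taylor (x - 3) h; have := cubic_pos_taylor (x - 2) h.
  have := cubic_pos_taylor (x - 1) h; have := cubic_pos_taylor x h.
  rewrite /smooth_step /smooth_step1 /smooth_step2 ![x - _ + h]addrAC !ler_norml.
  move=> /andP[a1 b1] /andP[a2 b2] /andP[a3 b3] /andP[a4 b4].
  have : 0 <= `|h| ^+ 3 by rewrite exprn_ge0.
  by move=> h0; apply/andP; split; lra.
- move=> x h.
  have := square_pos_taylor (x - 3) h; have := square_pos_taylor (x - 2) h.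
  have := square_pos_taylor (x - 1) h; have := square_pos_taylor x h.
  rewrite /smooth_step1 /smooth_step2 ![x - _ + h]addrAC !ler_norml.
  move=> /andP[a1 b1] /andP[a2 b2] /andP[a3 b3] /andP[a4 b4].
  have := sqr_ge0 h.
  by move=> h0; apply/andP; split; lra.
- move=> x h.
  have := pos_lipschitz (x - 3) h; have := pos_lipschitz (x - 2) h.
  have := pos_lipschitz (x - 1) h; have := pos_lipschitz x h.
  rewrite /smooth_step2 ![x - _ + h]addrAC !ler_norml.
  move=> /andP[a1 b1] /andP[a2 b2] /andP[a3 b3] /andP[a4 b4].
  have : 0 <= `|h| by [].
  by move=> h0; apply/andP; split; lra.
Qed.

End smooth_step.

(** * From smooth test functions to distribution functions *)

Section sandwich.
Context d (Om : measurableType d) (R : realType) (P : probability Om R).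
Variables (Y : Om -> measurableTypeR R) (g : R -> R) (a C : R).
Hypotheses (mY : measurable_fun setT Y) (cg : continuous g) (gC : forall y, `|g y| <= C).

Let mB : measurable (Y @^-1` [set` `]-oo, a]]).
Proof. by rewrite -[X in measurable X]setTI; apply: mY => //; exact: measurable_itv. Qed.

Let probE : fine (P (Y @^-1` [set` `]-oo, a]])) = mean P (\1_(Y @^-1` [set` `]-oo, a]])).
Proof. by rewrite /mean /Rintegral integral_indic// setIT. Qed.

Let tame_indic : tame P (\1_(Y @^-1` [set` `]-oo, a]])).
Proof.
apply: (@tame_bounded _ _ _ _ _ 1); first exact: measurable_indic.
by move=> w; rewrite indicE; case: (_ \in _); rewrite ?normr1// normr0.
Qed.

Let tame_g : tame P (fun w => g (Y w)).
Proof. exact: (@tame_bounded_comp _ _ R P C g Y). Qed.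

Lemma prob_le_mean : (forall y, y <= a -> 1 <= g y) -> (forall y, 0 <= g y) ->
  fine (P (Y @^-1` [set` `]-oo, a]])) <= mean P (fun w => g (Y w)).
Proof.
move=> g1 g0; rewrite probE; apply: le_mean => // w; rewrite indicE.
case: (boolP (_ \in _)) => [|_]; last exact: g0.
by rewrite inE/= in_itv/= => h; exact: g1.
Qed.

Lemma mean_le_prob : (forall y, g y <= 1) -> (forall y, a < y -> g y <= 0) ->
  mean P (fun w => g (Y w)) <= fine (P (Y @^-1` [set` `]-oo, a]])).
Proof.
move=> g1 g0; rewrite probE; apply: le_mean => // w; rewrite indicE.
case: (boolP (_ \in _)) => [_|]; first exact: g1.
by rewrite notin_setE/= in_itv/= => /negP; rewrite -ltNge => h; exact: g0.
Qed.

End sandwich.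

(** The indicator of ]-oo, r] lies between smooth steps descending over [r - h, r] and over
    [r, r + h]. Continuity of the limit distribution function at r supplies an h for which the two
    limits are within e / 2 of its value, and the test-function limits cost another e / 2. *)
Lemma cvg_in_distribution_smooth3 (R : realType) (d : nat -> measure_display)
    (Om : forall n, measurableType (d n)) (Pr : forall n, probability (Om n) R)
    (X : forall n, Om n -> R) (mu : probability (measurableTypeR R) R) :
  (forall n, measurable_fun [set: Om n] (X n)) ->
  (forall A f f1 f2, smooth3 A f f1 f2 ->
     mean (Pr n) (fun w => f (X n w)) @[n --> \oo] --> mean mu f) ->
  cvg_in_distribution Pr X mu.
Proof.
move=> mX cX; split=> // r cr.
pose F s := mu [set` `]-oo, s]].
have Ffin s : F s \is a fin_num by rewrite fin_num_measure//; exact: measurable_itv.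
have cF : fine (F s) @[s --> r] --> fine (F r).
  by apply: fine_cvg; rewrite fineK.
rewrite -/(F r) -(fineK (Ffin r)).
rewrite (_ : (fun n => _) = (fun n => (fine (Pr n (X n @^-1` `]-oo, r])))%:E)); last first.
  apply/funext => n; rewrite fineK// fin_num_measure//.
  rewrite -[X in measurable X]setTI; apply: (mX n) => //; exact: measurable_itv.
apply: cvg_EFin; first by near=> n.
apply/cvgrPdist_le => /= e e0.
have e20 : 0 < e / 2 by rewrite divr_gt0.
move/cvgrPdist_le : cF => /(_ _ e20) /nbhs_ballP [h0 /= h00 cF].
pose h := h0 / 2; have hp : 0 < h by rewrite divr_gt0.
have hp0 : h != 0 by rewrite gt_eqF.
have Fr : fine (F (r + h)) <= fine (F r) + e / 2.
  have : ball r h0 (r + h).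
    by rewrite /ball/= opprD addrA subrr sub0r normrN gtr0_norm// /h; lra.
  by move=> /cF/=; rewrite ler_norml => /andP[? ?]; lra.
have Fl : fine (F r) - e / 2 <= fine (F (r - h)).
  have : ball r h0 (r - h).
    by rewrite /ball/= opprB addrCA subrr addr0 gtr0_norm// /h; lra.
  by move=> /cF/=; rewrite ler_norml => /andP[? ?]; lra.
(* [smooth_step] of 3 (b - x) / h, in the affine form required by [smooth3_affine]: it is 1 up to b
   - h and 0 from b on. *)
pose f b x := smooth_step (- (3 / h) * x + 3 * b / h).
have fE b x : f b x = smooth_step (3 * (b - x) / h) by rewrite /f; congr smooth_step; field.
have sf b := smooth3_affine (- (3 / h)) (3 * b / h) (@smooth3_smooth_step R).
have cf b : continuous (f b) by have [] := smooth3_continuous (sf b).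
have f01 b y : 0 <= f b y <= 1 by exact: smooth_step_bounds.
have fC b y : `|f b y| <= 1 by have /andP[? ?] := f01 b y; rewrite ger0_norm.
have fb b y : b < y -> f b y <= 0.
  move=> by'; rewrite fE smooth_step_le0// ler_pdivrMr// mul0r; lra.
have fb1 b y : y <= b - h -> 1 <= f b y.
  by move=> yb; rewrite fE smooth_step_ge3// ler_pdivlMr//; lra.
have limf b := cX _ _ _ _ (sf b).
have /cvgrPdist_le l1 := limf (r + h); have /cvgrPdist_le l2 := limf r.
have muf b : mean mu (f b) <= fine (F b).
  apply: (@mean_le_prob _ _ R mu id (f b) b 1) => //; last exact: fb.
  by move=> y; have /andP[] := f01 b y.
have muf1 b : fine (F (b - h)) <= mean mu (f b).
  apply: (@prob_le_mean _ _ R mu id (f b) (b - h) 1) => //; first exact: fb1.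
  by move=> y; have /andP[] := f01 b y.
near=> n.
have u1 : `|mean mu (f (r + h)) - mean (Pr n) (fun w => f (r + h) (X n w))| <= e / 2.
  near: n; exact: l1.
have u2 : `|mean mu (f r) - mean (Pr n) (fun w => f r (X n w))| <= e / 2.
  near: n; exact: l2.
have w1 : fine (Pr n (X n @^-1` `]-oo, r])) <= mean (Pr n) (fun w => f (r + h) (X n w)).
  apply: (@prob_le_mean _ _ R (Pr n) (X n) (f (r + h)) r 1) => //.
    - exact: mX.
    - by move=> y yr; apply: fb1; rewrite addrK.
    - by move=> y; have /andP[] := f01 (r + h) y.
have w2 : mean (Pr n) (fun w => f r (X n w)) <= fine (Pr n (X n @^-1` `]-oo, r])).
  apply: (@mean_le_prob _ _ R (Pr n) (X n) (f r) r 1) => //; [exact: mX| |exact: fb].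
  by move=> y; have /andP[] := f01 r y.
have := muf (r + h); have := muf1 r.
move: u1 u2 w1 w2; rewrite !ler_norml => /andP[? ?] /andP[? ?] ? ? ? ?.
by apply/andP; split; lra.
Unshelve. all: by end_near. Qed.

(** * Algebra of the statistic: correlations as traces and the martingale decomposition *)

Lemma big_offdiag (R : nmodType) N (G : 'I_N -> 'I_N -> R) :
  \sum_i \sum_(j | j != i) G i j =
  \sum_(i < N) \sum_(j < N | (j < i)%N) (G i j + G j i).
Proof.
transitivity (\sum_(i < N) (\sum_(j < N | (j < i)%N) G i j + \sum_(j < N | (i < j)%N) G i j)).
  apply: eq_bigr => /= i _; rewrite (bigID (fun j : 'I_N => (j < i)%N))/=; congr (_ + _).
    by apply: eq_bigl => j; rewrite -(inj_eq val_inj)/= neq_ltn; case: (ltngtP j i).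
  by apply: eq_bigl => j; rewrite -(inj_eq val_inj)/= neq_ltn; case: (ltngtP j i).
rewrite big_split/=; under [RHS]eq_bigr do rewrite big_split/=.
rewrite big_split/=; congr (_ + _).
by rewrite (exchange_big_dep xpredT).
Qed.

Lemma mxtrace_outer (R : comPzRingType) n (a b : 'cV[R]_n) :
  \tr (a *m a^T *m (b *m b^T)) = ((a^T *m b) 0 0) ^+ 2.
Proof.
rewrite -mulmxA (mulmxA a^T) {1}[a^T *m b]mx11_scalar mul_scalar_mx -scalemxAr.
rewrite mxtraceZ mxtrace_mulC expr2; congr (_ * _).
by rewrite -mxtrace_tr trmx_mul trmxK trace_mx11.
Qed.

Lemma enorm_proj_sqr (R : realType) n (Q : 'M[R]_n) (e : 'cV[R]_n) :
  Q^T = Q -> Q *m Q = Q -> enorm (Q *m e) ^+ 2 = qform Q e.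
Proof.
move=> QT QQ; rewrite /enorm sqr_sqrtr; last by apply: sumr_ge0 => k _; exact: sqr_ge0.
have := qform_proj_mulmx QT QQ e => /matrixP/(_ 0 0).
rewrite !mxE mulr1n => <-; apply: eq_bigr => k _.
by rewrite expr2 !mxE.
Qed.

(** The 0-1 factors reconcile two conventions: when a residual vanishes [resid_corr] is 0, while
    [direction_mx] is still a rank-one projection. Keeping them gives measurability everywhere; off
    a null event they are 1. *)
Lemma resid_corr_sqr (R : realType) n (Q1 Q2 : 'M[R]_n) (u1 u2 e1 e2 : 'cV[R]_n) :
  Q1^T = Q1 -> Q1 *m Q1 = Q1 -> Q2^T = Q2 -> Q2 *m Q2 = Q2 ->
  resid_corr Q1 Q2 e1 e2 ^+ 2 = (if qform Q1 e1 == 0 then 0 else 1) *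
    ((if qform Q2 e2 == 0 then 0 else 1) *
     \tr (direction_mx Q1 u1 e1 *m direction_mx Q2 u2 e2)).
Proof.
move=> Q1T Q11 Q2T Q22; rewrite /resid_corr expr_div_n exprMn !enorm_proj_sqr//.
have [->|r1] := eqVneq (qform Q1 e1) 0; first by rewrite !mul0r invr0 mulr0.
have [->|r2] := eqVneq (qform Q2 e2) 0; first by rewrite mulr0 invr0 !mul0r !mulr0.
rewrite !mul1r /direction_mx (negbTE r1) (negbTE r2) -scalemxAl -scalemxAr !mxtraceZ mxtrace_outer.
rewrite invfM mulrC -mulrA; congr (_ * (_ * _)).
by rewrite trmx_mul Q1T !mulmxA.
Qed.

Lemma sum_le_card (R : realDomainType) N (P : pred 'I_N) (F : 'I_N -> R) c :
  0 <= c -> (forall i, P i -> F i <= c) -> \sum_(i | P i) F i <= N%:R * c.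
Proof.
move=> c0 Fc; apply: (@le_trans _ _ (\sum_(i < N) c)).
  by rewrite [leLHS]big_mkcond; apply: ler_sum => i _; case: ifP => // /Fc.
by rewrite sumr_const card_ord mulr_natl.
Qed.

(** Each of the at most N^2 products of complements has trace p - tr ((1 - Q_i) Q_j) <= p. *)
Lemma mxtrace_complement_sqr (R : realFieldType) N n (P : pred 'I_N) (Q : 'I_N -> 'M[R]_n) (m p : R) :
  (forall i, (Q i)^T = Q i) -> (forall i, Q i *m Q i = Q i) -> (forall i, \tr (Q i) = m) ->
  n%:R = m + p -> 0 <= p ->
  \tr ((\sum_(i | P i) (1%:M - Q i)) *m (\sum_(i | P i) (1%:M - Q i))) <= N%:R ^+ 2 * p.
Proof.
move=> QT QQ trQ nE p0.
have h i j : \tr ((1%:M - Q i) *m (1%:M - Q j)) <= p.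
  rewrite mulmxBr mulmx1 mxtraceB mxtraceB trQ mxtrace1 nE (_ : m + p - m = p); last by ring.
  rewrite gerBl.
  apply: mxtrace_proj_ge0 => //; first by rewrite linearB/= trmx1 QT.
  by rewrite mulmxBl !mulmxBr !mulmx1 mul1mx QQ subrr subr0.
rewrite mulmx_suml linear_sum/= expr2 -mulrA; apply: sum_le_card => [|i _]; first exact: mulr_ge0.
by rewrite mulmx_sumr linear_sum/=; apply: sum_le_card.
Qed.

(* Since tr (B i) = 0, replacing Q j by 1 - Q j in the cross terms only changes
   the sign, and 1 - Q j has the small rank p. *)
Lemma martingale_decomposition (R : fieldType) N n (A Q : 'I_N -> 'M[R]_n) (m : R) :
  (forall i, \tr (A i) = 1) -> (forall i, \tr (Q i) = m) -> m != 0 ->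
  \sum_i \tr ((A i - m^-1 *: Q i) *m
    (\sum_(j < N | (j < i)%N) (A j - m^-1 *: Q j) - m^-1 *: \sum_(j | j != i) (1%:M - Q j))) =
  \sum_(i < N) \sum_(j < N | (i < j)%N) \tr (A i *m A j) -
  m^-1 ^+ 2 * \sum_(i < N) \sum_(j < N | (i < j)%N) \tr (Q i *m Q j).
Proof.
move=> trA trQ mn0.
transitivity (\sum_(i < N) (\sum_(j < N | (j < i)%N) \tr ((A i - m^-1 *: Q i) *m (A j - m^-1 *: Q j)) +
    \sum_(j | j != i) (m^-1 * \tr ((A i - m^-1 *: Q i) *m Q j)))).
  apply: eq_bigr => i _; rewrite mulmxBr mxtraceB; congr (_ + _).
    by rewrite mulmx_sumr linear_sum.
  rewrite -scalemxAr mxtraceZ mulmx_sumr linear_sum/= mulr_sumr -sumrN.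
  apply: eq_bigr => j _; rewrite mulmxBr mulmx1 mxtraceB [\tr (A i - _)]mxtraceB.
  by rewrite mxtraceZ trA trQ mulVf// subrr sub0r mulrN opprK.
rewrite big_split/= big_offdiag -big_split/= mulr_sumr.
rewrite (exchange_big_dep xpredT)//= [X in _ = _ - X](_ : _ =
   \sum_(i < N) \sum_(j < N | (j < i)%N) m^-1 ^+ 2 * \tr (Q i *m Q j)); last first.
  under eq_bigr do rewrite mulr_sumr.
  rewrite (exchange_big_dep xpredT)//=; apply: eq_bigr => i _; apply: eq_bigr => j _.
  by rewrite [\tr (Q i *m _)]mxtrace_mulC.
rewrite -sumrB; apply: eq_bigr => i _; rewrite -sumrB -big_split/=; apply: eq_bigr => j _.
rewrite !mulmxBl !mulmxBr -!scalemxAl -!scalemxAr !mxtraceB !mxtraceZ.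
rewrite [\tr (A j *m A i)]mxtrace_mulC [\tr (Q j *m Q i)]mxtrace_mulC.
rewrite [\tr (Q i *m A j)]mxtrace_mulC; ring.
Qed.

Lemma measurable_sum_cond d (S : measurableType d) (R : realType) (I : Type)
    (r : seq I) (P : pred I) (F : I -> S -> R) :
  (forall i, P i -> measurable_fun setT (F i)) ->
  measurable_fun setT (fun w => \sum_(i <- r | P i) F i w).
Proof.
move=> mF.
rewrite (_ : (fun w => _) = (fun w => \sum_(i <- r) if P i then F i w else 0)).
  apply: measurable_sumr => i; case: (P i) (mF i) => mFi; first exact: mFi.
  exact: measurable_cst.
by apply/funext => w; rewrite big_mkcond.
Qed.

Lemma measurable_mean_section d1 d2 (S1 : measurableType d1) (S2 : measurableType d2)
    (R : realType) (P : probability S2 R) (F : S1 * S2 -> R) :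
  measurable_fun setT F -> (forall z, 0 <= F z) ->
  measurable_fun setT (fun x => mean P (fun y => F (x, y))).
Proof.
move=> mF F0; apply: (measurableT_comp (@fine_measurable R setT measurableT)).
apply: (@measurable_fun_fubini_tonelli_F _ _ S1 S2 R P (EFin \o F)).
  exact/measurable_EFinP.
by move=> z /=; rewrite lee_fin.
Qed.

(** * Gaussian residuals satisfy the assumptions of the martingale argument *)

Section residual_design.
Context d (Om : measurableType d) (R : realType) (Pr : probability Om R) (n N : nat).
Variables (e : 'I_N -> {RV Pr >-> n.-tuple R}) (s : 'I_N -> R).
Hypotheses (s0 : forall i, 0 < s i) (he : forall i, multinormal_law (e i) 0 (s i ^+ 2)%:M).
Hypothesis ind : mutually_independent e.
Variables (Q : 'I_N -> 'M[R]_n) (u : 'I_N -> 'cV[R]_n) (m p : R).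
Hypotheses (QT : forall i, (Q i)^T = Q i) (QQ : forall i, Q i *m Q i = Q i)
  (Qu : forall i, Q i *m u i = u i) (uu : forall i, (u i)^T *m u i = 1%:M)
  (trQ : forall i, \tr (Q i) = m).
Hypotheses (m1 : 1 <= m) (p0 : 0 <= p) (nE : n%:R = m + p).
Hypotheses (N0 : (0 < N)%N) (Nm : N%:R <= m ^+ 2).

Let m0 : 0 < m. Proof. exact: lt_le_trans m1. Qed.
Let E := n.-tuple R.
Let X (i : 'I_N) : {mfun Om >-> E} := e i.
Let At i (t : E) := direction_mx (Q i) (u i) (col_of_tuple t).
Let A i w := At i (e i w).

Let indX (B : 'I_N -> set E) : (forall i, measurable (B i)) ->
  Pr (\bigcap_(i in setT) X i @^-1` B i) = (\prod_i Pr (X i @^-1` B i))%E.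
Proof.
move=> mB; have := @ind (finset.setTfor 'I_N) B mB.
rewrite (_ : [set` finset.setTfor 'I_N] = setT).
  by move=> ->; apply: eq_bigl => i; rewrite inE.
by apply/seteqP; split=> // i _ /=; rewrite inE.
Qed.

Let extend (T : nmodType) (F : 'I_N -> T) (k : nat) : T :=
  if insub k is Some i then F i else 0.

Let extendE (T : nmodType) (F : 'I_N -> T) (i : 'I_N) : extend F i = F i.
Proof. by rewrite /extend valK. Qed.

Let extendP (T : nmodType) (F : 'I_N -> T) k (kN : (k < N)%N) : extend F k = F (Ordinal kN).
Proof. exact: (extendE F (Ordinal kN)). Qed.

(** The concrete class for the martingale argument: measurability for the sigma-algebra of all
    errors but the k-th. *)
Let Past (k : nat) (g : Om -> R) : Prop :=
  forall kN : (k < N)%N,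
    measurable_fun setT (g : others (fun i => X i) (Ordinal kN) -> R).

Let PastA k : function_algebra (Past k).
Proof.
split=> [c|f g pf pg|f g pf pg] kN; first exact: measurable_cst.
- exact: measurable_funD (pf kN) (pg kN).
- exact: measurable_funM (pf kN) (pg kN).
Qed.

Let mAt i a b : measurable_fun setT (fun t : E => At i t a b).
Proof. exact: (measurable_direction_mx (u i) (QT i) (QQ i)). Qed.

Let mA i a b : measurable_fun setT (fun w => A i w a b).
Proof. exact: (measurableT_comp (mAt i a b) (measurable_funP (e i))). Qed.

Let tAt d1 (S : measurableType d1) (P : probability S R) (h : S -> E) i a b :
  measurable_fun setT (fun w => At i (h w) a b) -> tame P (fun w => At i (h w) a b).
Proof.
move=> mm; apply: (@tame_bounded _ _ _ _ _ 1) => // w.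
exact: direction_mx_entry_le1.
Qed.

Let mqt i : measurable_fun setT (fun t : E => qform (Q i) (col_of_tuple t)).
Proof. by apply: measurable_qform => k; exact: measurable_tnth. Qed.

Let mq i : measurable_fun setT (fun w => qform (Q i) (col_of_tuple (e i w))).
Proof. exact: (measurableT_comp (mqt i) (measurable_funP (e i))). Qed.

Let A_ext w k := extend (A^~ w) k.

Let pastA i k : (i < N)%N -> (k < N)%N -> i != k -> entries_in (Past k) (fun w => A_ext w i).
Proof.
move=> iN kN ik a b kN'.
rewrite (_ : (fun w => _) = (fun t => At (Ordinal iN) t a b) \o X (Ordinal iN)); last first.
  by apply/funext => w; rewrite /A_ext extendP.
apply: (measurableT_comp (mAt _ a b)); apply: others_measurable_fun.
by rewrite -(inj_eq val_inj).
Qed.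

Let B i (t : E) := At i t - m^-1 *: Q i.

Section conditional.
Variables (k : nat) (kN : (k < N)%N) (g : Om -> R) (Y : Om -> 'M[R]_n).
Let i := Ordinal kN.
Hypotheses (YT : forall w, (Y w)^T = Y w) (pY : entries_in (Past k) Y)
  (tY : entries_in (tame Pr) Y) (pg : Past k g) (tg : tame Pr g).

Let swap (h : Om -> R) (ph : Past k h) (th : tame Pr h) q :
  mean Pr (fun w => h w * \tr (B i (e i w) *m Y w) ^+ q) =
  mean Pr (fun w => h w * mean (distribution Pr (e i)) (fun t => \tr (B i t *m Y w) ^+ q)).
Proof.
pose F (t : E) (w : Om) := h w * \tr (B i t *m Y w) ^+ q.
have mean_h w : mean (distribution Pr (X i)) (F^~ w) =
    h w * mean (distribution Pr (e i)) (fun t => \tr (B i t *m Y w) ^+ q).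
  apply: meanZ; apply: tameX; have CA := function_algebra_tame (distribution Pr (e i)).
  apply: (algebra_trace CA); apply: (entriesM CA); last exact: entries_cst.
  apply: (entriesB CA); last exact: entries_cst.
  by move=> a b; apply: (@tAt _ _ _ idfun); exact: mAt.
transitivity (mean Pr (fun w => F (X i w) w)) => //.
rewrite (@mean_swap _ _ Om E R _ X i Pr indX F).
- by apply: eq_mean => w; exact: mean_h.
- have CA := @function_algebra_measurable _ (others (fun i => X i) i * E)%type R.
  apply: measurable_funM.
    exact: (measurableT_comp (ph kN) (@measurable_fst _ _ (others (fun i => X i) i) E)).
  apply: (@algebraX _ _ _ CA q (fun z => \tr (B i z.2 *m Y z.1))).
  apply: (algebra_trace CA); apply: (entriesM CA).
    apply: (entriesB CA); last exact: entries_cst.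
    move=> a b; apply: (measurableT_comp (mAt i a b)).
    exact: (@measurable_snd _ _ (others (fun i => X i) i) E).
  move=> a b.
  pose yab w : R := Y w a b.
  have pYab : measurable_fun setT (yab : others (fun i => X i) i -> R) := @pY a b kN.
  exact: (measurableT_comp pYab (@measurable_fst _ _ (others (fun i => X i) i) E)).
- have CA := function_algebra_tame Pr.
  apply: tameM => //; apply: tameX; apply: (algebra_trace CA); apply: (entriesM CA) => //.
  apply: (entriesB CA); last exact: entries_cst.
  by move=> a b; apply: tAt; exact: mA.
move=> w; have CA := function_algebra_tame (distribution Pr (X i)).
apply: tameM; first exact: tame_cst.
apply: tameX; apply: (algebra_trace CA); apply: (entriesM CA); last exact: entries_cst.
apply: (entriesB CA); last exact: entries_cst.
by move=> a b; apply: (@tAt _ _ _ idfun); exact: mAt.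
Qed.

Lemma residual_cond :
  [/\ mean Pr (fun w => g w * \tr (B i (e i w) *m Y w)) = 0,
      mean Pr (fun w => g w * \tr (B i (e i w) *m Y w) ^+ 2) =
        mean Pr (fun w => g w * (2 * kap (Q i) m (Y w) / (m * (m + 2)))) &
      mean Pr (fun w => \tr (B i (e i w) *m Y w) ^+ 4) <=
        mean Pr (fun w => 108 * kap (Q i) m (Y w) ^+ 2 / m ^+ 4)].
Proof.
split.
- transitivity (mean Pr (fun w => g w * \tr (B i (e i w) *m Y w) ^+ 1)).
    by apply: eq_mean => w; rewrite expr1.
  rewrite (swap (@pg) tg) -[RHS](mean_cst Pr 0); apply: eq_mean => w.
  rewrite (_ : mean _ _ = 0) ?mulr0//.
  rewrite -[RHS](mean_direction (s0 i) (he i) (QT i) (QQ i) (uu i) (trQ i) m0 (YT w)).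
  by apply: eq_mean => t; rewrite expr1.
- rewrite (swap (@pg) tg); apply: eq_mean => w; congr (_ * _).
  exact: (mean_direction_sqr (s0 i) (he i) (QT i) (QQ i) (uu i) (trQ i) m0 (YT w)).
- have [c1 _ _] := PastA k.
  rewrite (_ : mean Pr (fun w => \tr _ ^+ 4) = mean Pr (fun w => 1 * \tr (B i (e i w) *m Y w) ^+ 4)); last first.
    by apply: eq_mean => w; rewrite mul1r.
  rewrite (swap (@c1 1) (tame_cst Pr 1)).
  have CA := function_algebra_tame Pr.
  have CO := @function_algebra_measurable _ (Om * E)%type R.
  (* Only an inequality is available at order four, so the inner mean must itself be shown tame
     before the outer means can be compared; its measurability is Tonelli's theorem. *)
  pose h w := mean (distribution Pr (e i)) (fun t => \tr (B i t *m Y w) ^+ 4).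
  have hk w : 0 <= h w <= 108 * kap (Q i) m (Y w) ^+ 2 / m ^+ 4.
    rewrite mean_ge0/=; last by move=> t; rewrite -[4%N]/(2 * 2)%N exprM sqr_ge0.
    exact: (mean_direction_pow4 (s0 i) (he i) (QT i) (QQ i) (uu i) (trQ i) m0 (YT w)).
  have tk : tame Pr (fun w => 108 * kap (Q i) m (Y w) ^+ 2 / m ^+ 4).
    apply: tameM; last exact: tame_cst.
    by apply: tameZ; apply: tameX; exact: (algebra_kap CA).
  have th : tame Pr (fun w => 1 * h w).
    apply: (tame_le tk); last first.
      by move=> w; rewrite mul1r; have /andP[h0 h1] := hk w; rewrite !ger0_norm// (le_trans h0).
    apply: measurable_funM; first exact: measurable_cst.
    apply: (@measurable_mean_section _ _ Om E R _ (fun z => \tr (B i z.2 *m Y z.1) ^+ 4)).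
      apply: (algebraX CO 4); apply: (algebra_trace CO); apply: (entriesM CO).
        apply: (entriesB CO); last exact: entries_cst.
        by move=> a b; apply: (measurableT_comp (mAt i a b)); exact: measurable_snd.
      move=> a b; pose yab w : R := Y w a b.
      have tyab : measurable_fun setT yab := tame_measurable (tY a b).
      exact: (measurableT_comp tyab (@measurable_fst _ _ Om E)).
    by move=> z; rewrite -[4%N]/(2 * 2)%N exprM sqr_ge0.
  by apply: le_mean => // w; rewrite mul1r; have /andP[] := hk w.
Qed.

End conditional.

Lemma residual_corr_measurable i j :
  measurable_fun setT (fun w => resid_corr (Q i) (Q j) (col_of_tuple (e i w)) (col_of_tuple (e j w)) ^+ 2).
Proof.
have mr k : measurable_fun setT (fun w => (if qform (Q k) (col_of_tuple (e k w)) == 0 then 0 else 1) : R).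
  apply: measurable_fun_ifT; [|exact: measurable_cst|exact: measurable_cst].
  apply: measurable_fun_eqr; last exact: measurable_cst.
  exact: mq.
rewrite (_ : (fun w => _) = (fun w => (if qform (Q i) (col_of_tuple (e i w)) == 0 then 0 else 1) *
   ((if qform (Q j) (col_of_tuple (e j w)) == 0 then 0 else 1) * \tr (A i w *m A j w)))); last first.
  by apply/funext => w; rewrite (resid_corr_sqr (u i) (u j)).
apply: measurable_funM => //; apply: measurable_funM => //.
have CM := @function_algebra_measurable _ Om R.
by apply: (algebra_trace CM); apply: (entriesM CM) => a b; exact: mA.
Qed.

Definition residual_statistic w : R :=
  (\sum_(i < N) \sum_(j < N | (i < j)%N)
     n%:R * resid_corr (Q i) (Q j) (col_of_tuple (e i w)) (col_of_tuple (e j w)) ^+ 2 -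
   n%:R / m ^+ 2 * \sum_(i < N) \sum_(j < N | (i < j)%N) \tr (Q i *m Q j)) / N%:R.

Lemma measurable_residual_statistic : measurable_fun setT residual_statistic.
Proof.
apply: measurable_funM; last exact: measurable_cst.
apply: measurable_funB; last exact: measurable_cst.
apply: measurable_sumr => i; apply: measurable_sum_cond => j ij.
by apply: measurable_funM; [exact: measurable_cst|exact: residual_corr_measurable].
Qed.

(** Nonzero exactly when no residual vanishes, which is almost sure by a union bound over i. *)
Let r w := \prod_i qform (Q i) (col_of_tuple (e i w)).

Let r_ae : mean Pr (fun w => (r w == 0)%:R) = 0.
Proof.
have mind d1 (S : measurableType d1) (g : S -> R) : measurable_fun setT g ->
    measurable_fun setT (fun w => (g w == 0)%:R : R).
  move=> mg; rewrite (_ : (fun w => _) = (fun w => if g w == 0 then 1 else 0)).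
    apply: measurable_fun_ifT; [|exact: measurable_cst|exact: measurable_cst].
    by apply: measurable_fun_eqr => //; exact: measurable_cst.
  by apply/funext => w; case: eqP.
have tind d1 (S : measurableType d1) (P : probability S R) (g : S -> R) :
    measurable_fun setT g -> tame P (fun w => (g w == 0)%:R : R).
  move=> mg; apply: (@tame_bounded _ _ _ _ _ 1); first exact: mind.
  by move=> w; case: (g w == 0); rewrite ?normr1 ?normr0.
have mr : measurable_fun setT r by apply: measurable_prod => i _; exact: mq.
apply/eqP; rewrite eq_le mean_ge0 ?andbT//.
have tsum : tame Pr (fun w => \sum_i (qform (Q i) (col_of_tuple (e i w)) == 0)%:R).
  by apply: tame_sum => i _; apply: tind; exact: mq.
apply: (@le_trans _ _ (mean Pr (fun w => \sum_i (qform (Q i) (col_of_tuple (e i w)) == 0)%:R))).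
  apply: le_mean => //; first exact: tind.
  move=> w; case: (boolP (r w == 0)) => [|_]; last by apply: sumr_ge0.
  rewrite /r => /prodf_eq0 [i _ /eqP qi]; rewrite (bigD1 i)//= qi eqxx lerDl.
  by apply: sumr_ge0.
rewrite mean_sum; last by move=> i _; apply: tind; exact: mq.
rewrite big1// => i _.
rewrite -[RHS](direction_ae (s0 i) (he i) (QT i) (QQ i) (trQ i) m0).
by rewrite mean_distribution//; exact: tind.
Qed.

(** Off the null event r = 0 the statistic equals the martingale [S], by [resid_corr_sqr] and
    [martingale_decomposition]; [core_bound] then applies with K_k = (1 / m) sum_(j != k) (1 -
    Q_j). *)
Lemma residual_statistic_bound Af f f1 f2 : smooth3 Af f f1 f2 ->
  `|mean Pr (fun w => f (residual_statistic w)) - mean (normal_prob 0 1) f| <=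
  Af * core_const p * (Num.sqrt N%:R / m + Num.sqrt N%:R^-1).
Proof.
move=> sf.
have [cf _ _] := smooth3_continuous sf.
pose Qx := extend Q.
pose Kx := extend (fun k => m^-1 *: \sum_(j | j != k) (1%:M - Q j)).
pose S w := \sum_(k < N) n%:R / N%:R * \tr ((A_ext w k - m^-1 *: Qx k) *m
  (\sum_(i < k) (A_ext w i - m^-1 *: Qx i) - Kx k)).
have SE w : S w = n%:R / N%:R * (\sum_(i < N) \sum_(j < N | (i < j)%N) \tr (A i w *m A j w) -
  m^-1 ^+ 2 * \sum_(i < N) \sum_(j < N | (i < j)%N) \tr (Q i *m Q j)).
  rewrite -(martingale_decomposition (A := A^~ w) _ trQ (lt0r_neq0 m0)); last first.
    by move=> i; exact: direction_mx_trace.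
  rewrite mulr_sumr; apply: eq_bigr => i _; congr (_ * \tr (_ *m _)).
    by rewrite /A_ext /Qx !extendE.
  rewrite /Kx extendE; congr (_ - _).
  rewrite (big_ord_widen N (fun j => A_ext w j - m^-1 *: Qx j) (ltnW (ltn_ord i))).
  by apply: eq_bigr => j _; rewrite /A_ext /Qx !extendE.
have tA : forall i, entries_in (tame Pr) (A i) by move=> i a b; apply: tAt; exact: mA.
have CA := function_algebra_tame Pr.
have tS : measurable_fun setT S.
  rewrite (_ : S = (fun w => n%:R / N%:R * (\sum_(i < N) \sum_(j < N | (i < j)%N) \tr (A i w *m A j w) -
  m^-1 ^+ 2 * \sum_(i < N) \sum_(j < N | (i < j)%N) \tr (Q i *m Q j)))); last exact/funext.
  apply: measurable_funM; first exact: measurable_cst.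
  apply: measurable_funB; last exact: measurable_cst.
  apply: measurable_sumr => i; apply: measurable_sum_cond => j ij.
    by apply: (tame_measurable (P := Pr)); apply: (algebra_trace CA); exact: entriesM.
have f01 x : `|f x| <= Af by case: sf => h _ _ _ _; have [] := h x.
have -> : mean Pr (fun w => f (residual_statistic w)) = mean Pr (fun w => f (S w)).
  apply: (@mean_ae_eq _ _ _ _ _ _ r).
  - apply: (@tame_bounded_comp _ _ R Pr Af f residual_statistic) => //; exact: measurable_residual_statistic.
  - exact: (@tame_bounded_comp _ _ R Pr Af f S).
  - by apply: measurable_prod => i _; exact: mq.
  - exact: r_ae.
  move=> w rw; congr f; rewrite SE /residual_statistic.
  have ri i : qform (Q i) (col_of_tuple (e i w)) != 0.
    by move: rw; rewrite /r prodf_seq_neq0 => /allP/(_ i); rewrite mem_index_enum => /(_ isT).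
  have -> : \sum_(i < N) \sum_(j < N | (i < j)%N)
     n%:R * resid_corr (Q i) (Q j) (col_of_tuple (e i w)) (col_of_tuple (e j w)) ^+ 2 =
     n%:R * \sum_(i < N) \sum_(j < N | (i < j)%N) \tr (A i w *m A j w).
    rewrite mulr_sumr; apply: eq_bigr => i _; rewrite mulr_sumr; apply: eq_bigr => j _.
    by rewrite (resid_corr_sqr (u i) (u j))// !ifN// !mul1r.
  by field; rewrite gt_eqF ?m0// pnatr_eq0 -lt0n.
apply: (@core_bound _ Om R Pr n N m p Qx (fun k w => A_ext w k) Past m1 p0 nE PastA
  _ _ _ _ _ _ _ _ pastA _ Kx N0 Nm _ _ _ Af f f1 f2 sf).
- by move=> k kN; rewrite /Qx extendP.
- by move=> k kN; rewrite /Qx extendP.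
- by move=> k kN; rewrite /Qx extendP.
- by move=> k w kN; rewrite /A_ext extendP; exact: direction_mx_sym.
- by move=> k w kN; rewrite /A_ext extendP; exact: direction_mx_idem.
- by move=> k w kN; rewrite /A_ext extendP; exact: direction_mx_trace.
- by move=> k w kN; rewrite /A_ext /Qx !extendP; exact: proj_direction_mx.
- move=> k kN a b; apply: (eq_tame (tA (Ordinal kN) a b)) => w.
  by rewrite /A_ext extendP.
- move=> k g Y kN YT pY tY pg tg.
  have [h1 h2 h3] := @residual_cond k kN g Y YT pY tY pg tg.
  rewrite /Qx extendP; split.
  + by rewrite -[RHS]h1; apply: eq_mean => w; rewrite /A_ext extendP.
  + by rewrite -h2; apply: eq_mean => w; rewrite /A_ext extendP.
  + apply: le_trans h3; rewrite le_eqVlt; apply/orP; left; apply/eqP.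
    by apply: eq_mean => w; rewrite /A_ext extendP.
- move=> k kN; rewrite /Kx extendP linearZ/= linear_sum/=; congr (_ *: _).
  by apply: eq_bigr => j _; rewrite linearB/= trmx1 QT.
- move=> k kN; rewrite /Kx extendP -scalemxAl -scalemxAr !mxtraceZ mulrA -expr2 exprVn mulrC.
  by rewrite ler_wpM2r ?invr_ge0 ?sqr_ge0//; exact: mxtrace_complement_sqr QT QQ trQ nE p0.
- move=> k g h cg ph kN.
  exact: (measurableT_comp (continuous_measurable_fun cg) (ph kN)).
Qed.

End residual_design.

(** * Least-squares residual projections and the passage to the limit *)

Section residual_projection.
Context (R : realType) (T p : nat) (x : 'M[R]_(T, p)).
Hypothesis hx : x^T *m x \in unitmx.

Lemma resid_proj_sym : (resid_proj x)^T = resid_proj x.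
Proof.
by rewrite /resid_proj linearB/= trmx1 !trmx_mul trmxK trmx_inv trmx_mul trmxK mulmxA.
Qed.

Lemma resid_proj_idem : resid_proj x *m resid_proj x = resid_proj x.
Proof.
rewrite /resid_proj mulmxBl !mulmxBr !mulmx1 mul1mx.
rewrite (_ : x *m invmx (x^T *m x) *m x^T *m (x *m invmx (x^T *m x) *m x^T) =
  x *m invmx (x^T *m x) *m x^T); first by rewrite subrr subr0.
by rewrite -!mulmxA (mulmxA x^T) (mulmxA (x^T *m x)) mulmxV// mul1mx.
Qed.

Lemma resid_proj_trace : \tr (resid_proj x) = T%:R - p%:R.
Proof.
by rewrite /resid_proj mxtraceB mxtrace1 -mulmxA mxtrace_mulC -mulmxA mulVmx// mxtrace1.
Qed.

End residual_projection.

(** A nonzero trace forces some Q_jj != 0; column j of Q lies in the range of Q and has squared norm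
    Q_jj. *)
Lemma exists_unit_vector (R : realType) n (Q : 'M[R]_n) :
  Q^T = Q -> Q *m Q = Q -> \tr Q != 0 ->
  exists u : 'cV[R]_n, Q *m u = u /\ u^T *m u = 1%:M.
Proof.
move=> QT QQ trQ.
have [j Qj] : exists j, Q j j != 0.
  apply/existsP; apply: contraNT trQ; rewrite negb_exists => /forallP h.
  by rewrite /mxtrace big1// => i _; apply/eqP; have := h i; rewrite negbK.
have Qjj : (col j Q)^T *m col j Q = (Q j j)%:M.
  apply/matrixP => a b; rewrite !ord1 [RHS]mxE mulr1n -[in RHS]QQ -{1}[in RHS]QT !mxE.
  by apply: eq_bigr => k _; rewrite !mxE.
have Q0 : 0 <= Q j j.
  by rewrite -QQ mxE; apply: sumr_ge0 => k _; rewrite -{2}QT mxE -expr2 sqr_ge0.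
exists ((Num.sqrt (Q j j))^-1 *: col j Q); split.
  by rewrite -scalemxAr colE mulmxA QQ.
rewrite [(_ *: _)^T]linearZ/= -scalemxAl -scalemxAr Qjj scalerA -invfM -expr2 sqr_sqrtr//.
by rewrite scale_scalar_mx mulVf.
Qed.

Theorem theorem1 (R : realType) (p : nat) (T : nat -> nat)
  (hTp : forall N : nat, (p < T N)%N)
  (hT : (T N)%:R / Num.sqrt (N%:R : R) @[N --> \oo] --> +oo)
  (x : forall N : nat, 'I_N -> 'M[R]_(T N, p))
  (hx : forall (N : nat) (i : 'I_N), (x N i)^T *m x N i \in unitmx)
  (d : nat -> measure_display) (Om : forall N : nat, measurableType (d N))
  (Pr : forall N : nat, probability (Om N) R)
  (sigma : forall N : nat, 'I_N -> R)
  (hsigma : forall (N : nat) (i : 'I_N), 0 < sigma N i)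
  (eps : forall N : nat, 'I_N -> {RV (Pr N) >-> (T N).-tuple R})
  (hindep : forall N : nat, mutually_independent (eps N))
  (hnormal : forall (N : nat) (i : 'I_N),
     multinormal_law (eps N i) 0 ((sigma N i ^+ 2)%:M)) :
  cvg_in_distribution Pr
    (fun (N : nat) (w : Om N) =>
       (corr_stat (x N) (fun i : 'I_N => col_of_tuple (eps N i w))
        - corr_center (x N)) / N%:R)
    (normal_prob 0 1).
Proof.
pose Q N i := resid_proj (x N i).
pose m N : R := (T N)%:R - p%:R.
have m1 N : 1 <= m N by rewrite /m lerBrDr addrC natr1 ler_nat.
have m0 N : 0 < m N by exact: lt_le_trans (m1 N).
have QT N i : (Q N i)^T = Q N i by exact: resid_proj_sym.
have QQ N i : Q N i *m Q N i = Q N i by exact: resid_proj_idem.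
have trQ N i : \tr (Q N i) = m N by exact: resid_proj_trace.
have hex N i : {v : 'cV[R]_(T N) | Q N i *m v = v /\ v^T *m v = 1%:M}.
  by apply: cid; apply: exists_unit_vector; rewrite // trQ gt_eqF.
pose u N i := sval (hex N i).
have hu N i : Q N i *m u N i = u N i /\ (u N i)^T *m u N i = 1%:M by exact: svalP (hex N i).
have Qu N i : Q N i *m u N i = u N i by have [] := hu N i.
have uu N i : (u N i)^T *m u N i = 1%:M by have [] := hu N i.
apply: cvg_in_distribution_smooth3 => [N|A f f1 f2 sf].
  exact: (measurable_residual_statistic (eps N) (u N) (m N) (QT N) (QQ N)).
have A0 := smooth3_ge0 sf.
apply/cvgrPdist_le => /= e e0.
pose C := `|A * core_const p%:R| + 1.
have C0 : 0 < C by rewrite ltr_wpDl.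
(* Both rates will be at most [del], so the final bound is C (del + del) = e. *)
pose del := e / (2 * C).
have del0 : 0 < del by rewrite divr_gt0// mulr_gt0.
move/cvgryPge : hT => hT.
near=> N.
have N0 : (0 < N)%N by near: N; exact: nbhs_infty_gt.
have N1 : 1 <= Num.sqrt (N%:R : R) by rewrite -{1}sqrtr1; apply: ler_wsqrtr; rewrite ler1n.
have Ns : 0 < Num.sqrt (N%:R : R) by exact: lt_le_trans N1.
(* As p <= p sqrt N, the summand p turns this bound on T into m >= (1 + 1 / del) sqrt N. There the 1
   gives N <= m^2 and 1 / del gives sqrt N / m <= del. *)
have TK : p%:R + (1 + del^-1) <= (T N)%:R / Num.sqrt (N%:R : R) by near: N; exact: hT.
have Nd : (del ^+ 2)^-1 <= N%:R by near: N; exact: nbhs_infty_ger.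
have mK : (1 + del^-1) * Num.sqrt N%:R <= m N.
  move: TK; rewrite ler_pdivlMr// mulrDl /m => TK.
  have : p%:R <= p%:R * Num.sqrt N%:R :> R by rewrite ler_peMr.
  lra.
have d0 : 0 < del^-1 by rewrite invr_gt0.
have Nm : N%:R <= m N ^+ 2.
  rewrite -[leLHS](@sqr_sqrtr R)//; apply: lerXn2r; rewrite ?nnegrE ?sqrtr_ge0 ?(ltW (m0 N))//.
  by apply: le_trans mK; rewrite ler_peMl ?sqrtr_ge0// lerDl ltW.
have b1 : Num.sqrt N%:R / m N <= del.
  rewrite ler_pdivrMr// -ler_pdivrMl//; apply: le_trans mK.
  by rewrite ler_wpM2r ?sqrtr_ge0// lerDr.
have b2 : Num.sqrt (N%:R^-1) <= del.
  rewrite -[del]ger0_norm ?(ltW del0)// -sqrtr_sqr; apply: ler_wsqrtr.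
  by rewrite -[leRHS]invrK lef_pV2// posrE ?ltr0n// invr_gt0 exprn_gt0.
rewrite distrC.
have H := residual_statistic_bound (hsigma N) (hnormal N) (@hindep N) (QT N) (QQ N) (Qu N)
  (uu N) (trQ N) (m1 N) (ler0n _ p) _ N0 Nm sf.
apply: le_trans (H _) _; first by rewrite /m subrK.
apply: (@le_trans _ _ (C * (del + del))).
  apply: (@le_trans _ _ (C * (Num.sqrt N%:R / m N + Num.sqrt N%:R^-1))).
    rewrite ler_wpM2r//; first by rewrite addr_ge0// divr_ge0 ?sqrtr_ge0// ltW.
    by rewrite (le_trans (ler_norm _))// lerDl.
  by rewrite ler_wpM2l ?(ltW C0)//; exact: lerD.
by rewrite /del le_eqVlt; apply/orP; left; apply/eqP; field; rewrite gt_eqF.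
Unshelve. all: by end_near. Qed.
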